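(* Let $T$ be a canonical theory. If $(N_n)_{n\in\mathbb N}$ is a convergent sequence of finite models of $T$, then there exists a weak $T$-on $\mathcal N$ such that for every finite model $M$ of $T$, $\lim_{n\to\infty}p(M,N_n)=p(M,\mathcal N)$, $\lim_{n\to\infty}t_{\mathrm{ind}}(M,N_n)=t_{\mathrm{ind}}(M,\mathcal N)$ and $\lim_{n\to\infty}t_{\mathrm{inj}}(M,N_n)=t_{\mathrm{inj}}(M,\mathcal N)$. Conversely, if $\mathcal N$ is a weak $T$-on, then there exists a convergent sequence $(N_n)_{n\in\mathbb N}$ of finite models of $T$ such that these three equalities hold for every finite model $M$ of $T$.
   Context: A language $\mathcal L$ is a finite set of predicate symbols, each $P$ with an arity $k(P)\ge1$ (no constants/function symbols; equality allowed). A universal theory $T$ is a set of universal formulas (axioms) $\forall\vec xF(\vec x)$, $F$ open. A structure $M$ is a set $V(M)$ with relations $R_{P,M}\subseteq V(M)^{k(P)}$; a model of $T$ satisfies all axioms. $T$ is canonical if for every $P$ of arity $k$ and $i<j$, $T$ entails $x_i=x_j\to\neg P(x_1,\dots,x_k)$; a structure is canonical if no $R_{P,M}$ contains a tuple with repeated entries. Finite densities: for finite models $M,N$ with $|V(M)|\le|V(N)|$, $p(M,N)$ is the probability that for a uniformly random $|V(M)|$-element subset $U\subseteq V(N)$ the induced substructure $N|_U$ is isomorphic to $M$; $t_{\mathrm{ind}}(M,N)$ is the probability that a uniformly random injection $\alpha:V(M)\to V(N)$ is an induced embedding (for every $P$ and distinct $v_1,\dots,v_k\in V(M)$, $(v_1,\dots,v_k)\in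 R_{P,M}$ iff $(\alpha(v_1),\dots,\alpha(v_k))\in R_{P,N}$); $t_{\mathrm{inj}}(M,N)$ is the probability that it is a positive embedding (only the ''only if'' direction required). All three are $0$ if $|V(M)|>|V(N)|$. A sequence $(N_n)$ of finite models is convergent if $|V(N_n)|<|V(N_{n+1})|$ for all $n$ and $\lim_n p(M,N_n)$ exists for every finite model $M$ of $T$. Euclidean objects: $r(V)$ is the set of non-empty finite subsets of $V$, $\mathcal E_V=[0,1]^{r(V)}$ with Lebesgue measure $\lambda$, $\mathcal E_k=\mathcal E_{[k]}$; for an injection $\alpha:[k]\to V$, $\alpha^*(x)_A=x_{\alpha(A)}$. A Euclidean structure $\mathcal N$ assigns to each $P$ a Lebesgue measurable $\mathcal N_P\subseteq\mathcal E_{k(P)}$. For finite $M$, $R_P(M)$ (resp. $\overline R_P(M)$) is the set of injections $\alpha:[k(P)]\to V(M)$ with $(\alpha(1),\dots,\alpha(k(P)))\in R_{P,M}$ (resp. $\notin$); $T_{\mathrm{inj}}(M,\mathcal N)=\bigcap_P\bigcap_{\alpha\in R_P(M)}(\alpha^* )^{-1}(\mathcal N_P)$, $T_{\mathrm{ind}}(M,\mathcal N)=T_{\mathrm{inj}}(M,\mathcal N)\cap\bigcap_P\bigcap_{\alpha\in\overline R_P(M)}(\alpha^* )^{-1}(\mathcal E_{k(P)}\setminus\mathcal N_P)$, $t_{\mathrm{inj}}=\lambda(T_{\mathrm{inj}})$, $t_{\mathrm{ind}}=\lambda(T_{\mathrm{ind}})$, $p(M,\mathcal N)=\frac{|V(M)|!}{|\mathrm{Aut}(M)|}t_{\mathrm{ind}}(M,\mathcal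 N)$. A weak $T$-on is a Euclidean structure with $t_{\mathrm{ind}}(M,\mathcal N)=0$ for every finite canonical structure $M$ that is not a model of $T$. *)

(* Defs.v *)
From HB Require Import structures.
From mathcomp Require Import all_boot all_order all_fingroup all_algebra.
From mathcomp Require Import all_classical all_reals all_analysis.
From mathcomp Require Import measurable_realfun.

Set Implicit Arguments.
Unset Strict Implicit.
Unset Printing Implicit Defensive.

Import Order.TTheory GRing.Theory Num.Theory.
Import numFieldTopology.Exports.

Local Open Scope classical_set_scope.
Local Open Scope ring_scope.

Record language := Language {
  symbol :> finType;
  arity : symbol -> nat;
  arity_gt0 : forall P, (0 < arity P)%N }.

(* k-tuples of elements of V are functions 'I_k -> V; V may be empty. *)
Definition structure (L : language) (V : Type) :=
  forall P : L, set ('I_(arity P) -> V).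

Inductive open_formula (L : language) (n : nat) :=
| FBot
| FEq of 'I_n & 'I_n
| FPred (P : L) of ('I_(arity P) -> 'I_n)
| FNot of open_formula L n
| FAnd of open_formula L n & open_formula L n
| FOr of open_formula L n & open_formula L n
| FImp of open_formula L n & open_formula L n.
Arguments FBot {L n}.
Arguments FEq {L n}.
Arguments FPred {L n}.

Fixpoint holds (L : language) (V : Type) (M : structure L V) (n : nat)
    (x : 'I_n -> V) (F : open_formula L n) : Prop :=
  match F with
  | FBot => False
  | FEq i j => x i = x j
  | FPred P a => M P (x \o a)
  | FNot F1 => ~ holds M x F1
  | FAnd F1 F2 => holds M x F1 /\ holds M x F2
  | FOr F1 F2 => holds M x F1 \/ holds M x F2
  | FImp F1 F2 => holds M x F1 -> holds M x F2
  end.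

(* The universal closure of [matrix], over its [nvars] variables. *)
Record universal_formula (L : language) := Forall {
  nvars : nat;
  matrix : open_formula L nvars }.

Definition satisfies (L : language) (V : Type) (M : structure L V)
    (phi : universal_formula L) : Prop :=
  forall x : 'I_(nvars phi) -> V, holds M x (matrix phi).

Definition theory (L : language) := set (universal_formula L).

Definition models (L : language) (T : theory L) (V : Type)
    (M : structure L V) : Prop :=
  forall phi, T phi -> satisfies M phi.

Definition entails (L : language) (T : theory L)
    (phi : universal_formula L) : Prop :=
  forall (V : Type) (M : structure L V), models T M -> satisfies M phi.

Definition canonical_theory (L : language) (T : theory L) : Prop :=
  forall (P : L) (i j : 'I_(arity P)), (i < j)%N ->
  entails T (Forall (FImp (FEq i j) (FNot (FPred P id)))).

Definition canonical_structure (L : language) (V : Type)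
    (M : structure L V) : Prop :=
  forall P x, M P x -> injective x.

Record finstructure (L : language) := FinStructure {
  vertices :> finType;
  rel_of : structure L vertices }.
Arguments rel_of {L} _ _ _.

Section finite_densities.
Context (R : realType) (L : language).
Implicit Types M N : finstructure L.

Definition is_isomorphism M N (f : M -> N) : Prop :=
  bijective f /\ forall P x, rel_of M P x <-> rel_of N P (f \o x).

Definition isomorphic M N : Prop := exists f : M -> N, is_isomorphism f.

Definition induced_on N (U : {set N}) : finstructure L :=
  @FinStructure L {v : N | v \in U} (fun P x => rel_of N P (val \o x)).

Definition induced_embedding M N (f : M -> N) : Prop :=
  forall P x, injective x -> (rel_of M P x <-> rel_of N P (f \o x)).

Definition positive_embedding M N (f : M -> N) : Prop :=
  forall P x, injective x -> rel_of M P x -> rel_of N P (f \o x).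

Definition injections M N : {set {ffun M -> N}} :=
  [set f : {ffun M -> N} | injectiveb f]%SET.

Definition p_fin M N : R :=
  if (#|M| <= #|N|)%N then
    #|[set U : {set N} | (#|U| == #|M|) && `[< isomorphic (induced_on U) M >]]%SET|%:R
    / #|[set U : {set N} | #|U| == #|M|]%SET|%:R
  else 0.

Definition tind_fin M N : R :=
  if (#|M| <= #|N|)%N then
    #|[set f in injections M N | `[< induced_embedding f >]]%SET|%:R
    / #|injections M N|%:R
  else 0.

Definition tinj_fin M N : R :=
  if (#|M| <= #|N|)%N then
    #|[set f in injections M N | `[< positive_embedding f >]]%SET|%:R
    / #|injections M N|%:R
  else 0.

Definition automorphisms M : {set {perm M}} :=
  [set s : {perm M} | `[< is_isomorphism s >]]%SET.

Definition convergent (T : theory L) (N : nat -> finstructure L) : Prop :=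
  (forall n, (#|N n| < #|N n.+1|)%N) /\
  (forall M, models T (rel_of M) -> cvgn (fun n => p_fin M (N n))).

End finite_densities.

Section cons_pair.
Context d (T : measurableType d) (n : nat).

Definition cons_pair (x : T * n.-tuple T) : n.+1.-tuple T :=
  [the n.+1.-tuple T of x.1 :: x.2].

Lemma measurable_cons_pair : measurable_fun [set: T * n.-tuple T] cons_pair.
Proof. exact: measurable_cons. Qed.

HB.instance Definition _ :=
  isMeasurableFun.Build _ _ _ _ cons_pair measurable_cons_pair.

End cons_pair.

Section lebesgue_cube.
Context (R : realType).

(* The n-fold product of Lebesgue measure on [0,1], as a Borel probability
   measure on R^n. *)
Fixpoint cube_prob (n : nat) : probability (n.-tuple (measurableTypeR R)) R :=
  match n with
  | 0 => \d_[tuple]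
  | m.+1 => distribution (uniform_prob (@ltr01 R) \x cube_prob m)%E
              (@cons_pair _ (measurableTypeR R) m)
  end.

Definition cube (I : Type) : set (I -> R) :=
  [set x | forall i, x i \in `[0, 1]].

(* Identification of R^#|I| with R^I along the enumeration of I. *)
Definition tuple_fun (I : finType) (t : #|I|.-tuple (measurableTypeR R)) :
  I -> R := fun i => tnth t (enum_rank i).

(* Up to a null set, A is Borel; meant for A contained in the cube, outside
   which everything is null. *)
Definition lebesgue_measurable (I : finType) (A : set (I -> R)) : Prop :=
  completed_algebra_gen (cube_prob #|I|) (@tuple_fun I @^-1` A).

(* The outer measure generated by [cube_prob], which on Lebesgue measurable
   sets is the completed measure; it never exceeds 1, so [fine] is harmless. *)
Definition lebesgue_cube (I : finType) (A : set (I -> R)) : R :=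
  fine (mu_ext (cube_prob #|I|) (@tuple_fun I @^-1` A)).

End lebesgue_cube.
Arguments cube : clear implicits.

(* r(V), the non-empty subsets of V. *)
Definition rset (V : finType) := {A : {set V} | A != finset.set0}.

Lemma imset_neq0 (U V : finType) (f : U -> V) (A : rset U) :
  (f @: val A)%SET != finset.set0.
Proof. by rewrite imset_eq0 (valP A). Qed.

Definition r_image (U V : finType) (f : U -> V) (A : rset U) : rset V :=
  exist _ (f @: val A)%SET (imset_neq0 f A).

(* The Euclidean cube E_V = [0,1]^{r(V)}; E_k is [euclid R 'I_k]. *)
Definition euclid (R : realType) (V : finType) : set (rset V -> R) :=
  cube R (rset V).
Arguments euclid : clear implicits.

(* alpha^* : E_V -> E_U. *)
Definition pullback (R : realType) (U V : finType) (alpha : U -> V)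
    (x : rset V -> R) : rset U -> R :=
  fun A => x (r_image alpha A).

Record euclidean_structure (R : realType) (L : language) :=
  EuclideanStructure {
    peon : forall P : L, set (rset 'I_(arity P) -> R);
    peon_sub : forall P, @peon P `<=` euclid R 'I_(arity P);
    peon_measurable : forall P, lebesgue_measurable (@peon P) }.
Arguments peon {R L} _ _ _.

Section euclidean_densities.
Context (R : realType) (L : language).
Implicit Types (M : finstructure L) (E : euclidean_structure R L).

Definition Rel M (P : L) : set ('I_(arity P) -> M) :=
  [set alpha | injective alpha /\ rel_of M P alpha].
Arguments Rel : clear implicits.

Definition coRel M (P : L) : set ('I_(arity P) -> M) :=
  [set alpha | injective alpha /\ ~ rel_of M P alpha].
Arguments coRel : clear implicits.

Definition Tinj M E : set (rset M -> R) :=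
  euclid R M `&`
  \bigcap_(P in [set: L]) \bigcap_(alpha in Rel M P)
    (pullback alpha @^-1` peon E P).
Arguments Tinj : clear implicits.

Definition Tind M E : set (rset M -> R) :=
  Tinj M E `&`
  \bigcap_(P in [set: L]) \bigcap_(alpha in coRel M P)
    (pullback alpha @^-1` (euclid R 'I_(arity P) `\` peon E P)).
Arguments Tind : clear implicits.

Definition tinj_euc M E : R := lebesgue_cube (Tinj M E).

Definition tind_euc M E : R := lebesgue_cube (Tind M E).

Definition p_euc M E : R := (#|M| `!)%:R / #|automorphisms M|%:R * tind_euc M E.

Definition weak_on (T : theory L) E : Prop :=
  forall M, canonical_structure (rel_of M) -> ~ models T (rel_of M) ->
  tind_euc M E = 0.

Definition converges_to (T : theory L) (N : nat -> finstructure L) E : Prop :=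
  forall M, models T (rel_of M) ->
  [/\ p_fin R M (N n) @[n --> \oo] --> p_euc M E,
      tind_fin R M (N n) @[n --> \oo] --> tind_euc M E &
      tinj_fin R M (N n) @[n --> \oo] --> tinj_euc M E].

End euclidean_densities.
Arguments Rel {L} M P _.
Arguments coRel {L} M P _.
Arguments Tinj {R L} M E _.
Arguments Tind {R L} M E _.

(* Main.v *)
(* A weak T-on carries the same information as a law: a consistent,
   permutation-invariant family of distributions of structures on finite vertex
   sets, supported on models of T, under which disjoint vertex sets are
   independent.

   Random injections into N_n define such distributions up to an error
   O(1/|N_n|), hence exactly in the limit. The limiting law is represented over
   the cube by a finitary proof of the Aldous-Hoover theorem. Add n
   hidden vertices and generate the tuples that meet exactly j visible vertices
   layer by layer, using for each j-set the coordinate attached to it and the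
   conditional distribution given the layers below. As n grows these conditional
   probabilities form a bounded martingale; along a sequence of levels with
   summable increments they converge almost surely, and the patterns on distinct
   j-sets become conditionally independent because the vertices outside a j-set
   can be traded for hidden ones. The coordinate of the empty set is then fixed:
   by independence over disjoint sets, first and second moments agree, so almost
   every value of it gives the same law.

   Conversely, sample a structure on m vertices from the T-on. It is almost
   surely a model, and the variance of each of its densities is O(1/m), so some
   model on m vertices has finitely many prescribed densities close to the
   expected ones. *)

Require Import Defs.
From HB Require Import structures.
From mathcomp Require Import all_boot all_order all_fingroup all_algebra.
From mathcomp Require Import all_classical all_reals all_analysis.
From mathcomp Require Import measurable_realfun.
From mathcomp Require Import lra zify.

Set Implicit Arguments.
Unset Strict Implicit.
Unset Printing Implicit Defensive.

Import Order.TTheory GRing.Theory Num.Theory.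
Import numFieldTopology.Exports numFieldNormedType.Exports.

Local Open Scope ring_scope.

(** * Finite probability *)

(** The classical proof conditions on sigma-algebras of an infinite exchangeable array. Here the
    hidden vertices are a finite stand-in for the remaining vertices, so each conditional
    probability is a quotient of finite sums and each information is a map between finite types. One
    quantity governs all estimates: the second moment [en] of the conditional probability of a
    pattern. It increases with the level and is at most 1, and its gaps bound both the increments of
    the martingale (Pythagoras) and the defect of conditional independence (hiding vertices raises
    the level by #|V|). The levels are chosen with gaps at most 8^-i: by Chebyshev an increment
    reaches 2^-i with probability at most 2^-i, which is summable.

    Two obstacles shape the construction. A j-set has no preferred labelling, so its vertices are
    ordered by their own coordinates, almost surely distinct; invariance of the law under
    relabelling shows that this choice does no harm. And one coordinate must fix the pattern of a
    j-set consistently at every level, which is why patterns are coded by nested intervals. *)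

Section finite_probability.
Context (R : realFieldType).

Definition is_dist (S : finType) (P : S -> R) :=
  (forall s, 0 <= P s) /\ \sum_s P s = 1.

Definition Ex (S : finType) (P F : S -> R) : R := \sum_s P s * F s.

Definition Pr (S : finType) (P : S -> R) (B : pred S) : R :=
  \sum_(s | B s) P s.

Definition push (S T : finType) (g : S -> T) (P : S -> R) (t : T) : R :=
  Pr P (fun s => g s == t).

(** On a fibre of probability zero the quotient is 0, so [cond] stays between 0 and 1 without a
    positivity hypothesis. *)
Definition cond (S T : finType) (P : S -> R) (pi : S -> T) (Q : pred S)
    (t : T) : R :=
  Pr P (fun s => Q s && (pi s == t)) / Pr P (fun s => pi s == t).

(** The squared L2 norm of a conditional expectation; refining [pi] increases it, as in energy
    increment arguments. *)
Definition energy (S T : finType) (P : S -> R) (pi : S -> T) (Q : pred S) : R :=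
  Ex P (fun s => cond P pi Q (pi s) ^+ 2).

Lemma eq_Ex (S : finType) (P F G : S -> R) : F =1 G -> Ex P F = Ex P G.
Proof. by move=> FG; apply: eq_bigr => s _; rewrite FG. Qed.

Lemma ExB (S : finType) (P F G : S -> R) :
  Ex P (fun s => F s - G s) = Ex P F - Ex P G.
Proof.
by rewrite /Ex -sumrB; apply: eq_bigr => s _; rewrite mulrBr.
Qed.

Lemma ExD (S : finType) (P F G : S -> R) :
  Ex P (fun s => F s + G s) = Ex P F + Ex P G.
Proof.
by rewrite /Ex -big_split; apply: eq_bigr => s _; rewrite mulrDr.
Qed.

Lemma ExZ (S : finType) (P F : S -> R) c :
  Ex P (fun s => c * F s) = c * Ex P F.
Proof. by rewrite /Ex mulr_sumr; apply: eq_bigr => s _; rewrite mulrCA. Qed.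

Lemma ExPr (S : finType) (P : S -> R) (B : pred S) :
  Ex P (fun s => (B s)%:R) = Pr P B.
Proof.
rewrite /Ex /Pr [RHS]big_mkcond; apply: eq_bigr => s _.
by case: (B s); rewrite ?mulr1 ?mulr0.
Qed.

Lemma eq_Pr (S : finType) (P : S -> R) (B C : pred S) :
  B =1 C -> Pr P B = Pr P C.
Proof. by move=> BC; apply: eq_bigl. Qed.

Lemma Ex_push (S T : finType) (g : S -> T) (P : S -> R) (F : T -> R) :
  Ex (push g P) F = Ex P (F \o g).
Proof.
rewrite /Ex [RHS](partition_big g predT)//=; apply: eq_bigr => t _.
rewrite /push /Pr mulr_suml; apply: eq_bigr => s /eqP <- //.
Qed.

Lemma Pr_push (S T : finType) (g : S -> T) (P : S -> R) (B : pred T) :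
  Pr (push g P) B = Pr P (B \o g).
Proof. by rewrite -!ExPr Ex_push. Qed.

Lemma sum_Pr_fiber (S T : finType) (f : S -> T) (P : S -> R) (Q : pred T)
    (B : pred S) :
  \sum_(t | Q t) Pr P (fun s => (f s == t) && B s) =
  Pr P (fun s => Q (f s) && B s).
Proof.
rewrite /Pr [RHS](partition_big f Q)//=; last by move=> s /andP[].
apply: eq_bigr => t Qt; apply: eq_bigl => s.
by case: eqP => [->|]; rewrite ?Qt ?andbT ?andbF.
Qed.

Section dist.
Context (S : finType) (P : S -> R) (hP : is_dist P).

Lemma Ex_cst c : Ex P (fun=> c) = c.
Proof. by rewrite /Ex -mulr_suml hP.2 mul1r. Qed.

Lemma Ex_ge0 F : (forall s, 0 <= F s) -> 0 <= Ex P F.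
Proof. by move=> F0; apply: sumr_ge0 => s _; rewrite mulr_ge0 ?hP.1. Qed.

Lemma ler_Ex F G : (forall s, F s <= G s) -> Ex P F <= Ex P G.
Proof. by move=> FG; apply: ler_sum => s _; rewrite ler_wpM2l ?hP.1. Qed.

Lemma Pr_ge0 B : 0 <= Pr P B.
Proof. by apply: sumr_ge0 => s _; rewrite hP.1. Qed.

Lemma Pr_le (B C : pred S) : (forall s, B s -> C s) -> Pr P B <= Pr P C.
Proof.
move=> BC; rewrite -!ExPr; apply: ler_Ex => s.
by case: (B s) (BC s) => [->//|_]; rewrite ler0n.
Qed.

Lemma sqr_Ex_le F : Ex P F ^+ 2 <= Ex P (fun s => F s ^+ 2).
Proof.
have := Ex_ge0 (fun s => sqr_ge0 (F s - Ex P F)).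
rewrite (@eq_Ex _ _ _ (fun s => F s ^+ 2 - ((Ex P F *+ 2) * F s - Ex P F ^+ 2)))//.
  by rewrite ExB ExB ExZ Ex_cst; lra.
by move=> s; rewrite sqrrB; lra.
Qed.

Lemma cond_ge0 (T : finType) (pi : S -> T) (Q : pred S) t : 0 <= cond P pi Q t.
Proof. by rewrite divr_ge0 ?Pr_ge0. Qed.

Lemma cond_le1 (T : finType) (pi : S -> T) (Q : pred S) t : cond P pi Q t <= 1.
Proof.
rewrite /cond; have [->|pi0] := eqVneq (Pr P (fun s => pi s == t)) 0.
  by rewrite invr0 mulr0.
rewrite ler_pdivrMr ?lt_def ?pi0 ?Pr_ge0// mul1r.
by apply: Pr_le => s /andP[].
Qed.

Lemma cond_pi (T : finType) (pi : S -> T) (Q : pred S) t :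
  cond P pi Q t * Pr P (fun s => pi s == t) =
  Pr P (fun s => Q s && (pi s == t)).
Proof.
rewrite /cond; have [pi0|pi0] := eqVneq (Pr P (fun s => pi s == t)) 0.
  rewrite pi0 mulr0; apply/esym/eqP; rewrite eq_le Pr_ge0 andbT -pi0.
  by apply: Pr_le => s /andP[].
by rewrite mulfVK.
Qed.

Lemma tower (T : finType) (pi : S -> T) (Q : pred S) (F : T -> R) :
  Ex P (fun s => F (pi s) * (Q s)%:R) =
  Ex P (fun s => F (pi s) * cond P pi Q (pi s)).
Proof.
rewrite /Ex (partition_big pi predT)//= [RHS](partition_big pi predT)//=.
apply: eq_bigr => t _.
transitivity (F t * Pr P (fun s => Q s && (pi s == t))).
  rewrite /Pr mulr_sumr big_mkcond [RHS]big_mkcond; apply: eq_bigr => s _.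
  case: eqP => [<-|_]; last by rewrite andbF.
  by rewrite andbT; case: (Q s); rewrite ?mulr1 ?mulr0 // mulrC.
rewrite -cond_pi mulrA /Pr mulr_sumr; apply: eq_bigr => s /eqP ->.
by rewrite mulrC.
Qed.

(** Since [pi1] factors through [pi2], conditioning on [pi1] is an orthogonal projection applied
    after conditioning on [pi2], so the squared distance is the difference of the squared norms. *)
Lemma pythagoras (T U : finType) (pi2 : S -> T) (pi1 : S -> U) (h : T -> U) (Q : pred S) :
  (forall s, pi1 s = h (pi2 s)) ->
  Ex P (fun s => (cond P pi2 Q (pi2 s) - cond P pi1 Q (pi1 s)) ^+ 2) =
  energy P pi2 Q - energy P pi1 Q.
Proof.
move=> pi12; set c2 := cond P pi2 Q; set c1 := cond P pi1 Q.
(* The cross term: [tower] replaces [c2] by the indicator of [Q], and a second use replaces the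
   indicator by [c1]. *)
have H : Ex P (fun s => c1 (pi1 s) * c2 (pi2 s)) = energy P pi1 Q.
  rewrite (@eq_Ex _ _ _ (fun s => (c1 \o h) (pi2 s) * c2 (pi2 s))); last first.
    by move=> s /=; rewrite pi12.
  rewrite -tower (@eq_Ex _ _ _ (fun s => c1 (pi1 s) * (Q s)%:R)); last first.
    by move=> s /=; rewrite pi12.
  by rewrite tower.
rewrite (@eq_Ex _ _ _ (fun s => c2 (pi2 s) ^+ 2 -
    (2 * (c1 (pi1 s) * c2 (pi2 s)) - c1 (pi1 s) ^+ 2))); last first.
  by move=> s; lra.
by rewrite ExB ExB ExZ H /energy -/c1 -/c2; lra.
Qed.

Lemma energy_mono (T U : finType) (pi2 : S -> T) (pi1 : S -> U) (h : T -> U) (Q : pred S) :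
  (forall s, pi1 s = h (pi2 s)) -> energy P pi1 Q <= energy P pi2 Q.
Proof.
move=> pi12; rewrite -subr_ge0 -(pythagoras Q pi12).
by apply: Ex_ge0 => s; exact: sqr_ge0.
Qed.

Lemma energy_le1 (T : finType) (pi : S -> T) (Q : pred S) : energy P pi Q <= 1.
Proof.
rewrite -[leRHS](Ex_cst 1); apply: ler_Ex => s.
by rewrite expr_le1 ?cond_ge0 ?cond_le1.
Qed.

End dist.

Lemma cond_push (S T U : finType) (g : S -> T) (P : S -> R) (pi : T -> U)
    (Q : pred T) u :
  cond P (pi \o g) (Q \o g) u = cond (push g P) pi Q u.
Proof. by rewrite /cond !Pr_push. Qed.

Lemma eq_cond (S T : finType) (P P' : S -> R) (pi : S -> T) (Q : pred S) :
  P =1 P' -> cond P pi Q =1 cond P' pi Q.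
Proof. by move=> PP t; congr (_ / _); apply: eq_bigr => s _. Qed.

Lemma eq_cond_pi (S T : finType) (P : S -> R) (pi pi' : S -> T) (Q Q' : pred S) :
  pi =1 pi' -> Q =1 Q' -> cond P pi Q =1 cond P pi' Q'.
Proof.
by move=> pp QQ t; congr (_ / _); apply: eq_Pr => s; rewrite ?QQ pp.
Qed.

Lemma cond_inj (S T U : finType) (P : S -> R) (pi : S -> T) (h : T -> U) (Q : pred S) t :
  (forall s, h (pi s) = h t -> pi s = t) ->
  cond P (h \o pi) Q (h t) = cond P pi Q t.
Proof.
move=> hinj; have E s : (h (pi s) == h t) = (pi s == t).
  by apply/eqP/eqP => [/hinj//|->].
by congr (_ / _); apply: eq_Pr => s /=; rewrite E.
Qed.

Lemma energy_push (S T U : finType) (g : S -> T) (P : S -> R) (pi : T -> U)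
    (Q : pred T) :
  energy P (pi \o g) (Q \o g) = energy (push g P) pi Q.
Proof.
by rewrite /energy Ex_push; apply: eq_Ex => s /=; rewrite cond_push.
Qed.

Lemma eq_energy (S T : finType) (P P' : S -> R) (pi pi' : S -> T)
    (Q Q' : pred S) : P =1 P' -> pi =1 pi' -> Q =1 Q' ->
  energy P pi Q = energy P' pi' Q'.
Proof.
move=> PP pp QQ; rewrite /energy /Ex; apply: eq_bigr => s _; rewrite PP.
by rewrite (eq_cond _ _ PP) (eq_cond_pi _ pp QQ) pp.
Qed.

End finite_probability.

(** * Laws of random structures, and hidden vertices *)

Section labelled_structures.
Context (L : language).

(** A structure on [V] is coded by the set of its tuples tagged with their predicates, so that
    structures on a finite vertex set form a [finType] and their distributions are finite. *)
Definition tup (V : finType) : finType := {P : L & {ffun 'I_(arity P) -> V}}.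

Definition tmap (U V : finType) (f : U -> V) (t : tup U) : tup V :=
  Tagged (fun P : L => {ffun 'I_(arity P) -> V})
    [ffun i => f (tagged t i)].

Definition pull (U V : finType) (f : U -> V) (K : {set tup V}) : {set tup U} :=
  [set t | tmap f t \in K]%SET.

Lemma tmap_comp (U V W : finType) (f : U -> V) (g : V -> W) t :
  tmap g (tmap f t) = tmap (g \o f) t.
Proof. by congr existT; apply/ffunP => i; rewrite !ffunE. Qed.

Lemma eq_tmap (U V : finType) (f g : U -> V) : f =1 g -> tmap f =1 tmap g.
Proof. by move=> fg t; congr existT; apply/ffunP => i; rewrite !ffunE fg. Qed.

Lemma tmap_id (V : finType) t : @tmap V V id t = t.
Proof. by case: t => P a; congr existT; apply/ffunP => i; rewrite !ffunE. Qed.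

Lemma mem_pull (U V : finType) (f : U -> V) K t :
  (t \in pull f K) = (tmap f t \in K).
Proof. by rewrite inE. Qed.

Lemma pull_comp (U V W : finType) (f : U -> V) (g : V -> W) K :
  pull f (pull g K) = pull (g \o f) K.
Proof. by apply/setP => t; rewrite !mem_pull tmap_comp. Qed.

Lemma eq_pull (U V : finType) (f g : U -> V) : f =1 g -> pull f =1 pull g.
Proof. by move=> fg K; apply/setP => t; rewrite !mem_pull (eq_tmap fg). Qed.

Lemma pull_id (V : finType) K : @pull V V id K = K.
Proof. by apply/setP => t; rewrite mem_pull tmap_id. Qed.

(* [hv n V] is V together with the n + 1 hidden vertices 0, ..., n. *)
Definition hv (n : nat) (V : finType) : finType := ('I_n.+1 + V)%type.

(** Hidden vertices keep their number; [inord] is faithful only for m <= n, whence this hypothesis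
    in the lemmas below. *)
Definition hmap (m n : nat) (U V : finType) (f : U -> V) (z : hv m U) : hv n V :=
  match z with inl i => inl (inord i) | inr u => inr (f u) end.
Arguments hmap m n {U V} f z.

Lemma hmap_comp (m n k : nat) (U V W : finType) (f : U -> V) (g : V -> W) :
  (m <= n)%N -> hmap n k g \o hmap m n f =1 hmap m k (g \o f).
Proof.
move=> mn [i|u] //=; congr inl; rewrite inordK//.
by rewrite (leq_trans (ltn_ord i)).
Qed.

Lemma hmap_inj (m n : nat) (U V : finType) (f : U -> V) :
  (m <= n)%N -> injective f -> injective (hmap m n f).
Proof.
move=> mn fi [i|u] [i'|u'] //= => [[/(congr1 val)/=]|[/fi->]//].
rewrite !inordK ?(leq_trans (ltn_ord _))// => ii.
by congr inl; exact: val_inj.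
Qed.

Lemma hmap_id (n : nat) (V : finType) : @hmap n n V V id =1 id.
Proof. by move=> [i|v] //=; rewrite inord_val. Qed.

Definition vis (n : nat) (V : finType) (t : tup (hv n V)) : {set V} :=
  [set v | [exists i, tagged t i == inr v]]%SET.

Lemma visP (n : nat) (V : finType) (t : tup (hv n V)) v :
  reflect (exists i, tagged t i = inr v) (v \in vis t).
Proof. by rewrite inE; apply: (iffP existsP) => -[i /eqP]; exists i => //; apply/eqP. Qed.

Lemma vis_hmap (m n : nat) (U V : finType) (f : U -> V) (t : tup (hv m U)) :
  vis (tmap (hmap m n f) t) = (f @: vis t)%SET.
Proof.
apply/setP => v; apply/visP/imsetP => [[i]|[u /visP[i ti ->]]].
  rewrite ffunE /=; case E : (tagged t i) => [//|u] [<-]; exists u => //.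
  by apply/visP; exists i.
by exists i; rewrite ffunE ti.
Qed.

Definition win (n : nat) (V : finType) (F : {set {set V}})
    (K : {set tup (hv n V)}) : {set tup (hv n V)} :=
  [set t in K | vis t \in F]%SET.

Lemma mem_win (n : nat) (V : finType) (F : {set {set V}})
    (K : {set tup (hv n V)}) t : (t \in win F K) = (t \in K) && (vis t \in F).
Proof. by rewrite inE. Qed.

Lemma eq_win (n : nat) (V : finType) (F : {set {set V}})
    (K K' : {set tup (hv n V)}) :
  (forall t, vis t \in F -> (t \in K) = (t \in K')) -> win F K = win F K'.
Proof.
move=> KK; apply/setP => t; rewrite !mem_win.
by case tF : (vis t \in F); rewrite ?andbF// KK.
Qed.

Lemma win_pull (m n : nat) (U V : finType) (f : U -> V) (F : {set {set U}})
    (G : {set {set V}})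
    (K : {set tup (hv n V)}) :
  (forall B, B \in F -> (f @: B)%SET \in G) ->
  win F (pull (hmap m n f) (win G K)) = win F (pull (hmap m n f) K).
Proof.
move=> FG; apply/setP => t; rewrite !mem_win !mem_pull mem_win vis_hmap.
case tF : (vis t \in F); last by rewrite !andbF.
by rewrite (FG _ tF) !andbT.
Qed.

Lemma pull_win (m n : nat) (U V : finType) (f : U -> V) (F : {set {set U}})
    (G : {set {set V}})
    (K : {set tup (hv n V)}) :
  (forall B, (B \in F) = ((f @: B)%SET \in G)) ->
  pull (hmap m n f) (win G K) = win F (pull (hmap m n f) K).
Proof.
by move=> FG; apply/setP => t; rewrite !mem_win !mem_pull mem_win vis_hmap FG.
Qed.

Context (R : realFieldType).

(* An exchangeable, dissociated random structure, given by the distributions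
   of its restrictions to finite vertex sets. *)
Record law := Law {
  weight : forall V : finType, {set tup V} -> R;
  law_dist : forall V, is_dist (@weight V);
  law_pull : forall (U V : finType) (f : U -> V), injective f ->
    push (pull f) (@weight V) =1 @weight U;
  law_dissociated : forall (U V : finType) (K : {set tup U}) (K' : {set tup V}),
    Pr (@weight (U + V)%type) (fun M => (pull inl M == K) && (pull inr M == K')) =
    weight K * weight K' }.
Arguments weight : clear implicits.

Definition low (j : nat) : {set {set 'I_j}} := [set B | B != [set: 'I_j]]%SET.
Definition top (j : nat) : {set {set 'I_j}} := [set [set: 'I_j]]%SET.

(** The event lives at level m while the conditioning will use level n; keeping the two apart lets n
    grow with the event fixed. *)
Definition at_top (j m n : nat) (p : {set tup (hv m 'I_j)})
    (K : {set tup (hv n 'I_j)}) : bool := win (top j) (pull (hmap m n id) K) == p.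

(** * Conditional probabilities of patterns, and approximate conditional independence *)

Section cond_independence.
Context (w : law).

Definition q (j m : nat) (p : {set tup (hv m 'I_j)}) (n : nat)
    (s : {set tup (hv n 'I_j)}) : R :=
  cond (weight w (hv n 'I_j)) (@win n _ (low j)) (at_top p) s.

Definition en (j m : nat) (p : {set tup (hv m 'I_j)}) (n : nat) : R :=
  energy (weight w (hv n 'I_j)) (@win n _ (low j)) (at_top p).

Lemma at_top_pull (j m n k : nat) (p : {set tup (hv m 'I_j)}) K :
  (m <= n)%N -> at_top p (pull (hmap n k id) K) = at_top p K.
Proof.
move=> mn; rewrite /at_top pull_comp; congr (win _ _ == _).
by apply: eq_pull; exact: hmap_comp.
Qed.

Lemma en_le1 (j m : nat) (p : {set tup (hv m 'I_j)}) n : en p n <= 1.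
Proof. exact/energy_le1/(law_dist w). Qed.

Lemma q_ge0 (j m : nat) (p : {set tup (hv m 'I_j)}) n s : 0 <= q p (n := n) s.
Proof. exact/cond_ge0/(law_dist w). Qed.

Lemma q_le1 (j m : nat) (p : {set tup (hv m 'I_j)}) n s : q p (n := n) s <= 1.
Proof. exact/cond_le1/(law_dist w). Qed.

(* Martingale orthogonality: [q] at level n is the conditional expectation of
   [q] at level k. *)
Lemma en_increment (j m n k : nat) (p : {set tup (hv m 'I_j)}) :
  (m <= n)%N -> (n <= k)%N ->
  Ex (weight w (hv k 'I_j)) (fun K => (q p (win (low j) K) -
    q p (win (low j) (pull (hmap n k id) K))) ^+ 2) = en p k - en p n.
Proof.
move=> mn nk; set g := pull (hmap n k id).
have wg : push g (weight w (hv k 'I_j)) =1 weight w (hv n 'I_j).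
  by apply: (law_pull w); apply: hmap_inj.
have Qg : at_top p \o g =1 at_top p by move=> K; exact: at_top_pull.
have -> : en p n = energy (weight w (hv k 'I_j)) (@win n _ (low j) \o g) (at_top p).
  rewrite /en -(eq_energy wg (frefl _) (frefl _)) -energy_push.
  exact: eq_energy.
rewrite -(@pythagoras _ _ _ (law_dist w _) _ _ _ _
  (fun s => win (low j) (g s))); last first.
  by move=> K /=; rewrite /g win_pull // => B; rewrite imset_id.
apply: eq_Ex => K; congr ((_ - _) ^+ 2).
rewrite /q -(eq_cond _ _ wg) -cond_push; apply: eq_cond_pi => //.
Qed.

Lemma en_mono (j m n k : nat) (p : {set tup (hv m 'I_j)}) :
  (m <= n)%N -> (n <= k)%N -> en p n <= en p k.
Proof.
move=> mn nk; rewrite -subr_ge0 -(en_increment p mn nk).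
by apply: Ex_ge0 => [|K]; [exact: law_dist|exact: sqr_ge0].
Qed.

(* Hiding the visible vertices outside [alpha] turns the information carried by
   a family of sets none of which contains the image of [alpha] into lower
   information with #|V| more hidden vertices. *)
Section hiding.
Context (V : finType) (j n : nat) (alpha : 'I_j -> V).
Hypothesis alpha_inj : injective alpha.

(** The hidden vertices 0, ..., n keep their place, so the new ones start at n + 1; the slots of
    vertices in the image of [alpha] stay empty. *)
Definition hide_outside (z : hv n V) : hv (n + #|V|) 'I_j :=
  match z with
  | inl i => inl (inord i)
  | inr v => match [pick a | alpha a == v] with
             | Some a => inr a
             | None => inl (inord (n.+1 + enum_rank v))
             end
  end.

Lemma hide_outside_inj : injective hide_outside.
Proof.
have lt1 (i : 'I_n.+1) : (i < (n + #|V|).+1)%N.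
  by rewrite (leq_trans (ltn_ord i))// ltnS leq_addr.
have lt2 (v : V) : (n.+1 + enum_rank v < (n + #|V|).+1)%N.
  by rewrite addSn ltnS ltn_add2l.
have ne (i : 'I_n.+1) (v : V) :
    inord i <> inord (n.+1 + enum_rank v) :> 'I_(n + #|V|).+1.
  move=> /(congr1 val) /=; rewrite !inordK// => iv.
  by have := ltn_ord i; rewrite iv ltnNge leq_addr.
move=> [i|u] [i'|u'] /=.
- move=> [/(congr1 val)/=]; rewrite !inordK// => ii.
  by congr inl; exact: val_inj.
- by case: pickP => // _ [/ne].
- by case: pickP => // _ [/esym/ne].
case: pickP => [a /eqP <-|_]; case: pickP => [a' /eqP <-|_] //.
  by move=> [->].
move=> [/(congr1 val)/=]; rewrite !inordK// => /addnI uu.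
by congr inr; apply: enum_rank_inj; exact: val_inj.
Qed.

Lemma hide_outsideK : hide_outside \o hmap n n alpha =1 hmap n (n + #|V|) id.
Proof.
move=> [i|a] /=; first by rewrite inord_val.
case: pickP => [a' /eqP/alpha_inj -> //|/(_ a)].
by rewrite eqxx.
Qed.

Lemma vis_hide_outside (t : tup (hv n V)) :
  vis (tmap hide_outside t) = [set: 'I_j]%SET ->
  (alpha @: [set: 'I_j])%SET \subset vis t.
Proof.
move=> tT; apply/fintype.subsetP => _ /imsetP[a _ ->]; apply/visP.
have : a \in vis (tmap hide_outside t) by rewrite tT inE.
move=> /visP[i]; rewrite ffunE /=; case E : (tagged t i) => [//|v] /=.
by case: pickP => // a' /eqP av [<-]; exists i; rewrite E av.
Qed.

(** After hiding, a tuple whose visible set lies in [F] no longer sees all of ['I_j]. The [F]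
    information thus becomes a function of the low information at level n + #|V|, and energy is
    monotone. *)
Lemma energy_win_le (m : nat) (F : {set {set V}}) (p : {set tup (hv m 'I_j)}) :
  (m <= n)%N ->
  (forall B, B \in F -> ~~ ((alpha @: [set: 'I_j])%SET \subset B)) ->
  energy (weight w (hv n V)) (@win n V F) (at_top p \o pull (hmap n n alpha)) <=
  en p (n + #|V|).
Proof.
move=> mn hF; set g := pull hide_outside.
have wg : push g (weight w (hv (n + #|V|) 'I_j)) =1 weight w (hv n V).
  exact/law_pull/hide_outside_inj.
rewrite -(eq_energy wg (frefl _) (frefl _)) -energy_push.
have -> : energy (weight w (hv (n + #|V|) 'I_j)) (win F \o g)
    ((at_top p \o pull (hmap n n alpha)) \o g) =
    energy (weight w (hv (n + #|V|) 'I_j)) (win F \o g) (at_top p).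
  apply: eq_energy => // K /=; rewrite /g pull_comp (eq_pull hide_outsideK).
  exact: at_top_pull.
apply: (energy_mono (h := fun s => win F (g s)) (law_dist w _)) => K /=.
apply/setP => t; rewrite !mem_win !mem_pull mem_win inE.
case tF : (vis t \in F); last by rewrite !andbF.
suff -> : vis (tmap hide_outside t) != [set: 'I_j]%SET by rewrite !andbT.
by apply/eqP => /vis_hide_outside; apply/negP; exact: hF.
Qed.

(* Approximate conditional independence of the top part given the lower one. *)
Lemma cond_independence (m : nat) (F : {set {set V}})
    (p : {set tup (hv m 'I_j)}) (B : pred {set tup (hv m V)}) :
  (m <= n)%N ->
  (forall B, B \in F -> ~~ ((alpha @: [set: 'I_j])%SET \subset B)) ->
  (forall B, B \in low j -> (alpha @: B)%SET \in F) ->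
  (Pr (weight w (hv n V)) (fun K => B (win F (pull (hmap m n id) K)) &&
      at_top p (pull (hmap n n alpha) K)) -
   Ex (weight w (hv n V)) (fun K => (B (win F (pull (hmap m n id) K)))%:R *
      q p (win (low j) (pull (hmap n n alpha) K)))) ^+ 2
  <= en p (n + #|V|) - en p n.
Proof.
move=> mn hF lF; set P := weight w (hv n V); set a := pull (hmap n n alpha).
have hP : is_dist P by exact: law_dist.
have wa : push a P =1 weight w (hv n 'I_j) by exact/law_pull/hmap_inj.
pose G (s : {set tup (hv n V)}) : R := (B (win F (pull (hmap m n id) s)))%:R.
have GF s : G (win F s) = G s by rewrite /G win_pull// => C; rewrite imset_id.
have lowa s : win (low j) (a (win F s)) = win (low j) (a s) by exact: win_pull.
pose cF s := cond P (@win n V F) (at_top p \o a) (win F s).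
pose ca s := cond P (win (low j) \o a) (at_top p \o a) ((win (low j) \o a) s).
have caE s : ca s = q p (win (low j) (a s)).
  by rewrite /ca cond_push; exact: eq_cond.
have -> : Pr P (fun K => B (win F (pull (hmap m n id) K)) && at_top p (a K)) =
    Ex P (fun s => G s * cF s).
  rewrite -ExPr [RHS](@eq_Ex _ _ _ _ (fun s => G (win F s) * cF s)); last first.
    by move=> s; rewrite GF.
  rewrite -(tower hP); apply: eq_Ex => s /=; rewrite GF /G.
  by rewrite -natrM mulnb.
rewrite -ExB; apply: (le_trans (sqr_Ex_le hP _)).
apply: (@le_trans _ _ (Ex P (fun s => (cF s - ca s) ^+ 2))).
  apply: (ler_Ex hP) => s; rewrite -caE -mulrBr exprMn /G.
  by case: (B _); rewrite ?mulr0n ?expr0n ?mul0r ?sqr_ge0// expr1n mul1r.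
(* The low information is part of the [F] information, so the squared distance is a difference of
   energies; hiding bounds the larger one, and restriction along [alpha] identifies the smaller one
   with [en p n]. *)
rewrite (@pythagoras _ _ _ hP _ _ _ _ (fun s => win (low j) (a s))); last first.
  by move=> s /=; rewrite lowa.
rewrite lerB// ?energy_win_le// energy_push le_eqVlt; apply/orP; left.
by apply/eqP; apply: eq_energy => // s; rewrite wa.
Qed.

End hiding.

(** The law does not distinguish the labels of the j visible vertices. This later makes the
    labelling by sorted coordinates harmless. *)
Lemma q_perm (j m n : nat) (s : 'I_j -> 'I_j) (p : {set tup (hv m 'I_j)})
    (K : {set tup (hv n 'I_j)}) : injective s -> (m <= n)%N ->
  q (pull (hmap m m s) p) (win (low j) (pull (hmap n n s) K)) =
  q p (win (low j) K).
Proof.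
move=> s_inj mn; set g := pull (hmap n n s).
have sT : (s @: [set: 'I_j])%SET = [set: 'I_j]%SET.
  apply/eqP; rewrite eqEcard; apply/andP; split; first exact: finset.subsetT.
  by rewrite card_imset.
have slow B : (B \in low j) = ((s @: B)%SET \in low j).
  by rewrite !inE -[in RHS]sT (inj_eq (imset_inj s_inj)).
have stop B : (B \in top j) = ((s @: B)%SET \in top j).
  by rewrite !inE -[in RHS]sT (inj_eq (imset_inj s_inj)).
have [r rK Kr] : bijective s by exact: injF_bij.
have pull_s_inj k : injective (@pull (hv k 'I_j) (hv k 'I_j) (hmap k k s)).
  apply: (can_inj (g := pull (hmap k k r))) => K'; rewrite pull_comp.
  rewrite -[RHS]pull_id; apply: eq_pull => z.
  have := @hmap_comp k k k _ _ _ r s (leqnn k) z => /= ->.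
  by rewrite -[RHS](@hmap_id k); case: z => //= a; rewrite Kr.
have wg : push g (weight w (hv n 'I_j)) =1 weight w (hv n 'I_j).
  exact/law_pull/hmap_inj.
have lg K' : win (low j) (g K') = g (win (low j) K').
  by rewrite /g; apply/esym/pull_win.
rewrite /q -(eq_cond _ _ wg) -cond_push lg.
rewrite (eq_cond_pi _ (pi' := g \o @win n _ (low j)) (Q' := at_top p)) => [|//|K'].
  by apply: cond_inj => K'; exact: pull_s_inj.
rewrite /= /at_top /g.
have -> : pull (hmap m n id) (pull (hmap n n s) K') =
    pull (hmap m m s) (pull (hmap m n id) K').
  rewrite !pull_comp; apply: eq_pull => z.
  by rewrite (hmap_comp n id s mn) (hmap_comp n s id (leqnn m)).
by rewrite -(pull_win m _ stop) (inj_eq (@pull_s_inj m)).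
Qed.

End cond_independence.
End labelled_structures.

Arguments hmap m n {U V} f z.
Arguments weight {L R} l V K.
Arguments win {L n V} F K.

Local Open Scope classical_set_scope.

(** * Uniform coordinates *)

(** A separate name for the function type, to which the sigma-algebra generated by the coordinates
    is attached. *)
Definition cspace (R : realType) (I : finType) : Type := I -> measurableTypeR R.

HB.instance Definition _ (R : realType) (I : finType) :=
  gen_eqMixin (cspace R I).
HB.instance Definition _ (R : realType) (I : finType) :=
  gen_choiceMixin (cspace R I).
HB.instance Definition _ (R : realType) (I : finType) :=
  isPointed.Build (cspace R I) (fun=> 0).

Section cspace_measurable.
Context (R : realType) (I : finType).

Definition coord_preimages : set (set (cspace R I)) :=
  [set A | exists i (B : set (measurableTypeR R)),
    measurable B /\ A = [set x | B (x i)]].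

Let cspace0 : <<s coord_preimages >> set0.
Proof. exact: sigma_algebra0. Qed.

Let cspaceC A : <<s coord_preimages >> A -> <<s coord_preimages >> (~` A).
Proof. exact: sigma_algebraC. Qed.

Let cspaceU (F : (set (cspace R I))^nat) :
  (forall i, <<s coord_preimages >> (F i)) ->
  <<s coord_preimages >> (\bigcup_i F i).
Proof. exact: sigma_algebra_bigcup. Qed.

HB.instance Definition _ := @isMeasurable.Build default_measure_display
  (cspace R I) <<s coord_preimages >> cspace0 cspaceC cspaceU.

Definition box (B : I -> set (measurableTypeR R)) : set (cspace R I) :=
  [set x | forall i, B i (x i)].

Lemma measurable_coord (i : I) :
  measurable_fun [set: cspace R I] (fun x : cspace R I => x i).
Proof.
move=> _ B mB; rewrite setTI; apply: sub_sigma_algebra.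
by exists i, B.
Qed.

Lemma measurable_box (B : I -> set (measurableTypeR R)) :
  (forall i, measurable (B i)) -> measurable (box B).
Proof.
move=> mB; have -> : box B =
    \bigcap_(i in [set: I]) [set x : cspace R I | B i (x i)].
  by apply/seteqP; split => x /= h i => [_|]; apply: h.
apply: fin_bigcap_measurable => // i _; rewrite -[X in measurable X]setTI.
by apply: measurable_coord => //; exact: mB.
Qed.

Lemma measurable_cspace d (T : measurableType d) (f : T -> cspace R I) :
  (forall i, measurable_fun [set: T] (fun t => f t i)) ->
  measurable_fun [set: T] f.
Proof.
move=> mf; apply: (measurability coord_preimages) => // _ [_ [i [B [mB ->]]] <-].
by apply: mf.
Qed.

(** Boxes are stable under intersection and generate the sigma-algebra. *)
Lemma cspace_unique (mu nu : probability (cspace R I) R) :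
  (forall B, (forall i, measurable (B i)) -> mu (box B) = nu (box B)) ->
  forall A, measurable A -> mu A = nu A.
Proof.
move=> munu; pose G := [set A | exists2 B, (forall i, measurable (B i)) & A = box B].
apply: (measure_unique G (fun=> setT)).
- apply/seteqP; split.
    apply: smallest_sub; first exact: smallest_sigma_algebra.
    move=> _ [i [B [mB ->]]]; apply: sub_sigma_algebra.
    exists (fun k => if k == i then B else setT).
      by move=> k; case: ifP.
    apply/seteqP; split => x /= => [Bx k|/(_ i)]; last by rewrite eqxx.
    by case: eqP => // ->.
  apply: smallest_sub; first exact: sigma_algebra_measurable.
  by move=> _ [B mB ->]; exact: measurable_box.
- move=> _ _ [B mB ->] [C mC ->]; exists (fun i => B i `&` C i).
    by move=> i; exact: measurableI.
  apply/seteqP; split => x /=; first by move=> [Bx Cx] i; split.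
  by move=> BC; split => i; have [] := BC i.
- move=> _; exists (fun=> setT) => //.
  by apply/seteqP; split.
- by rewrite bigcup_const.
- by move=> _ [B mB ->]; exact: munu.
- by move=> _; rewrite (le_lt_trans (probability_le1 _ _))// ltry.
Qed.

End cspace_measurable.

Lemma measure_ae_eq d (T : measurableType d) (R : realType)
    (mu : {measure set T -> \bar R}) (A B : set T) :
  measurable A -> measurable B -> {ae mu, forall x, A x <-> B x} -> mu A = mu B.
Proof.
move=> mA mB AB; have I C : measurable C -> mu C = (\int[mu]_x (\1_C x)%:E)%E.
  by move=> mC; rewrite integral_indic ?setIT.
rewrite !I//; apply: ge0_ae_eq_integral => //.
- exact/measurable_EFinP/measurable_indic.
- exact/measurable_EFinP/measurable_indic.
- have [N [mN N0 hN]] := AB; exists N; split => // x /= nx; apply: hN => /= ABx.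
  apply: nx => _; rewrite !indicE; congr (_%:R)%:E.
  by congr nat_of_bool; apply/idP/idP; rewrite !inE => /ABx.
Qed.

Section cube_measure.
Context (R : realType).
Implicit Types I J : finType.

Let U := uniform_prob (@ltr01 R).

Lemma fineU (B : set (measurableTypeR R)) : measurable B -> (fine (U B))%:E = U B.
Proof. by move=> mB; rewrite fineK// fin_num_measure. Qed.

Let U_setT : U setT = 1%E. Proof. exact: probability_setT. Qed.

Lemma cube_prob_box n (B : 'I_n -> set (measurableTypeR R)) :
  (forall i, measurable (B i)) ->
  cube_prob R n [set t | forall i, B i (tnth t i)] =
  (\prod_i fine (U (B i)))%:E.
Proof.
elim: n B => [|n IHn] B mB /=.
  by rewrite big_ord0 diracE mem_set// => -[].
rewrite /distribution /pushforward /=.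
have -> : (@cons_pair _ (measurableTypeR R) n) @^-1`
    [set t | forall i, B i (tnth t i)] =
    B ord0 `*` [set t | forall i, B (lift ord0 i) (tnth t i)].
  apply/seteqP; split => -[x t] /=.
    move=> h; split; first exact: (h ord0).
    by move=> i; have := h (lift ord0 i); rewrite tnthS.
  move=> [h0 h] i; case: (unliftP ord0 i) => [k ->|->//].
  by rewrite tnthS.
rewrite product_measure1E//; last first.
  have -> : [set t | forall i, B (lift ord0 i) (tnth t i)] =
     \bigcap_(i in [set: 'I_n]) ((fun t : n.-tuple (measurableTypeR R) => tnth t i) @^-1` B (lift ord0 i)).
    by apply/seteqP; split => t /= h i => [_|]; apply: h.
  apply: fin_bigcap_measurable => // i _.
  by rewrite -[X in measurable X]setTI; apply: measurable_tnth.
rewrite big_ord_recl EFinM fineU//; congr (_ * _)%E.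
by apply: (IHn (fun i => B (lift ord0 i))) => i.
Qed.

Lemma measurable_tuple_fun I :
  measurable_fun setT (@tuple_fun R I : _ -> cspace R I).
Proof. by apply: measurable_cspace => i; exact: measurable_tnth. Qed.

HB.instance Definition _ I :=
  isMeasurableFun.Build _ _ _ _ (@tuple_fun R I : _ -> cspace R I)
    (@measurable_tuple_fun I).

(** Defined as an image of [cube_prob], which ties it directly to the [lebesgue_cube] of the
    statement. *)
Definition lam I : probability (cspace R I) R :=
  distribution (cube_prob R #|I|) (@tuple_fun R I : _ -> cspace R I).

Lemma lam_box I (B : I -> set (measurableTypeR R)) : (forall i, measurable (B i)) ->
  lam I (box B) = (\prod_i fine (U (B i)))%:E.
Proof.
move=> mB; rewrite /lam /= /distribution /pushforward /=.
have -> : @tuple_fun R I @^-1` box B =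
    [set t | forall i, B (enum_val i) (tnth t i)].
  apply/seteqP; split => t /= h i.
    by have := h (enum_val i); rewrite /tuple_fun enum_valK.
  by have := h (enum_rank i); rewrite enum_rankK.
rewrite (@cube_prob_box _ (fun i => B (enum_val i)))//; congr EFin.
by rewrite [RHS](reindex _ (onW_bij _ (@enum_val_bij I))).
Qed.

Lemma lam_pushforward d (T : measurableType d) (P : probability T R) I
    (f : T -> cspace R I) : measurable_fun setT f ->
  (forall B, (forall i, measurable (B i)) ->
    P (f @^-1` box B) = (\prod_i fine (U (B i)))%:E) ->
  forall A, measurable A -> P (f @^-1` A) = lam I A.
Proof.
move=> mf fbox A mA.
pose h : {mfun T >-> cspace R I} := HB.pack f (isMeasurableFun.Build _ _ _ _ f mf).
rewrite -(@cspace_unique _ _ (distribution P h) (lam I))// => B mB.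
by rewrite lam_box// -fbox.
Qed.

Lemma lam_reindex I J (f : J -> I) : injective f ->
  forall A : set (cspace R J), measurable A ->
  lam I ((fun x : cspace R I => (x \o f : cspace R J)) @^-1` A) = lam J A.
Proof.
move=> f_inj; apply: lam_pushforward.
  by apply: measurable_cspace => j; exact: measurable_coord.
move=> B mB; pose C i := if [pick j | f j == i] is Some j then B j else setT.
have Cf j : C (f j) = B j.
  by rewrite /C; case: pickP => [k /eqP/f_inj->//|/(_ j)]; rewrite eqxx.
have -> : (fun x : cspace R I => (x \o f : cspace R J)) @^-1` box B = box C.
  apply/seteqP; split => x /= h i; last by have := h (f i); rewrite Cf.
  by rewrite /C; case: pickP => // j /eqP <-; exact: h.
rewrite lam_box; last by move=> i; rewrite /C; case: pickP.
congr EFin; rewrite (bigID (mem (f @: [set: J])%SET))/=.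
rewrite [X in _ * X]big1 ?mulr1.
  rewrite big_imset/=; last by move=> ? ? _ _ /f_inj.
  by apply: eq_big => [j|j _]; rewrite ?inE// Cf.
move=> i /negP fi; rewrite /C; case: pickP => [j /eqP ji|_].
  by case: fi; rewrite -ji imset_f.
by rewrite U_setT.
Qed.

Lemma product_prob_rect d1 d2 (T1 : measurableType d1) (T2 : measurableType d2)
    (P1 : probability T1 R) (P2 : probability T2 R) A B a b :
  measurable A -> measurable B -> P1 A = a%:E -> P2 B = b%:E ->
  (P1 \x P2)%E (A `*` B) = (a * b)%:E.
Proof. by move=> mA mB Aa Bb; rewrite EFinM -Aa -Bb; exact: product_measure1E. Qed.

(** Splicing two independent uniform points along [S] gives a uniform point. Independence of
    disjoint blocks of coordinates follows without splitting the index type. *)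
Definition merge I (S : pred I) (xy : cspace R I * cspace R I) : cspace R I :=
  fun i => if S i then xy.1 i else xy.2 i.

Lemma measurable_merge I (S : pred I) : measurable_fun setT (@merge I S).
Proof.
apply: measurable_cspace => i; rewrite /merge; case: (S i).
  by apply: measurableT_comp (measurable_coord i) measurable_fst.
by apply: measurableT_comp (measurable_coord i) measurable_snd.
Qed.

Lemma lam_merge I (S : pred I) (A : set (cspace R I)) : measurable A ->
  (lam I \x lam I)%E (merge S @^-1` A) = lam I A.
Proof.
pose P : probability _ R := (lam I \x lam I)%E.
apply: (@lam_pushforward _ _ P I _ (@measurable_merge I S)) => B mB.
have -> : merge S @^-1` box B = box (fun i => if S i then B i else setT) `*`
    box (fun i => if S i then setT else B i).
  apply/seteqP; split => -[x y] /=.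
    by move=> h; split => i; have := h i; rewrite /merge/=; case: (S i).
  by move=> [h h'] i; have := h i; have := h' i; rewrite /merge/=; case: (S i).
rewrite /P; apply: etrans (product_prob_rect _ _ (lam_box _) (lam_box _)) _;
  try (by move=> i; case: (S i)); try by apply: measurable_box => i; case: (S i).
rewrite -big_split; congr EFin; apply: eq_bigr => i _ /=.
by case: (S i); rewrite !U_setT ?mulr1 ?mul1r.
Qed.

Lemma lam_indep I (S : pred I) (A B : set (cspace R I)) :
  measurable A -> measurable B ->
  (forall x y : cspace R I, (forall i, S i -> x i = y i) -> A x -> A y) ->
  (forall x y : cspace R I, (forall i, ~~ S i -> x i = y i) -> B x -> B y) ->
  lam I (A `&` B) = (lam I A * lam I B)%E.
Proof.
move=> mA mB hA hB; rewrite -(lam_merge S); last exact: measurableI.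
rewrite -[RHS]product_measure1E//.
congr (_ _); apply/seteqP; split => -[x y] /= [Ax By]; split.
- by apply: hA Ax => i Si; rewrite /merge Si.
- by apply: hB By => i /negPf Si; rewrite /merge Si.
- by apply: hA Ax => i Si; rewrite /merge Si.
- by apply: hB By => i /negPf Si; rewrite /merge Si.
Qed.

Lemma U_itv (a b : R) : 0 <= a -> a <= b -> b <= 1 ->
  U [set u | a <= u < b] = (b - a)%:E.
Proof.
move=> a0 ab b1; have -> : [set u | a <= u < b] = `[a, b[%classic.
  by apply/seteqP; split => u /=; rewrite in_itv.
rewrite /U /uniform_prob integral_uniform_pdf setIidl; last first.
  move=> u /=; rewrite !in_itv /= => /andP[au ub].
  by rewrite (le_trans a0 au) (le_trans (ltW ub) b1).
rewrite (eq_integral (cst 1%:E)); last first.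
  move=> u; rewrite inE /= in_itv /= => /andP[au ub].
  by rewrite /uniform_pdf (le_trans a0 au) (le_trans (ltW ub) b1) subr0 invr1.
rewrite integral_cst// mul1e; transitivity (lebesgue_measure `[a, b[%classic) => //.
rewrite lebesgue_measure_itv /= lte_fin.
by case: ltgtP ab => // -> _; rewrite subrr.
Qed.

Lemma U_set1 (c : R) : U [set c] = 0%E.
Proof.
have /null_content_dominatesP d01 := dominates_uniform_prob (@ltr01 R).
by apply: d01 => //; exact: lebesgue_measure_set1.
Qed.

Definition upd I (i : I) (xu : cspace R I * measurableTypeR R) : cspace R I :=
  fun k => if k == i then xu.2 else xu.1 k.

Lemma measurable_upd I (i : I) : measurable_fun setT (upd i).
Proof.
apply: measurable_cspace => k; rewrite /upd; case: (k == i).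
  exact: measurable_snd.
exact: measurableT_comp (measurable_coord k) measurable_fst.
Qed.

(** Resampling one coordinate preserves the uniform measure, so Fubini for that coordinate is
    available without changing the index set. *)
Lemma lam_upd I (i : I) (A : set (cspace R I)) : measurable A ->
  lam I A = (\int[lam I]_x U [set u | A (upd i (x, u))])%E.
Proof.
move=> mA; transitivity ((lam I \x U)%E (upd i @^-1` A)); last first.
  rewrite /product_measure1; apply: eq_integral => x _ /=; congr (U _).
  by apply/seteqP; split => u; rewrite /xsection /= inE.
apply/esym; move: A mA; pose P : probability _ R := (lam I \x U)%E.
apply: (@lam_pushforward _ _ P I _ (@measurable_upd I i)) => B mB.
have -> : upd i @^-1` box B = box (fun k => if k == i then setT else B k) `*` B i.
  apply/seteqP; split => -[x u] /=.
    move=> h; split => [k|]; last by have := h i; rewrite /upd eqxx.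
    by have := h k; rewrite /upd; case: (k == i).
  move=> [h' h] k; have := h' k; rewrite /upd/=.
  by case: eqP => [->|].
have mC k : measurable (if k == i then setT else B k) by case: (k == i).
rewrite /P; apply: etrans (product_prob_rect _ _ (lam_box _) (esym (fineU _))) _ => //.
  exact: measurable_box.
congr EFin; rewrite (bigD1 i)//= eqxx U_setT mul1r mulrC.
rewrite [RHS](bigD1 i)//=; congr (_ * _).
by apply: eq_bigr => k /negPf ->.
Qed.

Lemma ae_U01 : {ae uniform_prob (@ltr01 R), forall u, 0 <= u < 1}.
Proof.
have m01 : measurable ([set u | 0 <= u < 1] : set (measurableTypeR R)).
  rewrite (_ : [set u | _] = `[0, 1[%classic); first exact: measurable_itv.
  by apply/seteqP; split => u /=; rewrite in_itv.
exists (~` [set u | 0 <= u < 1]); split => //; first exact: measurableC.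
transitivity (1 - U [set u : R | (0 <= u < 1)%R])%E.
  exact: (probability_setC (uniform_prob (@ltr01 R)) m01).
by rewrite U_itv// subr0 subee.
Qed.

Lemma lam_upd_ae I (i : I) (A : set (cspace R I)) (h : cspace R I -> R) :
  measurable A -> measurable_fun setT h -> (forall x, 0 <= h x) ->
  {ae lam I, forall x, U [set u | A (upd i (x, u))] = (h x)%:E} ->
  lam I A = (\int[lam I]_x (h x)%:E)%E.
Proof.
move=> mA mh h0 Ah; rewrite (lam_upd i)//; apply: ge0_ae_eq_integral => //.
- have := measurable_fun_xsection (uniform_prob (@ltr01 R))
    (_ : measurable (upd i @^-1` A)).
  have mupd : measurable (upd i @^-1` A).
    by rewrite -[X in measurable X]setTI; exact: measurable_upd.
  move=> /(_ mupd); congr measurable_fun; apply/funext => x /=; congr (U _).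
  by apply/seteqP; split => u; rewrite /xsection /= inE.
- exact/measurable_EFinP.
- by move=> x _; rewrite lee_fin.
- by have [N [mN N0 hN]] := Ah; exists N; split => // x /= nx; apply: hN => /= Ahx; apply: nx.
Qed.

Lemma ae_U (Q : measurableTypeR R -> Prop) : (forall u, 0 <= u < 1 -> Q u) ->
  {ae uniform_prob (@ltr01 R), forall u, Q u}.
Proof.
move=> h; have [N [mN N0 hN]] := ae_U01; exists N; split => // u /= nQ.
by apply: hN => /= u01; exact/nQ/h.
Qed.

Lemma lam_coord_itv I (i : I) : {ae lam I, forall x, 0 <= x i < 1}.
Proof.
have [N [mN N0 hN]] := ae_U01.
exists ((fun x : cspace R I => x i) @^-1` N); split.
- by rewrite -[X in measurable X]setTI; exact: measurable_coord.
- rewrite (lam_upd i); last by rewrite -[X in measurable X]setTI; exact: measurable_coord.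
  apply: integral0_eq => x _; rewrite -N0; congr (U _).
  by apply/seteqP; split => u /=; rewrite /upd eqxx.
- by move=> x /= nx; apply: hN.
Qed.

Lemma lam_no_ties I (i k : I) : i != k -> {ae lam I, forall x, x i != x k}.
Proof.
move=> ik.
have mA : measurable [set x : cspace R I | x i = x k].
  rewrite -[X in measurable X]setTI.
  have -> : [set x : cspace R I | x i = x k] = (fun x => x i == x k) @^-1` [set true].
    by apply/seteqP; split => x /= /eqP.
  by apply: measurable_fun_eqr => //; exact: measurable_coord.
exists [set x : cspace R I | x i = x k]; split => //.
  rewrite (lam_upd i)//; apply: integral0_eq => x _.
  have -> : [set u | [set y : cspace R I | y i = y k] (upd i (x, u))] = [set x k].
    by apply/seteqP; split => u /=; rewrite /upd eqxx eq_sym (negPf ik).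
  exact: U_set1.
by move=> x /= /negP; rewrite negbK => /eqP.
Qed.

Lemma lam_reindex_ae I J (f : J -> I) (Q : cspace R J -> Prop) : injective f ->
  {ae lam J, forall y, Q y} ->
  {ae lam I, forall x, Q (fun j => x (f j))}.
Proof.
move=> f_inj [N [mN N0 NQ]].
exists ((fun x : cspace R I => (x \o f : cspace R J)) @^-1` N); split.
- rewrite -[X in measurable X]setTI.
  by apply: measurable_cspace => // j; exact: measurable_coord.
- by rewrite -N0; exact: lam_reindex.
- by move=> x /= Qx; apply: NQ.
Qed.

Lemma lam_aeS I (Q Q' : cspace R I -> Prop) : (forall x, Q x -> Q' x) ->
  {ae lam I, forall x, Q x} -> {ae lam I, forall x, Q' x}.
Proof. by move=> QQ; apply: filterS. Qed.

End cube_measure.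

(** * Random variables with finitely many values, and almost sure limits *)

Section finite_random_variables.
Context d (T : measurableType d) (R : realType) (P : probability T R).
Implicit Types S : finType.

Definition fin_rv S (X : T -> S) := forall s, measurable [set t | X t = s].

Definition rv_law S (X : T -> S) (s : S) : R := fine (P [set t | X t = s]).

Lemma measurable_fin_rv S (X : T -> S) (B : set S) : fin_rv X ->
  measurable [set t | B (X t)].
Proof.
move=> mX; have -> : [set t | B (X t)] = \bigcup_(s in B) [set t | X t = s].
  by apply/seteqP; split => [t Bt|t [s Bs /= ->//]]; exists (X t).
by apply: fin_bigcup_measurable.
Qed.

Lemma measurable_fun_fin_rv S (X : T -> S) (F : S -> R) : fin_rv X ->
  measurable_fun setT (fun t => F (X t)).
Proof.
move=> mX _ B mB; rewrite setTI; exact: (measurable_fin_rv (F @^-1` B)).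
Qed.

Lemma fin_rv_comp S S' (X : T -> S) (g : S -> S') : fin_rv X -> fin_rv (g \o X).
Proof. by move=> mX s; exact: (measurable_fin_rv [set r | g r = s]). Qed.

Lemma fin_rv_set S (X : T -> {set S}) :
  (forall s, measurable [set t | s \in X t]) -> fin_rv X.
Proof.
move=> mX A; have -> : [set t | X t = A] =
    \bigcap_(s in [set: S]) [set t | (s \in X t) = (s \in A)].
  apply/seteqP; split => t /=; first by move=> XA s _; rewrite /= XA.
  by move=> h; apply/setP => s; exact: h s I.
apply: fin_bigcap_measurable => // s _; case: (s \in A).
  exact: mX.
have -> : [set t | (s \in X t) = false] = ~` [set t | s \in X t].
  by apply/seteqP; split => t /= => [->//|/negP/negbTE].
exact/measurableC/mX.
Qed.

Lemma rv_lawE S (X : T -> S) s : fin_rv X ->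
  P [set t | X t = s] = (rv_law X s)%:E.
Proof. by move=> mX; rewrite fineK// fin_num_measure. Qed.

Lemma rv_law_ge0 S (X : T -> S) s : 0 <= rv_law X s.
Proof. by rewrite fine_ge0// measure_ge0. Qed.

Lemma int_rv S (X : T -> S) (F : S -> R) : fin_rv X -> (forall s, 0 <= F s) ->
  (\int[P]_t (F (X t))%:E = (Ex (rv_law X) F)%:E)%E.
Proof.
move=> mX F0.
under eq_integral => t _.
  rewrite (_ : (F (X t))%:E =
    (\sum_(s <- enum S) (F s)%:E * (\1_[set t | X t = s] t)%:E)%E); last first.
    rewrite (big_rem (X t)) ?mem_enum//= big1_seq ?adde0.
      by rewrite indicE mem_set// mule1.
    move=> s /andP[_]; rewrite mem_rem_uniq ?enum_uniq// inE => /andP[/eqP sX _].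
    by rewrite indicE memNset ?mule0// => /= /esym.
  over.
rewrite ge0_integral_sum//=.
- rewrite /Ex -sumEFin big_enum/=; apply: eq_bigr => s _.
  rewrite ge0_integralZl_EFin//; last by apply/measurable_EFinP/measurable_indic.
  rewrite integral_indic// setIT mulrC EFinM; congr (_ * _)%E; exact: rv_lawE.
- move=> s; apply: measurable_funeM; exact/measurable_EFinP/measurable_indic.
- by move=> s t _; rewrite mule_ge0 ?lee_fin.
Qed.

Lemma P_rv S (X : T -> S) (B : pred S) : fin_rv X ->
  P [set t | B (X t)] = (Pr (rv_law X) B)%:E.
Proof.
move=> mX; rewrite -ExPr -(int_rv mX)//.
rewrite (eq_integral (fun t => (\1_[set t | B (X t)] t)%:E)); last first.
  move=> t _; rewrite indicE; case BX : (B (X t)); first by rewrite mem_set.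
  by rewrite memNset//= BX.
by rewrite integral_indic ?setIT//; exact: (measurable_fin_rv [set s | B s]).
Qed.

Lemma is_dist_rv S (X : T -> S) : fin_rv X -> is_dist (rv_law X).
Proof.
move=> mX; split => [s|]; first exact: rv_law_ge0.
have := P_rv predT mX; rewrite /Pr => /(congr1 fine) /= <-.
by rewrite (_ : mkset _ = setT) ?probability_setT//; apply/seteqP; split.
Qed.

Lemma rv_law_comp S S' (X : T -> S) (g : S -> S') : fin_rv X ->
  rv_law (g \o X) =1 push g (rv_law X).
Proof.
move=> mX s; rewrite /push; have := P_rv (fun r => g r == s) mX.
move=> /(congr1 fine) /= <-; congr (fine (P _)).
by apply/seteqP; split => t /= /eqP.
Qed.

End finite_random_variables.

Lemma cvgn_sum (R : realType) (I : Type) (r : seq I) (P : pred I)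
    (f : nat -> I -> R) (l : I -> R) :
  (forall i, P i -> f n i @[n --> \oo] --> l i) ->
  \sum_(i <- r | P i) f n i @[n --> \oo] --> \sum_(i <- r | P i) l i.
Proof.
move=> fl; elim: r => [|i r IHr].
  by under eq_fun do rewrite big_nil; rewrite big_nil; exact: cvg_cst.
under eq_fun do rewrite big_cons; rewrite big_cons.
by case: ifP => // Pi; apply: cvgD => //; exact: fl.
Qed.

Section almost_sure_limits.
Context d (T : measurableType d) (R : realType) (P : probability T R).

Lemma cvgn_geometric_increments (u : R^nat) (m : nat) :
  (forall i, (m <= i)%N -> `|u i.+1 - u i| <= 2^-1 ^+ i) -> cvgn u.
Proof.
move=> hu; have : cvgn (series (telescope (fun i => u (i + m)%N))).
  apply: normed_cvg; apply: (@series_le_cvg _ _ (geometric 1 2^-1)).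
  - by move=> n /=.
  - by move=> n /=; rewrite mul1r exprn_ge0// invr_ge0.
  - move=> n /=; rewrite mul1r; apply: (le_trans (hu _ (leq_addl n m))).
    by rewrite exprD ler_piMr ?exprn_ge0 ?invr_ge0// exprn_ile1 ?invr_ge0 ?invf_le1 ?ler1n.
  - by apply: is_cvg_geometric_series; rewrite ger0_norm ?invr_ge0// invf_lt1 ?ltr1n.
rewrite telescopeK => h.
have {}h : cvgn (fun i => u (i + m)%N).
  have : cvgn ([sequence u (n + m)%N - u (0 + m)%N]_n + cst (u (0 + m)%N)).
    by apply: is_cvgD h _; exact: is_cvg_cst.
  by congr (cvgn _); apply/funext => n /=; rewrite /GRing.add /= subrK.
by have /cvg_ex[l] := h; rewrite (cvg_shiftn m u) => /cvgP.
Qed.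

(** Chebyshev's inequality for the squares at threshold 4^-i turns second moments 8^-i into
    probabilities 2^-i. By Borel-Cantelli, almost surely all but finitely many increments are below
    2^-i. *)
Lemma ae_cvgn_square_increments (g : nat -> T -> R) (m : nat) :
  (forall i, measurable_fun setT (g i)) ->
  (forall i, (m <= i)%N ->
    (\int[P]_t ((g i.+1 t - g i t) ^+ 2)%:E <= (8^-1 ^+ i)%:E)%E) ->
  {ae P, forall t, cvgn (fun i => g i t)}.
Proof.
move=> mg hg.
have md i : measurable_fun setT (fun t => (g i.+1 t - g i t) ^+ 2).
  by apply: measurable_funX; exact: measurable_funB.
pose F i := [set t | (((4^-1 ^+ (i + m)%N)%:E <= `|((g (i + m).+1 t - g (i + m)%N t) ^+ 2)%:E|)%E)].
have mF i : measurable (F i).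
  rewrite /F -[X in measurable X]setTI.
  apply: emeasurable_fun_c_infty => //; apply: measurableT_comp => //.
  exact/measurable_EFinP.
have PF i : (P (F i) <= (2^-1 ^+ (i + m))%:E)%E.
  have md' : measurable_fun setT
      (fun t => ((g (i + m).+1 t - g (i + m)%N t) ^+ 2)%:E).
    exact/measurable_EFinP.
  have := @le_integral_abse _ _ _ P setT measurableT
    (fun t => ((g (i + m).+1 t - g (i + m)%N t) ^+ 2)%:E) (4^-1 ^+ (i + m)%N).
  move=> le_abse.
  have {le_abse} := le_abse md' _; rewrite exprn_gt0 ?invr_gt0// => /(_ isT).
  rewrite setTI -/(F i) => h.
  have pos4 : (0 < (4^-1 ^+ (i + m) : R)%:E)%E.
    by rewrite lte_fin exprn_gt0 ?invr_gt0.
  rewrite -(@lee_pmul2l _ (4^-1 ^+ (i + m))%:E)//.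
  apply: (le_trans h); rewrite -EFinM -exprMn -invfM -natrM.
  apply: le_trans (hg _ (leq_addl _ _)).
  by rewrite le_eqVlt; apply/orP; left; apply/eqP; apply: eq_integral => t _; rewrite abse_EFin ger0_norm ?sqr_ge0.
have PFoo : (\sum_(n <oo) P (F n) < +oo)%E.
  apply: (@le_lt_trans _ _ (\sum_(n <oo) (2^-1 ^+ n)%:E)%E).
    apply: lee_nneseries => // n _; apply: (le_trans (PF n)).
    by rewrite lee_fin exprD ler_piMr ?exprn_ge0 ?invr_ge0// exprn_ile1 ?invr_ge0 ?invf_le1 ?ler1n.
  apply: (@le_lt_trans _ _ (2%:E : \bar R)); last by rewrite ltry.
  apply: le_trans (@epsilon_trick0 R 2 xpredT _) => //.
  apply: lee_nneseries => // n _.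
  rewrite lee_fin exprVn expnS natrM invfM mulrA divff// mul1r.
  by rewrite natrX.
have N0 := lim_sup_set_cvg0 mF PFoo.
exists (lim_sup_set F); split => //.
  apply: bigcap_measurable => [|k _]; first by exists 0%N.
  exact: bigcup_measurable.
move=> t /= ncv n _ /=; apply: contrapT => nF; apply: ncv.
apply: (@cvgn_geometric_increments _ (n + m)%N) => i nmi.
have im : (m <= i)%N by rewrite (leq_trans _ nmi)// leq_addl.
have : ~ F (i - m)%N t.
  by move=> Fi; apply: nF; exists (i - m)%N => //=; rewrite leq_subRL// addnC.
rewrite /F /= subnK// => /negP; rewrite -ltNge lte_fin => h.
rewrite -(@ler_pXn2r _ 2)// ?nnegrE ?exprn_ge0 ?invr_ge0//.
rewrite real_normK ?num_real// -exprM mulnC exprM.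
rewrite ger0_norm ?sqr_ge0// in h; rewrite ltW// (lt_le_trans h)//.
by have -> : (2^-1 : R) ^+ 2 = 4^-1 by lra.
Qed.

Lemma integral_bounded_cvg (f : nat -> T -> R) (g : T -> R) (D : set T) :
  measurable D -> (forall i, measurable_fun setT (f i)) ->
  measurable_fun setT g ->
  (forall i t, 0 <= f i t <= 1) ->
  {ae P, forall t, f i t @[i --> \oo] --> g t} ->
  (\int[P]_(t in D) (f i t)%:E)%E @[i --> \oo] --> (\int[P]_(t in D) (g t)%:E)%E.
Proof.
move=> mD mf mg f01 fg.
have mf' i : measurable_fun D (fun t => (f i t)%:E).
  exact/measurable_EFinP/measurable_funTS.
have mg' : measurable_fun D (fun t => (g t)%:E).
  exact/measurable_EFinP/measurable_funTS.
have fg' : {ae P, forall t, D t -> (f i t)%:E @[i --> \oo] --> (g t)%:E}.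
  by apply: filterS fg => t h _; apply: cvg_EFin => //; exact: nearW.
have i1 : P.-integrable D (cst 1%:E) by exact: finite_measure_integrable_cst.
have f1' : {ae P, forall t i, D t -> (`|(f i t)%:E| <= cst 1%:E t)%E}.
  apply: aeW => t i _; have /andP[f0 f1] := f01 i t.
  by rewrite /= ger0_norm// lee_fin.
by have [] := dominated_convergence mD mf' mg' fg' i1 f1'.
Qed.

Lemma ae_eq0_integral_square (f : T -> R) : measurable_fun setT f ->
  (\int[P]_t ((f t) ^+ 2)%:E)%E = 0%E -> {ae P, forall t, f t = 0}.
Proof.
move=> mf f0; have mf2 : measurable_fun setT (fun t => ((f t) ^+ 2)%:E).
  exact/measurable_EFinP/measurable_funX.
have /(ae_eq_integral_abs P measurableT mf2) :
    (\int[P]_t `|((f t) ^+ 2)%:E| = 0)%E.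
  by rewrite -f0; apply: eq_integral => t _; rewrite abse_EFin ger0_norm ?sqr_ge0.
apply: filterS => t /(_ I) [] /eqP.
by rewrite expf_eq0 => /andP[_ /eqP].
Qed.

End almost_sure_limits.

(** * Nested partitions of the unit interval *)

Section stacked_intervals.
Context (R : realFieldType) (S : finType) (Q : pred S) (W : S -> R) (c : R).
Hypothesis W_ge0 : forall p, 0 <= W p.

(** Left endpoint of the interval of [p] when intervals of lengths [W], one for each element of [Q],
    are laid end to end from [c] in the order of [enum_rank]. *)
Definition stack (p : S) : R :=
  c + \sum_(p' | Q p' && (enum_rank p' < enum_rank p)%N) W p'.

Lemma stack_ge p : c <= stack p.
Proof. by rewrite lerDl sumr_ge0. Qed.

Lemma stack_le p p' : Q p -> (enum_rank p < enum_rank p')%N ->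
  stack p + W p <= stack p'.
Proof.
move=> Qp pp; rewrite /stack -addrA lerD2l [leRHS](bigD1 p) ?Qp//= addrC lerD2l.
rewrite [leRHS](bigID (fun r => enum_rank r < enum_rank p)%N)/= ler_wpDr ?sumr_ge0//.
rewrite le_eqVlt; apply/orP; left; apply/eqP; apply: eq_bigl => r.
case: (Q r) => //=; case: ltnP => [rp|]; last by rewrite andbF.
rewrite (ltn_trans rp pp)/= andbT; apply/esym/eqP => E.
by rewrite E ltnn in rp.
Qed.

Lemma stack_le_sum p : Q p -> stack p + W p <= c + \sum_(p' | Q p') W p'.
Proof.
move=> Qp; rewrite /stack -addrA lerD2l [leRHS](bigD1 p)//= addrC lerD2l.
rewrite [leRHS](bigID (fun r => enum_rank r < enum_rank p)%N)/= ler_wpDr ?sumr_ge0//.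
rewrite le_eqVlt; apply/orP; left; apply/eqP; apply: eq_bigl => r.
case: (Q r) => //=; case: ltnP => [rp|]; last by rewrite andbF.
by rewrite andbT; apply/esym/eqP => E; rewrite E ltnn in rp.
Qed.

Lemma stack_unique u p p' : Q p -> Q p' -> stack p <= u < stack p + W p ->
  stack p' <= u < stack p' + W p' -> p = p'.
Proof.
move=> Qp Qp' /andP[p1 p2] /andP[p'1 p'2].
have [pp|pp|pp] := ltngtP (enum_rank p) (enum_rank p').
- by have := stack_le Qp pp; move=> h; exfalso; lra.
- by have := stack_le Qp' pp; move=> h; exfalso; lra.
- by apply: enum_rank_inj; exact: val_inj.
Qed.

Lemma stack_exists u : c <= u < c + \sum_(p | Q p) W p ->
  exists2 p, Q p & stack p <= u < stack p + W p.
Proof.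
move=> /andP[cu uc].
(* [f k] is where the first k intervals end; for the least k with u < [f k], the element of rank k -
   1 is the one whose interval contains u. *)
pose f k := c + \sum_(p | Q p && (enum_rank p < k)%N) W p.
have exk : exists k, u < f k.
  exists #|S|; apply: (lt_le_trans uc); rewrite /f lerD2l le_eqVlt; apply/orP; left.
  by apply/eqP; apply: eq_bigl => p; rewrite ltn_ord andbT.
case: (ex_minnP exk) => -[|k] fk kmin.
  by move: fk; rewrite /f big1 ?addr0 ?ltNge ?cu// => p; rewrite ltn0 andbF.
have fk' : f k <= u by rewrite leNgt; apply/negP => /kmin; rewrite ltnn.
have kS : (k < #|S|)%N.
  rewrite ltnNge; apply/negP => Sk; have : f k.+1 = f k.
    congr (_ + _); apply: eq_bigl => p; congr (_ && _).
    by rewrite !(leq_trans (ltn_ord _))// leqW.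
  by move=> E; move: fk; rewrite E ltNge fk'.
pose p := enum_val (Ordinal kS).
have rp : enum_rank p = k :> nat by rewrite enum_valK.
have fS : f k.+1 = f k + (if Q p then W p else 0).
  rewrite /f -addrA; congr (_ + _).
  case Qp : (Q p).
    rewrite (bigD1 p)/=; last by rewrite Qp rp ltnS leqnn.
    rewrite addrC; congr (_ + _); apply: eq_bigl => r.
    rewrite -andbA; congr (_ && _); rewrite ltnS [in RHS]ltn_neqAle andbC.
    congr (_ && _); congr (~~ _); apply/eqP/eqP => [->//|E].
    by apply: enum_rank_inj; apply: ord_inj; rewrite E rp.
  rewrite addr0; apply: eq_bigl => r; case Qr : (Q r) => //=.
  rewrite ltnS leq_eqVlt; case: eqP => //= E.
  suff rE : r = p by rewrite rE Qp in Qr.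
  by apply: enum_rank_inj; apply: ord_inj; rewrite E rp.
have Qp : Q p.
  by move: fk; rewrite fS; case: (Q p) => //; rewrite addr0 ltNge fk'.
have stp : stack p = f k by rewrite /stack rp.
by exists p => //; rewrite stp fk'; move: fk; rewrite fS Qp.
Qed.

End stacked_intervals.

(* A tree of finite sets [T n] with weights is coded by nested partitions of
   [0, 1[ into intervals whose lengths are the weights. *)
Section nested_intervals.
Context (R : realFieldType) (T : nat -> finType) (r : forall n, T n.+1 -> T n)
  (W : forall n, T n -> R).

Fixpoint left_end (n : nat) : T n -> R :=
  match n with
  | 0 => stack predT (@W 0) 0
  | n.+1 => fun p => stack (fun p' => r p' == r p) (@W n.+1) (left_end (r p)) p
  end.

Definition cell (n : nat) (p : T n) (u : R) : bool :=
  left_end p <= u < left_end p + W p.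

Record coherent : Prop := Coherent {
  coherent_ge0 : forall n (p : T n), 0 <= W p;
  coherent_sum : \sum_(p : T 0) W p = 1;
  coherent_add : forall n (p : T n), W p = \sum_(p' | r p' == p) W p' }.

Hypothesis hW : coherent.

Lemma cell_restrict n (p : T n.+1) u : cell p u -> cell (r p) u.
Proof.
move=> /andP[pu up]; apply/andP; split.
  by apply: le_trans pu; apply: stack_ge; exact: coherent_ge0.
apply: (lt_le_trans up); rewrite (coherent_add hW (r p)).
by apply: stack_le_sum => //; exact: coherent_ge0.
Qed.

Lemma cell_unique n (p p' : T n) u : cell p u -> cell p' u -> p = p'.
Proof.
elim: n p p' => [|n IHn] p p' pu pu'.
  by apply: stack_unique pu pu' => //; exact: coherent_ge0.
have rr : r p' = r p by apply: IHn; exact: cell_restrict.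
move: pu'; rewrite /cell /= rr => pu'.
apply: stack_unique pu pu' => //; last exact/eqP.
exact: coherent_ge0.
Qed.

Lemma cell_exists n u : 0 <= u < 1 -> exists p : T n, cell p u.
Proof.
move=> u01; elim: n => [|n [p pu]].
  have [|p _ pu] := @stack_exists _ _ predT (@W 0) 0 u.
  - by rewrite add0r (coherent_sum hW).
  - by exists p.
have [|p' /eqP rp pu'] :=
  @stack_exists _ _ (fun p' => r p' == p) (@W n.+1) (left_end p) u.
- by rewrite -(coherent_add hW).
- by exists p'; rewrite /cell /= rp.
Qed.

Lemma cell_bounds n (p : T n) : 0 <= left_end p /\ left_end p + W p <= 1.
Proof.
elim: n p => [|n IHn] p.
  split; first by apply: stack_ge; exact: coherent_ge0.
  by rewrite -(coherent_sum hW) -[leRHS]add0r; apply: stack_le_sum => //; exact: coherent_ge0.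
have [l0 l1] := IHn (r p); split.
  by apply: (le_trans l0); apply: stack_ge; exact: coherent_ge0.
apply: le_trans l1; rewrite (coherent_add hW (r p)).
by apply: stack_le_sum => //; exact: coherent_ge0.
Qed.

End nested_intervals.

Lemma eq_cell (R : realFieldType) (T : nat -> finType)
    (r : forall n, T n.+1 -> T n) (W W' : forall n, T n -> R) n (p : T n) u :
  (forall n p, W n p = W' n p) -> cell r W p u = cell r W' p u.
Proof.
move=> WW; suff -> : W = W' by [].
by apply: functional_extensionality_dep => m; apply/funext => p'.
Qed.

(** * The random structure driven by uniform coordinates *)

Section levels.
Context (R : realType) (L : language) (w : law L R).

(** [en] increases with the level and is bounded by 1, so it eventually stays within [e] of its
    supremum. *)
Lemma en_almost_max (j m : nat) (p : {set tup L (hv m 'I_j)}) (e : R) : 0 < e ->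
  exists M, forall n k, (M <= n)%N -> (n <= k)%N -> en w p k - en w p n <= e.
Proof.
move=> e0; pose E := [set en w p (n + m) | n in [set: nat]].
have supE : has_sup E.
  split; first by exists (en w p (0 + m)); exists 0%N.
  by exists 1 => _ [n _ <-]; exact: en_le1.
have [_ [n0 _ <-] hn0] := sup_adherent e0 supE.
exists (n0 + m)%N => n k Mn nk.
have mn : (m <= n)%N by rewrite (leq_trans _ Mn)// leq_addl.
have kE : en w p k <= sup E.
  apply: sup_upper_bound => //; exists (k - m)%N => //.
  by rewrite subnK// (leq_trans mn).
have := en_mono w p (leq_addl n0 m) Mn; lra.
Qed.

Lemma exists_levels (j : nat) : exists N : nat -> nat,
  [/\ forall i, (i <= N i)%N, forall i, (N i <= N i.+1)%N &
      forall i m (p : {set tup L (hv m 'I_j)}) k, (m <= i)%N -> (N i <= k)%N ->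
        en w p k - en w p (N i) <= 8^-1 ^+ i].
Proof.
have e0 i : 0 < 8^-1 ^+ i :> R by rewrite exprn_gt0 ?invr_gt0.
pose M i m p := projT1 (cid (@en_almost_max j m p _ (e0 i))).
have hM i m p n k : (M i m p <= n)%N -> (n <= k)%N ->
    en w p k - en w p n <= 8^-1 ^+ i.
  by rewrite /M; case: cid => M' /=; apply.
(* There are finitely many patterns on at most i + 1 hidden vertices, so one bound serves all of
   them; summing the bounds plus one makes the levels increasing and at least i. *)
pose N0 i := (\max_(m < i.+1) \max_(p : {set tup L (hv m 'I_j)}) M i m p)%N.
exists (fun i => \sum_(i' < i.+1) (N0 i').+1)%N; split.
- move=> i; rewrite (leq_trans (leqnSn i))//.
  rewrite -[leqLHS]card_ord -sum1_card; apply: leq_sum => k _.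
  by rewrite ltnS.
- by move=> i; rewrite [leqRHS]big_ord_recr leq_addr.
- move=> i m p k mi; apply: hM; rewrite [leqRHS]big_ord_recr/=.
  apply: (@leq_trans (N0 i)); last by rewrite (leq_trans (leqnSn _))// leq_addl.
  have mi' : (m < i.+1)%N by [].
  apply: leq_trans (leq_bigmax (Ordinal mi')).
  by rewrite (leq_bigmax (F := fun p => M i m p) p).
Qed.

Definition level (j : nat) : nat -> nat := projT1 (cid (exists_levels j)).

Lemma level_ge j i : (i <= level j i)%N.
Proof. by rewrite /level; case: cid => N /= []. Qed.

Lemma level_mono j i : (level j i <= level j i.+1)%N.
Proof. by rewrite /level; case: cid => N /= []. Qed.

Lemma level_gap j i m (p : {set tup L (hv m 'I_j)}) k :
  (m <= i)%N -> (level j i <= k)%N -> en w p k - en w p (level j i) <= 8^-1 ^+ i.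
Proof. by rewrite /level; case: cid => N /= [_ _]; apply. Qed.

(* The conditional weight of the pattern p, given lower information at all
   levels. *)
Definition limit_weight (j m : nat) (p : {set tup L (hv m 'I_j)})
    (D : forall n, {set tup L (hv n 'I_j)}) : R :=
  limn_sup (fun i => q w p (win (low j) (D (level j i)))).

Definition restrict_pattern (j n : nat) (p : {set tup L (hv n.+1 'I_j)}) :
  {set tup L (hv n 'I_j)} := pull (hmap n n.+1 id) p.

(** One number [u] selects a pattern at every level, and nestedness makes these selections
    compatible. *)
Definition in_cell (j n : nat) (p : {set tup L (hv n 'I_j)})
    (D : forall n, {set tup L (hv n 'I_j)}) (u : R) : bool :=
  cell (@restrict_pattern j) (fun m p => @limit_weight j m p D) p u.

Lemma eq_limit_weight (j m : nat) (p : {set tup L (hv m 'I_j)}) D D' :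
  (forall n, win (low j) (D n) = win (low j) (D' n)) ->
  limit_weight p D = limit_weight p D'.
Proof.
by move=> DD; congr limn_sup; apply/funext => i; rewrite DD.
Qed.

Lemma eq_in_cell (j n : nat) (p : {set tup L (hv n 'I_j)}) D D' u :
  (forall n, win (low j) (D n) = win (low j) (D' n)) ->
  in_cell p D u = in_cell p D' u.
Proof.
by move=> DD; apply: eq_cell => m p'; exact: eq_limit_weight.
Qed.

End levels.

(** * The recursive construction from the coordinates *)

Section representation.
Context (R : realType) (L : language) (w : law L R).

Definition pullx (U V : finType) (f : U -> V) (x : cspace R {set V}) :
  cspace R {set U} := fun B => x (f @: B)%SET.

Definition sorted_by (j : nat) (V : finType) (x : cspace R {set V})
    (alpha : 'I_j -> V) : Prop :=
  forall a b : 'I_j, (a < b)%N -> x [set alpha a]%SET < x [set alpha b]%SET.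

(* The tuples seeing exactly j visible vertices; these vertices are labelled in
   increasing order of their coordinates. *)
Definition layer (j : nat)
    (D : forall V : finType, cspace R {set V} -> forall n, {set tup L (hv n V)})
    (V : finType) (x : cspace R {set V}) (n : nat) : {set tup L (hv n V)} :=
  [set t : tup L (hv n V) | (#|vis t| == j) && `[< exists2 alpha : 'I_j -> V,
     sorted_by x alpha /\ (alpha @: [set: 'I_j])%SET = vis t &
     exists s (p : {set tup L (hv n 'I_j)}),
       [/\ t = tmap (hmap n n alpha) s, s \in p &
       in_cell w p (D _ (pullx alpha x)) (x (vis t))] >]]%SET.

Fixpoint random_upto (j : nat) (V : finType) (x : cspace R {set V}) (n : nat) :
    {set tup L (hv n V)} :=
  match j with
  | 0 => finset.set0
  | i.+1 => random_upto i x n :|: layer i (random_upto i) x n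
  end.

(** A tuple with k visible vertices is settled at stage k + 1; later stages add only tuples with
    more. *)
Definition random_str (V : finType) (x : cspace R {set V}) (n : nat) :
    {set tup L (hv n V)} :=
  [set t | t \in random_upto #|vis t|.+1 x n]%SET.

Lemma mem_random_upto j (V : finType) (x : cspace R {set V}) n t :
  (t \in random_upto j x n) = (#|vis t| < j)%N && (t \in random_str x n).
Proof.
elim: j => [|j IHj] /=; first by rewrite inE.
rewrite finset.in_setU IHj ltnS [in RHS]leq_eqVlt.
have [tj|tj] := eqVneq #|vis t| j; last first.
  by rewrite [X in _ || X]inE (negPf tj) orbF.
by rewrite tj ltnn /= [in RHS]inE tj /= finset.in_setU IHj tj ltnn.
Qed.

(** Only the low part enters [in_cell], and there [random_upto k] already agrees with [random_str];
    so [random_str] satisfies a recursive equation free of stages. *)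
Lemma random_strP (V : finType) (x : cspace R {set V}) n (t : tup L (hv n V)) k :
  #|vis t| = k ->
  t \in random_str x n <-> exists2 alpha : 'I_k -> V,
     sorted_by x alpha /\ (alpha @: [set: 'I_k])%SET = vis t &
     exists s (p : {set tup L (hv n 'I_k)}),
       [/\ t = tmap (hmap n n alpha) s, s \in p &
       in_cell w p (random_str (pullx alpha x)) (x (vis t))].
Proof.
move=> tk; rewrite inE tk /= inE mem_random_upto tk ltnn /= inE tk eqxx /=.
have E (alpha : 'I_k -> V) m (p : {set tup L (hv m 'I_k)}) u :
    in_cell w p (random_upto k (pullx alpha x)) u =
    in_cell w p (random_str (pullx alpha x)) u.
  apply: eq_in_cell => i; apply/setP => s; rewrite !mem_win mem_random_upto.
  case sl : (vis s \in low k); rewrite ?andbF// !andbT.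
  suff -> : (#|vis s| < k)%N by [].
  move: sl; rewrite inE -[X in (_ < X)%N]card_ord -cardsT => sT.
  by apply: proper_card; rewrite finset.properT.
split.
  move=> /asboolP[alpha h [s [p [ts sp c]]]]; exists alpha => //.
  by exists s, p; split; [exact: ts|exact: sp|rewrite -E; exact: c].
move=> [alpha h [s [p [ts sp c]]]]; apply/asboolP; exists alpha => //.
by exists s, p; split; [exact: ts|exact: sp|rewrite E; exact: c].
Qed.

Lemma sorted_by_inj (j : nat) (V : finType) (x : cspace R {set V})
  (alpha : 'I_j -> V) : sorted_by x alpha -> injective alpha.
Proof.
move=> xa a b ab; have [lt|lt|/val_inj//] := ltngtP a b.
- by have := xa _ _ lt; rewrite ab ltxx.
- by have := xa _ _ lt; rewrite ab ltxx.
Qed.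

Lemma pullx_comp (U V W : finType) (f : U -> V) (g : V -> W) x :
  pullx f (pullx g x) = pullx (g \o f) x.
Proof. by apply/funext => B; rewrite /pullx imset_comp. Qed.

Lemma tmap_inj (U V : finType) (f : U -> V) : injective f -> injective (@tmap L U V f).
Proof.
move=> fi [P a] [Q b] /= /eqP; rewrite /tmap /= -tag_eqE /tag_eq /=.
case: eqP => //= PQ; subst Q; rewrite tagged_asE => /eqP /ffunP ab.
congr existT; apply/ffunP => i; apply: fi.
by have := ab i; rewrite !ffunE.
Qed.

(** Labels come from the order of the coordinates and not from the vertex set, so the construction
    commutes with restriction. *)
Lemma random_str_natural (U V : finType) (f : U -> V) x n : injective f ->
  pull (hmap n n f) (random_str x n) = random_str (pullx f x) n.
Proof.
move=> fi; have hfi : injective (hmap n n f) by exact: hmap_inj.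
have cardf (t : tup L (hv n U)) : #|vis (tmap (hmap n n f) t)| = #|vis t|.
  by rewrite vis_hmap card_imset.
have hmapc k (alpha : 'I_k -> U) s :
    tmap (hmap n n (f \o alpha)) s = tmap (hmap n n f) (tmap (hmap n n alpha) s).
  by rewrite tmap_comp; apply: eq_tmap => z; rewrite hmap_comp.
apply/setP => t; rewrite mem_pull; apply/idP/idP.
  move=> /(random_strP _ (cardf t))[alpha [xa ta] [s [p [ts sp c]]]].
  apply/(random_strP _ erefl).
  have aP a : exists u, f u = alpha a.
    have : alpha a \in vis (tmap (hmap n n f) t) by rewrite -ta imset_f.
    by rewrite vis_hmap => /imsetP[u _ ->]; exists u.
  have [beta fb] := choice aP.
  have ab : alpha = f \o beta by apply/funext => a; rewrite /= fb.
  subst alpha; exists beta.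
    split; first by move=> a b /xa; rewrite /pullx !imset_set1.
    apply: (imset_inj fi); rewrite -(@vis_hmap _ _ n) -ta.
    by rewrite -imset_comp.
  exists s, p; split; [by apply: (tmap_inj hfi); rewrite ts hmapc|exact: sp|].
  have -> : pullx f x (vis t) = x (vis (tmap (hmap n n f) t)).
    by rewrite vis_hmap.
  by rewrite pullx_comp; exact: c.
move=> /(random_strP _ erefl)[alpha [xa ta] [s [p [ts sp c]]]].
apply/(random_strP _ (cardf t)); exists (f \o alpha).
  split; first by move=> a b /xa; rewrite /pullx !imset_set1.
  by rewrite vis_hmap -[in RHS]ta imset_comp.
exists s, p; split; [by rewrite hmapc -ts|exact: sp|].
by rewrite -pullx_comp vis_hmap; exact: c.
Qed.

Lemma random_str_local (V : finType) (x y : cspace R {set V}) n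
    (t : tup L (hv n V)) :
  (forall B : {set V}, B \subset vis t -> x B = y B) ->
  t \in random_str x n -> t \in random_str y n.
Proof.
move=> xy; have [k tk] : exists k, #|vis t| = k by exists #|vis t|.
move=> /(random_strP _ tk)[alpha [xa ta] [s [p [ts sp c]]]].
have asub (B : {set 'I_k}) : (alpha @: B)%SET \subset vis t.
  by rewrite -ta; exact/imsetS/finset.subsetT.
apply/(random_strP _ tk); exists alpha.
  by split => // a b /xa; rewrite -!imset_set1 !xy.
have xya : pullx alpha y = pullx alpha x.
  by apply/funext => B; rewrite /pullx xy.
have xt : x (vis t) = y (vis t) by exact: xy.
by exists s, p; split; [exact: ts|exact: sp|rewrite -xt xya; exact: c].
Qed.

Lemma measurable_pullx (U V : finType) (f : U -> V) :
  measurable_fun setT (pullx f).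
Proof. by apply: measurable_cspace => B; exact: measurable_coord. Qed.

End representation.

(* Unfolding [random_str] makes unification diverge. *)
#[global] Opaque random_str.

Section cell_measure.
Context (R : realType) (T : nat -> finType) (r : forall n, T n.+1 -> T n)
  (W : forall n, T n -> R) (hW : coherent r W).

Lemma measurable_cell_set n (p : T n) :
  measurable ([set u | cell r W p u] : set (measurableTypeR R)).
Proof.
have -> : [set u | cell r W p u] = `[left_end r W p, left_end r W p + W p[%classic.
  by apply/seteqP; split => u /=; rewrite in_itv.
exact: measurable_itv.
Qed.

Lemma cell_measure n (p : T n) :
  uniform_prob (@ltr01 R) [set u | cell r W p u] = (W p)%:E.
Proof.
have [l0 l1] := cell_bounds hW p; have W0 := coherent_ge0 hW p.
have := U_itv l0 (_ : left_end r W p <= left_end r W p + W p) l1.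
by rewrite lerDl => /(_ W0) ->; rewrite addrC addKr.
Qed.

End cell_measure.

(** * Measurability of the construction *)

Section measurability.
Context (R : realType) (L : language) (w : law L R).

Lemma measurable_ltr_set d (X : measurableType d) (f g : X -> R) :
  measurable_fun setT f -> measurable_fun setT g ->
  measurable [set x | f x < g x].
Proof.
move=> mf mg; have : measurable ([set: X] `&`
    (fun x => f x < g x) @^-1` [set true]) by exact: measurable_fun_ltr.
by rewrite setTI.
Qed.

Lemma measurable_ler_set d (X : measurableType d) (f g : X -> R) :
  measurable_fun setT f -> measurable_fun setT g ->
  measurable [set x | f x <= g x].
Proof.
move=> mf mg; have : measurable ([set: X] `&`
    (fun x => f x <= g x) @^-1` [set true]) by exact: measurable_fun_ler.
by rewrite setTI.
Qed.

Lemma measurable_left_end d (X : measurableType d) (T : nat -> finType)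
    (r : forall n, T n.+1 -> T n) (W : X -> forall n, T n -> R) :
  (forall n p, measurable_fun setT (fun x => W x n p)) ->
  forall n p, measurable_fun setT (fun x => left_end r (W x) (n := n) p).
Proof.
move=> mW; elim=> [|n IHn] p /=; apply: measurable_funD.
- exact: measurable_cst.
- under eq_fun do rewrite big_mkcond; apply: measurable_sum => p'.
  by case: (_ && _); [exact: mW|exact: measurable_cst].
- exact: IHn.
- under eq_fun do rewrite big_mkcond; apply: measurable_sum => p'.
  by case: (_ && _); [exact: mW|exact: measurable_cst].
Qed.

Lemma measurable_cell d (X : measurableType d) (T : nat -> finType)
    (r : forall n, T n.+1 -> T n) (W : X -> forall n, T n -> R) (u : X -> R) :
  (forall n p, measurable_fun setT (fun x => W x n p)) ->
  measurable_fun setT u ->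
  forall n p, measurable [set x | cell r (W x) (n := n) p (u x)].
Proof.
move=> mW mu n p; have ml := measurable_left_end r mW p.
have -> : [set x | cell r (W x) p (u x)] =
    [set x | left_end r (W x) p <= u x] `&`
    [set x | u x < left_end r (W x) p + W x n p].
  by apply/seteqP; split => x /= /andP.
apply: measurableI; first exact: measurable_ler_set.
by apply: measurable_ltr_set => //; exact: measurable_funD.
Qed.

Lemma q_bounded (j m : nat) (p : {set tup L (hv m 'I_j)}) n s :
  0 <= q w p (n := n) s <= 1.
Proof. by rewrite q_ge0 q_le1. Qed.

Lemma limit_weight_ge0 (j m : nat) (p : {set tup L (hv m 'I_j)}) D :
  0 <= limit_weight w p D.
Proof.
rewrite /limit_weight; set u := fun i => _.
have ub : has_ubound (range u) by exists 1 => _ [i _ <-]; exact: q_le1.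
have lb : has_lbound (range u) by exists 0 => _ [i _ <-]; exact: q_ge0.
have su := cvg_sups_inf ub lb.
rewrite /limn_sup; apply: limr_ge; first exact: cvgP su.
apply: nearW => n; apply: (le_trans (q_ge0 w p (win (low j) (D (level w j n))))).
by apply: ub_le_sup; [exact: has_ubound_sdrop|exists n => /=].
Qed.

Lemma measurable_limit_weight (j m : nat) (p : {set tup L (hv m 'I_j)}) d
    (X : measurableType d) (D : X -> forall n, {set tup L (hv n 'I_j)}) :
  (forall n, fin_rv (fun x => win (low j) (D x n))) ->
  measurable_fun setT (fun x => limit_weight w p (D x)).
Proof.
move=> mD; apply: (@measurable_fun_limn_sup _ _ _ _
  (fun i x => q w p (win (low j) (D x (level w j i))))).
- move=> x _; exists 1 => _ [i _ <-]; exact: q_le1.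
- move=> x _; exists 0 => _ [i _ <-]; exact: q_ge0.
- by move=> i; apply: (measurable_fun_fin_rv _ (mD _)).
Qed.

Lemma measurable_sorted_by (j : nat) (V : finType) (alpha : 'I_j -> V) :
  measurable [set x : cspace R {set V} | sorted_by x alpha].
Proof.
have -> : [set x : cspace R {set V} | sorted_by x alpha] =
    \bigcap_(a in [set: 'I_j]) \bigcap_(b in [set b : 'I_j | (a < b)%N])
      [set x | x [set alpha a]%SET < x [set alpha b]%SET].
  by apply/seteqP; split => x /= h a => [_ b ab|b ab]; [exact: h|exact: (h a I b ab)].
apply: fin_bigcap_measurable => // a _; apply: fin_bigcap_measurable => // b _.
by apply: measurable_ltr_set; exact: measurable_coord.
Qed.

(** Induction on the number of visible vertices: the weights for a k-set read only tuples seeing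
    fewer vertices, and the existential in [random_strP] is a finite union. *)
Lemma measurable_random_str (V : finType) n (t : tup L (hv n V)) :
  measurable [set x : cspace R {set V} | t \in random_str w x n].
Proof.
have [k] := ubnP #|vis t|; elim: k => // k IHk in V n t *.
rewrite ltnS leq_eqVlt => /orP[/eqP tk|]; last exact: IHk.
have mlow (alpha : 'I_k -> V) m :
    fin_rv (fun x : cspace R {set V} =>
      win (low k) (random_str w (pullx alpha x) m)).
  apply: fin_rv_set => s.
  have -> : [set x : cspace R {set V} |
        s \in win (low k) (random_str w (pullx alpha x) m)] =
      if vis s \in low k then
        pullx alpha @^-1` [set y | s \in random_str w y m] else set0.
    by case: ifP => sl; apply/seteqP; split => x /=; rewrite mem_win sl ?andbT ?andbF.
  case: ifP => // sl; rewrite -[X in measurable X]setTI.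
  apply: (@measurable_pullx _ _ _ alpha) => //; apply: IHk.
  move: sl; rewrite inE -[X in (_ < X)%N]card_ord -cardsT => sT.
  by apply: proper_card; rewrite finset.properT.
have -> : [set x : cspace R {set V} | t \in random_str w x n] =
  \bigcup_(alpha in [set alpha : {ffun 'I_k -> V} |
             (alpha @: [set: 'I_k])%SET = vis t])
  \bigcup_(s in [set s : tup L (hv n 'I_k) | t = tmap (hmap n n alpha) s])
  \bigcup_(p in [set p : {set tup L (hv n 'I_k)} | s \in p])
    ([set x : cspace R {set V} | sorted_by x alpha] `&`
     [set x : cspace R {set V} |
        in_cell w p (random_str w (pullx alpha x)) (x (vis t))]).
  apply/seteqP; split => x.
    move=> /(random_strP _ _ tk)[alpha [xa ta] [s [p [ts sp c]]]].
    have aE : finfun alpha =1 alpha by move=> a; rewrite ffunE.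
    have aE' : finfun alpha = alpha :> ('I_k -> V) by apply/funext.
    exists (finfun alpha) => /=; first by rewrite aE'.
    exists s; first by rewrite /= aE'.
    by exists p; [exact: sp|rewrite /= aE'; split].
  move=> [alpha ta [s ts [p sp [xa c]]]]; apply/(random_strP _ _ tk).
  by exists alpha => //; exists s, p; split; [exact: ts|exact: sp|exact: c].
apply: fin_bigcup_measurable => // alpha _.
apply: fin_bigcup_measurable => // s _; apply: fin_bigcup_measurable => // p _.
apply: measurableI; first exact: measurable_sorted_by.
apply: measurable_cell; last exact: measurable_coord.
by move=> m p'; apply: measurable_limit_weight => i; exact: mlow.
Qed.

Lemma fin_rv_random_str (V : finType) n :
  fin_rv (fun x : cspace R {set V} => random_str w x n).
Proof. by apply: fin_rv_set => t; exact: measurable_random_str. Qed.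

End measurability.

(** * The representation theorem *)

Section regular_points.
Context (R : realType) (L : language) (w : law L R).

Definition coherent_at (j : nat) (y : cspace R {set 'I_j}) : Prop :=
  coherent (@restrict_pattern L j)
    (fun m p => limit_weight w p (random_str w y)).

Definition good (j : nat) (y : cspace R {set 'I_j}) : Prop :=
  coherent_at y /\ forall m (p : {set tup L (hv m 'I_j)}),
    q w p (win (low j) (random_str w y (level w j i))) @[i --> \oo] -->
    limit_weight w p (random_str w y).

(** Goodness reads only coordinates of proper subsets, hence survives resampling the coordinate of
    the full set. *)
Lemma good_local (j : nat) (y y' : cspace R {set 'I_j}) :
  (forall B, B != [set: 'I_j]%SET -> y B = y' B) ->
  [/\ forall n, win (low j) (random_str w y n) = win (low j) (random_str w y' n) &
      good y -> good y'].
Proof.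
move=> yy; have E n : win (low j) (random_str w y n) = win (low j) (random_str w y' n).
  apply: eq_win => t tl; have sub (B : {set 'I_j}) : B \subset vis t -> y B = y' B.
    move=> Bt; apply: yy; move: tl; rewrite inE; apply: contra => /eqP BT.
    by move: Bt; rewrite BT finset.subTset.
  by apply/idP/idP; apply: random_str_local => B Bt; [exact: sub|exact/esym/sub].
split; first exact: E.
move=> -[c cv].
have W m (p : {set tup L (hv m 'I_j)}) :
    limit_weight w p (random_str w y) = limit_weight w p (random_str w y').
  exact: eq_limit_weight.
split.
  rewrite /coherent_at; have <- : (fun m p => limit_weight w p (random_str w y)) =
      (fun m (p : {set tup L (hv m 'I_j)}) => limit_weight w p (random_str w y')).
    by apply: functional_extensionality_dep => m; apply/funext => p; exact: W.
  exact: c.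
move=> m p; rewrite -W; under eq_fun do rewrite -E; exact: cv.
Qed.

(** The limit superior in [limit_weight] gives a total, measurable function; this recovers the true
    limit wherever it exists. *)
Lemma limit_weight_cvg (j m : nat) (p : {set tup L (hv m 'I_j)}) D (l : R) :
  q w p (win (low j) (D (level w j i))) @[i --> \oo] --> l ->
  limit_weight w p D = l.
Proof. by move=> ql; have [_] := cvg_limn_inf_sup ql. Qed.

Lemma q_notop (j m : nat) (p : {set tup L (hv m 'I_j)}) n s :
  win (top j) p != p -> q w p (n := n) s = 0.
Proof.
move=> pn; rewrite /q /cond /Pr big_pred0 ?mul0r// => K.
apply/negbTE; apply: contra pn => /andP[/eqP <- _]; apply/eqP/setP => t.
by rewrite !mem_win -andbA andbb.
Qed.

Lemma limit_weight_notop (j m : nat) (p : {set tup L (hv m 'I_j)}) D :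
  win (top j) p != p -> limit_weight w p D = 0.
Proof.
move=> pn; apply: limit_weight_cvg; under eq_fun do rewrite q_notop//.
exact: cvg_cst.
Qed.

Lemma sorted_self_map (j : nat) (y : cspace R {set 'I_j}) (alpha : 'I_j -> 'I_j) :
  sorted_by y id -> sorted_by y alpha -> alpha =1 id.
Proof.
move=> yi ya; have mono (a b : 'I_j) : (a < b)%N -> (alpha a < alpha b)%N.
  move=> /ya lt; rewrite ltnNge leq_eqVlt; apply/negP => /orP[/eqP/val_inj E|/yi E].
    by rewrite E ltxx in lt.
  by have := lt_trans lt E; rewrite ltxx.
have le_alpha (a : 'I_j) : (a <= alpha a)%N.
  case: a => a; elim: a => [//|a IHa] aj.
  apply: leq_ltn_trans (IHa (ltnW aj)) _; exact: mono.
have ai : injective alpha.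
  move=> a b ab; have [/mono|/mono|/val_inj//] := ltngtP a b;
  by rewrite ab ltnn.
(* An increasing self-map satisfies a <= [alpha a], and a permutation leaves the sum unchanged, so
   all these inequalities are equalities. *)
have : (\sum_(a < j) a <= \sum_(a < j) alpha a ?= iff [forall a : 'I_j, a == alpha a :> nat])%N.
  by apply: leqif_sum => a _; exact/leqif_eq.
have -> : (\sum_(a < j) alpha a = \sum_(a < j) a)%N.
  by rewrite [RHS](reindex_inj ai).
by case=> _; rewrite eqxx => /esym/forallP h a; apply/esym/val_inj/eqP/h.
Qed.

Lemma pullx_id (V : finType) (x : cspace R {set V}) : pullx id x = x.
Proof. by apply/funext => B; rewrite /pullx imset_id. Qed.

Section one_top.
Context (j : nat) (y : cspace R {set 'I_j}).
Hypotheses (gy : coherent_at y) (yT : 0 <= y [set: 'I_j]%SET < 1) (ys : sorted_by y id).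

(** When the vertex coordinates increase with the labels, the identity is the only sorted labelling;
    the cells being disjoint, the coordinate of the full set dictates the whole top pattern. *)
Lemma in_cell_top n (p : {set tup L (hv n 'I_j)}) :
  in_cell w p (random_str w y) (y [set: 'I_j]%SET) ->
  win (top j) (random_str w y n) = p.
Proof.
(* A pattern with a tuple outside the top layer has weight 0, hence an empty cell. *)
move=> c; have pT : win (top j) p = p.
  apply/eqP; apply: contraT => /limit_weight_notop W0.
  by move: c => /andP[h]; rewrite ltNge W0 addr0 => /negP; case.
have cj (t : tup L (hv n 'I_j)) : vis t = [set: 'I_j]%SET -> #|vis t| = j.
  by move=> ->; rewrite cardsT card_ord.
apply/setP => t; rewrite mem_win; apply/andP/idP.
  move=> [tD]; rewrite inE => /eqP tT.
  move: tD => /(random_strP _ _ (cj _ tT))[alpha [ya ta] [s [p' [ts sp' c']]]].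
  have a1 : alpha = id by apply/funext; exact: (sorted_self_map ys ya).
  have yy : pullx alpha y = y by rewrite a1 pullx_id.
  rewrite yy tT in c'; rewrite (cell_unique gy c c') ts a1.
  by rewrite (eq_tmap (@hmap_id n _)) tmap_id.
move=> tp; have : t \in win (top j) p by rewrite pT.
rewrite mem_win => /andP[_ tT]; split; last exact: tT.
rewrite inE in tT; move/eqP: tT => tT.
apply/(random_strP _ _ (cj _ tT)); exists id; first by rewrite imset_id tT.
exists t, p; split; [|exact: tp|].
  by rewrite (eq_tmap (@hmap_id n _)) tmap_id.
by rewrite pullx_id tT; exact: c.
Qed.

Lemma top_in_cell n (p : {set tup L (hv n 'I_j)}) :
  win (top j) (random_str w y n) = p ->
  in_cell w p (random_str w y) (y [set: 'I_j]%SET).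
Proof.
move=> <-; have [p' c] := cell_exists gy n yT.
rewrite (in_cell_top c); exact: c.
Qed.

(** The cell chosen at level n + 1 lies inside the cell of its restriction, so the patterns at the
    two levels match. *)
Lemma top_restrict n (s : tup L (hv n 'I_j)) : vis s = [set: 'I_j]%SET ->
  (tmap (hmap n n.+1 id) s \in random_str w y n.+1) = (s \in random_str w y n).
Proof.
move=> sT; have c' := top_in_cell (erefl (win (top j) (random_str w y n.+1))).
have c := cell_restrict gy c'.
have sv (m : nat) (K : {set tup L (hv m 'I_j)}) r : vis r = [set: 'I_j]%SET ->
    (r \in K) = (r \in win (top j) K).
  by move=> rT; rewrite mem_win rT !inE eqxx andbT.
rewrite (sv _ _ s)// (in_cell_top c) mem_pull (sv _ (random_str w y n.+1))//.
by rewrite vis_hmap imset_id.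
Qed.

End one_top.

Lemma exists_sorted (V : finType) (x : cspace R {set V}) (A : {set V}) k :
  #|A| = k -> (forall u v, u != v -> x [set u]%SET != x [set v]%SET) ->
  exists2 alpha : 'I_k -> V, sorted_by x alpha & (alpha @: [set: 'I_k])%SET = A.
Proof.
move=> Ak nt; pose le u v := x [set u]%SET <= x [set v]%SET.
pose s := sort le (enum A).
have ss : size s = k by rewrite size_sort -cardE.
have s_uniq : uniq s by rewrite sort_uniq enum_uniq.
have le_tr : transitive le by move=> v u r; exact: le_trans.
have s_sorted : sorted le s by apply: sort_sorted => u v; exact: le_total.
pose alpha (i : 'I_k) := tnth (in_tuple s) (cast_ord (esym ss) i).
have alphaE v0 (i : 'I_k) : alpha i = nth v0 s i by rewrite /alpha (tnth_nth v0).
exists alpha.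
  move=> a b ab; have v0 := alpha a; rewrite !(alphaE v0).
  rewrite lt_neqAle; apply/andP; split.
    by apply: nt; rewrite nth_uniq ?ss// neq_ltn ab.
  have := sorted_leq_nth le_tr (fun u => lexx _) v0 s_sorted.
  by apply => //; rewrite ?inE ?ss// ltnW.
apply/setP => v; rewrite -[RHS]mem_enum -(mem_sort le); apply/imsetP/idP.
  by move=> [i _ ->]; rewrite mem_tnth.
move=> vs; have iv : (index v s < k)%N by rewrite -ss index_mem.
by exists (Ordinal iv) => //; rewrite (alphaE v)/= nth_index.
Qed.

Lemma factor_tuple (V : finType) j n (alpha : 'I_j -> V) (t : tup L (hv n V)) :
  (alpha @: [set: 'I_j])%SET = vis t ->
  exists s, t = tmap (hmap n n alpha) s.
Proof.
case: t => P a ta.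
have aP i : exists z : hv n 'I_j, hmap n n alpha z = a i.
  case ai : (a i) => [h|v]; first by exists (inl h); rewrite /= inord_val.
  have : v \in vis (Tagged (fun P : L => {ffun 'I_(arity P) -> hv n V}) a).
    by apply/visP; exists i.
  by rewrite -ta => /imsetP[b _ ->]; exists (inr b).
have [b ab] := choice aP; exists (Tagged (fun P : L => {ffun 'I_(arity P) -> hv n 'I_j}) (finfun b)).
by congr existT; apply/ffunP => i; rewrite !ffunE ab.
Qed.

Definition regular (j : nat) (V : finType) (x : cspace R {set V}) : Prop :=
  [/\ forall i, (i < j)%N -> forall alpha : 'I_i -> V, injective alpha ->
        good (pullx alpha x),
      forall A, 0 <= x A < 1 &
      forall u v, u != v -> x [set u]%SET != x [set v]%SET].

(** Hidden vertices are added one at a time; labelling the visible set in sorted order reduces each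
    step to [top_restrict]. *)
Lemma random_str_restrict (j : nat) (V : finType) (x : cspace R {set V}) m n
    (t : tup L (hv m V)) : regular j x -> (#|vis t| < j)%N -> (m <= n)%N ->
  (tmap (hmap m n id) t \in random_str w x n) = (t \in random_str w x m).
Proof.
move=> [xg x01 xt]; elim: n => [|n IHn] in t *.
  by rewrite leqn0 => tj /eqP m0; subst m; rewrite (eq_tmap (@hmap_id 0 _)) tmap_id.
move=> tj; rewrite leq_eqVlt => /predU1P[mn|mn].
  by subst m; rewrite (eq_tmap (@hmap_id _ _)) tmap_id.
rewrite -IHn//; set t' := tmap (hmap m n id) t.
have -> : tmap (hmap m n.+1 id) t = tmap (hmap n n.+1 id) t'.
  by rewrite tmap_comp; apply: eq_tmap => z; rewrite hmap_comp.
have t'j : (#|vis t'| < j)%N by rewrite vis_hmap imset_id.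
have [k tk] : exists k, #|vis t'| = k by exists #|vis t'|.
have [alpha xa ta] := exists_sorted tk xt.
have ai := sorted_by_inj xa.
have [s ts] := factor_tuple ta.
have sT : vis s = [set: 'I_k]%SET.
  by apply: (imset_inj ai); rewrite ta ts vis_hmap.
have -> : tmap (hmap n n.+1 id) t' = tmap (hmap n.+1 n.+1 alpha) (tmap (hmap n n.+1 id) s).
  rewrite ts !tmap_comp; apply: eq_tmap => z.
  by rewrite !hmap_comp.
have Dn i r : (tmap (hmap i i alpha) r \in random_str w x i) =
    (r \in random_str w (pullx alpha x) i).
  by rewrite -mem_pull random_str_natural.
rewrite ts !Dn; apply: top_restrict => //.
- by have [] : good (pullx alpha x) by apply: xg; rewrite // -tk.
- exact: x01.
- by move=> a b /xa; rewrite /pullx !imset_set1.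
Qed.

Lemma ae_regular (j : nat) (V : finType) :
  (forall i, (i < j)%N -> {ae lam R {set 'I_i}, forall y, good y}) ->
  {ae lam R {set V}, forall x, regular j x}.
Proof.
move=> gae.
have h1 : {ae lam R {set V}, forall x, forall (i : 'I_j)
    (alpha : {ffun 'I_i -> V}), injective alpha -> good (pullx alpha x)}.
  apply: filter_forall => i; apply: filter_forall => alpha.
  have [ai|nai] := pselect (injective alpha); last by apply: aeW => x /nai.
  have := gae i (ltn_ord i).
  by move=> /(lam_reindex_ae (imset_inj ai)); apply: lam_aeS => x gx _; exact: gx.
have h2 : {ae lam R {set V}, forall x, forall A, 0 <= x A < 1}.
  by apply: filter_forall => A; exact: lam_coord_itv.
have h3 : {ae lam R {set V}, forall x, forall u v, u != v ->
    x [set u]%SET != x [set v]%SET}.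
  apply: filter_forall => u; apply: filter_forall => v.
  have [->|uv] := eqVneq u v; first exact: aeW.
  have /(@lam_no_ties R) : [set u]%SET != [set v]%SET.
    by apply: contra uv => /eqP/finset.set1_inj ->.
  by apply: lam_aeS => x xuv _; exact: xuv.
apply: filterS3 h1 h2 h3 => x g1 g2 g3; split => // i ij alpha ai.
have aE : finfun alpha = alpha :> ('I_i -> V) by apply/funext => a; rewrite ffunE.
have ai' : injective (finfun alpha) by rewrite aE.
by have := g1 (Ordinal ij) (finfun alpha) ai'; rewrite aE.
Qed.

End regular_points.

(** * Almost sure convergence of the conditional weights *)

Section conditional_weights.
Context (R : realType) (L : language) (w : law L R).

(** The hypothesis excludes null fibres, on which every [q w p s] is 0 by the convention on
    division. *)
Lemma q_sum (j m n : nat) (s : {set tup L (hv n 'I_j)}) :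
  push (win (low j)) (weight w (hv n 'I_j)) s != 0 ->
  \sum_(p : {set tup L (hv m 'I_j)}) q w p s = 1.
Proof.
move=> s0; rewrite /q /cond -mulr_suml -[X in X / _]/(\sum_(p | predT p) _).
by rewrite sum_Pr_fiber /= divff.
Qed.

Lemma q_restrict (j m n : nat) (p : {set tup L (hv m 'I_j)})
    (s : {set tup L (hv n 'I_j)}) :
  q w p s = \sum_(p' | restrict_pattern p' == p) q w p' s.
Proof.
rewrite /q /cond -mulr_suml sum_Pr_fiber; congr (_ / _); apply: eq_Pr => K.
congr (_ && _); rewrite /at_top /restrict_pattern; congr (_ == _).
rewrite (@pull_win _ _ _ _ _ _ (top j)); last by move=> B; rewrite imset_id.
by congr win; rewrite pull_comp; apply: eq_pull => z; rewrite hmap_comp.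
Qed.

(** All levels n are required at once, because the weights for a j-set use the low part at
    arbitrarily high levels. *)
Definition has_law (V : finType) (F : {set {set V}}) : Prop := forall n,
  rv_law (lam R {set V}) (fun x => win F (random_str w x n)) =1
  push (win F) (weight w (hv n V)).

Lemma fin_rv_win (V : finType) (F : {set {set V}}) n :
  fin_rv (fun x : cspace R {set V} => win F (random_str w x n)).
Proof. exact: (fin_rv_comp (win F) (@fin_rv_random_str R L w V n)). Qed.

Lemma win_restrict (j : nat) (V : finType) (x : cspace R {set V})
    (F : {set {set V}}) m n : regular w j x ->
  (forall B, B \in F -> (#|B| < j)%N) -> (m <= n)%N ->
  win F (pull (hmap m n id) (random_str w x n)) = win F (random_str w x m).
Proof.
move=> xr Fj mn; apply: eq_win => t tF; rewrite mem_pull.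
exact: (random_str_restrict xr (Fj _ tF)).
Qed.

(** Once the law of the low part is known, the second moments of the increments of [q] are gaps of
    [en], so the choice of levels gives almost sure convergence; coherence holds at finite levels
    and passes to the limit through finite sums. *)
Lemma ae_good (j : nat) :
  (forall i, (i < j)%N -> {ae lam R {set 'I_i}, forall y, good w y}) ->
  has_law (low j) -> {ae lam R {set 'I_j}, forall y, good w y}.
Proof.
move=> gae hlow; have lowj B : B \in low j -> (#|B| < j)%N.
  rewrite inE -[X in (_ < X)%N]card_ord -cardsT => sT.
  by apply: proper_card; rewrite finset.properT.
have reg := @ae_regular R L w j 'I_j gae.
pose X n (y : cspace R {set 'I_j}) := win (low j) (random_str w y n).
have mX n : fin_rv (X n) by exact: fin_rv_win.
have cvgq m (p : {set tup L (hv m 'I_j)}) : {ae lam R {set 'I_j}, forall y,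
    cvgn (fun i => q w p (X (level w j i) y))}.
  apply: (@ae_cvgn_square_increments _ _ _ _
    (fun i y => q w p (X (level w j i) y)) m).
    by move=> i; exact: measurable_fun_fin_rv.
  move=> i mi; set n := level w j i; set k := level w j i.+1.
  have mn : (m <= n)%N by rewrite (leq_trans mi)// level_ge.
  (* At a regular point the low part at level n is a restriction of the one at level k, so the
     increment is a function of a single variable of known law. *)
  pose G (s : {set tup L (hv k 'I_j)}) : R :=
    (q w p s - q w p (win (low j) (pull (hmap n k id) s))) ^+ 2.
  have -> : (\int[lam R {set 'I_j}]_t ((q w p (X k t) - q w p (X n t)) ^+ 2)%:E =
      \int[lam R {set 'I_j}]_t (G (X k t))%:E)%E.
    apply: ae_eq_integral => //.
    - apply/measurable_EFinP; apply: measurable_funX; apply: measurable_funB;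
      exact: measurable_fun_fin_rv.
    - by apply/measurable_EFinP; exact: measurable_fun_fin_rv.
    - have [N [mN N0 hN]] := reg; exists N; split => // y /= ny; apply: hN => /= yr.
      apply: ny => _; rewrite /G /X win_pull; last by move=> B; rewrite imset_id.
      by rewrite (win_restrict yr lowj)//; exact: level_mono.
  rewrite int_rv//; last by move=> s; exact: sqr_ge0.
  rewrite lee_fin; have -> : Ex (rv_law (lam R {set 'I_j}) (X k)) G =
      Ex (weight w (hv k 'I_j)) (G \o win (low j)).
    by rewrite -Ex_push; apply: eq_bigr => s _; rewrite hlow.
  have nk : (n <= k)%N by exact: level_mono.
  rewrite (@eq_Ex _ _ _ _ (fun K => (q w p (win (low j) K) -
    q w p (win (low j) (pull (hmap n k id) K))) ^+ 2)); last first.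
    by move=> K /=; rewrite /G win_pull // => B; rewrite imset_id.
  by rewrite en_increment//; exact: level_gap.
(* Almost surely the random low part avoids the null fibres, so that [q_sum] applies at every
   level. *)
have pos n : {ae lam R {set 'I_j}, forall y,
    push (win (low j)) (weight w (hv n 'I_j)) (X n y) != 0}.
  exists [set y | push (win (low j)) (weight w (hv n 'I_j)) (X n y) == 0]; split.
  - exact: (measurable_fin_rv [set s | push (win (low j)) (weight w (hv n 'I_j)) s == 0]).
  - rewrite (@P_rv _ _ _ _ _ (X n)
      (fun s => push (win (low j)) (weight w (hv n 'I_j)) s == 0))//.
    by rewrite /Pr big1// => s /eqP s0; rewrite hlow.
  - by move=> y /= /negP; rewrite negbK.
have cvgq' : {ae lam R {set 'I_j}, forall y, forall m (p : {set tup L (hv m 'I_j)}),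
    cvgn (fun i => q w p (X (level w j i) y))}.
  apply: ae_foralln => m; apply: filter_forall => p; exact: cvgq.
have pos' := ae_foralln pos.
apply: filterS2 cvgq' pos' => y ycv ypos.
have cv m (p : {set tup L (hv m 'I_j)}) :
    q w p (X (level w j i) y) @[i --> \oo] --> limit_weight w p (random_str w y).
  have := ycv m p; set l := lim _ => ql.
  by rewrite (limit_weight_cvg ql).
split; last exact: cv.
split.
- move=> m p; rewrite -(cvg_lim _ (cv m p))//; apply: limr_ge.
    exact: cvgP (cv m p).
  by apply: nearW => i; exact: q_ge0.
- have h : (fun i => \sum_(p : {set tup L (hv 0 'I_j)}) q w p (X (level w j i) y))
      @ \oo --> \sum_(p : {set tup L (hv 0 'I_j)}) limit_weight w p (random_str w y).
    by apply: cvgn_sum => p _; exact: cv.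
  have E : (fun i => \sum_(p : {set tup L (hv 0 'I_j)}) q w p (X (level w j i) y)) = cst 1.
    by apply/funext => i; exact: (q_sum 0 (ypos (level w j i))).
  by rewrite E in h; rewrite -(cvg_lim (@Rhausdorff R) h) lim_cst.
- move=> m p.
  have h : (fun i => \sum_(p' | restrict_pattern p' == p) q w p' (X (level w j i) y))
      @ \oo --> \sum_(p' | restrict_pattern p' == p) limit_weight w p' (random_str w y).
    by apply: cvgn_sum => p' _; exact: cv.
  have E : (fun i => \sum_(p' | restrict_pattern p' == p) q w p' (X (level w j i) y)) =
      (fun i => q w p (X (level w j i) y)).
    by apply/funext => i; rewrite -q_restrict.
  by rewrite E in h; rewrite -(cvg_lim (@Rhausdorff R) h) (cvg_lim (@Rhausdorff R) (cv m p)).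
Qed.

End conditional_weights.

Section relabelling.
Context (R : realType) (L : language) (w : law L R).
Context (j m : nat) (s : 'I_j -> 'I_j) (s_inj : injective s).

Lemma imset_full : (s @: [set: 'I_j])%SET = [set: 'I_j]%SET.
Proof.
apply/eqP; rewrite finset.eqEcard; apply/andP; split; first exact: finset.subsetT.
by rewrite card_imset.
Qed.

Lemma pull_top (n : nat) (K : {set tup L (hv n 'I_j)}) :
  pull (hmap m n s) (win (top j) K) = win (top j) (pull (hmap m n s) K).
Proof.
by apply: pull_win => B; rewrite !inE -[in RHS]imset_full (inj_eq (imset_inj s_inj)).
Qed.

Lemma limit_weight_perm (p : {set tup L (hv m 'I_j)}) (y : cspace R {set 'I_j}) :
  good w y -> good w (pullx s y) ->
  limit_weight w (pull (hmap m m s) p) (random_str w (pullx s y)) =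
  limit_weight w p (random_str w y).
Proof.
move=> [_ gy] [_ gsy]; have := gsy m (pull (hmap m m s) p).
move=> /(cvg_lim (@Rhausdorff R)) <-; apply: cvg_lim; first exact: Rhausdorff.
apply: cvg_trans (gy m p); apply: near_eq_cvg; near=> i.
rewrite -random_str_natural// q_perm//.
rewrite (@leq_trans i)//; last exact: level_ge.
by near: i; exact: nbhs_infty_ge.
Unshelve. all: by end_near. Qed.

End relabelling.

(** * Adding one j-set to a down-closed family *)

Section add_set.
Context (R : realType) (L : language) (w : law L R).
Context (V : finType) (j : nat) (F : {set {set V}}) (alpha : 'I_j -> V).
Hypotheses (alpha_inj : injective alpha)
  (F_down : forall B C : {set V}, B \in F -> C \subset B -> C \in F)
  (F_card : forall B, B \in F -> (#|B| <= j)%N).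
Let A := (alpha @: [set: 'I_j])%SET.
Let F' := (F :\ A)%SET.
Hypotheses (A_F : A \in F)
  (gae : forall i, (i < j.+1)%N -> {ae lam R {set 'I_i}, forall y, good w y})
  (F'_law : has_law w F').

Let A_card : #|A| = j.
Proof. by rewrite card_imset// cardsT card_ord. Qed.

Let F'_notA B : B \in F' -> ~~ (A \subset B).
Proof.
move=> /setD1P[BA BF]; apply: contra BA => AB; rewrite eq_sym.
by rewrite finset.eqEcard AB A_card F_card.
Qed.

Let F'_low B : B \in low j -> (alpha @: B)%SET \in F'.
Proof.
rewrite inE => BT; apply/setD1P; split.
  by rewrite (inj_eq (imset_inj alpha_inj)).
by apply: F_down A_F _; exact/imsetS/finset.subsetT.
Qed.

Lemma win_split (beta : 'I_j -> V) n (s K : {set tup L (hv n V)}) :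
  injective beta -> (beta @: [set: 'I_j])%SET = A -> win F s = s ->
  win F K = s <-> win F' K = win F' s /\
    win (top j) (pull (hmap n n beta) K) = win (top j) (pull (hmap n n beta) s).
Proof.
move=> bi bA sF; split.
  move=> <-; split.
    by apply: eq_win => t /setD1P[_ tF]; rewrite mem_win tF andbT.
  by rewrite win_pull// => B; rewrite inE => /eqP ->; rewrite bA.
move=> [E1 E2]; rewrite -sF; apply: eq_win => t tF.
have [tA|tA] := eqVneq (vis t) A.
  have [r tr] : exists r, t = tmap (hmap n n beta) r.
    by apply: factor_tuple; rewrite bA tA.
  have rT : vis r \in top j.
    by rewrite inE; apply/eqP/(imset_inj bi); rewrite bA -tA tr vis_hmap.
  move: E2 => /setP/(_ r); rewrite !mem_win rT !andbT !mem_pull -tr.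
  by move=> ->.
have tF' : vis t \in F' by apply/setD1P.
by move: E1 => /setP/(_ t); rewrite !mem_win tF' !andbT => ->.
Qed.

Section target.
Context (m : nat) (s' : {set tup L (hv m V)}) (p : {set tup L (hv m 'I_j)}).

Let E n := Ex (weight w (hv n V)) (fun K => (win F' (pull (hmap m n id) K) == s')%:R *
  q w p (win (low j) (pull (hmap n n alpha) K))).

Let target := Pr (weight w (hv m V)) (fun K => (win F' K == s') &&
  (win (top j) (pull (hmap m m alpha) K) == p)).

Lemma target_level n : (m <= n)%N -> target =
  Pr (weight w (hv n V)) (fun K => (win F' (pull (hmap m n id) K) == s') &&
    at_top p (pull (hmap n n alpha) K)).
Proof.
move=> mn; rewrite /target.
have wm : push (pull (hmap m n id)) (weight w (hv n V)) =1 weight w (hv m V).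
  exact/law_pull/hmap_inj.
rewrite [LHS](eq_bigr (push (pull (hmap m n id)) (weight w (hv n V)))); last first.
  by move=> K _; rewrite wm.
rewrite -[LHS]/(Pr _ _) Pr_push; apply: eq_Pr => K /=.
congr (_ && (win (top j) _ == p)); rewrite !pull_comp; apply: eq_pull => z.
by rewrite (hmap_comp n id alpha mn) (hmap_comp n alpha id (leqnn m)).
Qed.

(** The defect of conditional independence, squared, is at most an energy gap, and along [level]
    these gaps are at most 8^-i. *)
Lemma level_cvg_target : E (level w j i) @[i --> \oo] --> target.
Proof.
have bound i : (m <= i)%N -> (target - E (level w j i)) ^+ 2 <= 8^-1 ^+ i.
  move=> mi; have mn : (m <= level w j i)%N by rewrite (leq_trans mi)// level_ge.
  rewrite (target_level mn); apply: le_trans (level_gap p mi (leq_addr #|V| _)).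
  exact: (@cond_independence _ _ w V j (level w j i) alpha alpha_inj m F' p
    (fun t => t == s') mn F'_notA F'_low).
have g0 : (8^-1 ^+ i : R) @[i --> \oo] --> (0 : R).
  by apply: cvg_expr; rewrite ger0_norm ?invr_ge0// invf_lt1// ltr1n.
apply/cvgrPdist_le => e e0.
have e2 : 0 < e ^+ 2 by rewrite exprn_gt0.
have /cvgrPdist_le /(_ _ e2) g0e := g0.
near=> i.
rewrite -(@ler_pXn2r _ 2)// ?nnegrE ?(ltW e0)//.
rewrite real_normK ?num_real//; apply: (le_trans (bound i _)).
  by near: i; exact: nbhs_infty_ge.
have : `|0 - 8^-1 ^+ i| <= e ^+ 2 by near: i.
by rewrite sub0r normrN ger0_norm// exprn_ge0// invr_ge0.
Unshelve. all: by end_near. Qed.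

Let Bset := [set x : cspace R {set V} | win F' (random_str w x m) = s'].

Let measurable_Bset : measurable Bset.
Proof. exact: (@fin_rv_win R L w V F' m s'). Qed.

Let reg : {ae lam R {set V}, forall x, regular w j.+1 x}.
Proof. exact: ae_regular. Qed.

Let F'_card B : B \in F' -> (#|B| < j.+1)%N.
Proof. by move=> /setD1P[_ /F_card]. Qed.

Lemma measurable_level_weight n : measurable_fun setT (fun x : cspace R {set V} =>
  q w p (win (low j) (random_str w (pullx alpha x) n))).
Proof.
have -> : (fun x : cspace R {set V} =>
      q w p (win (low j) (random_str w (pullx alpha x) n))) =
    (fun x => q w p (win (low j) (pull (hmap n n alpha) (random_str w x n)))).
  by apply/funext => x; rewrite random_str_natural.
exact: (measurable_fun_fin_rv
  (fun t => q w p (win (low j) (pull (hmap n n alpha) t)))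
  (@fin_rv_random_str R L w V n)).
Qed.

(** [F'] contains the image of every proper subset of ['I_j], so both factors of [E] are functions
    of the [F'] part, whose law is known. *)
Lemma level_integral n : (m <= n)%N ->
  (E n)%:E = (\int[lam R {set V}]_(x in Bset)
    (q w p (win (low j) (random_str w (pullx alpha x) n)))%:E)%E.
Proof.
move=> mn; pose H (t : {set tup L (hv n V)}) : R :=
  (win F' (pull (hmap m n id) t) == s')%:R *
  q w p (win (low j) (pull (hmap n n alpha) t)).
have HF K : H (win F' K) = H K.
  rewrite /H win_pull; last by move=> B; rewrite imset_id.
  by rewrite win_pull.
have -> : E n = Ex (rv_law (lam R {set V}) (fun x => win F' (random_str w x n))) H.
  transitivity (Ex (push (win F') (weight w (hv n V))) H).
    by rewrite Ex_push; apply: eq_Ex => K /=; rewrite HF.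
  by apply: eq_bigr => t _; rewrite F'_law.
rewrite -int_rv; first last.
- by move=> t; rewrite mulr_ge0 ?ler0n ?q_ge0.
- exact: fin_rv_win.
rewrite [RHS]integral_mkcond; apply: ae_eq_integral => //.
- by apply/measurable_EFinP; apply: measurable_fun_fin_rv; exact: fin_rv_win.
- apply/(measurable_restrictT _ measurable_Bset).
  apply/measurable_EFinP; apply: measurable_funTS.
  exact: measurable_level_weight.
- have [N [mN N0 hN]] := reg; exists N; split => // x /= nx; apply: hN => /= xr.
  apply: nx => _; rewrite HF /H (win_restrict xr F'_card mn) random_str_natural//.
  rewrite patchE; have [xB|xB] := pselect (Bset x).
    by rewrite mem_set// xB eqxx mul1r.
  rewrite memNset//; have /eqP/negbTE -> : win F' (random_str w x m) <> s' by [].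
  by rewrite mul0r.
Qed.

Lemma measurable_limit_weight_pull : measurable_fun setT (fun x : cspace R {set V} =>
    limit_weight w p (random_str w (pullx alpha x))).
Proof.
apply: measurable_limit_weight => n.
have -> : (fun x : cspace R {set V} => win (low j) (random_str w (pullx alpha x) n)) =
    (fun x => win (low j) (pull (hmap n n alpha) (random_str w x n))).
  by apply/funext => x; rewrite random_str_natural.
exact: (fin_rv_comp (fun t => win (low j) (pull (hmap n n alpha) t))
  (@fin_rv_random_str R L w V n)).
Qed.

(** Both sides are limits of [E] along the levels: the left by conditional independence, the right
    by dominated convergence, almost every point being regular. *)
Lemma target_integral : target%:E = (\int[lam R {set V}]_(x in Bset)
    (limit_weight w p (random_str w (pullx alpha x)))%:E)%E.
Proof.
have mlw := measurable_limit_weight_pull.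
have h := @integral_bounded_cvg _ _ R (lam R {set V})
  (fun i x => q w p (win (low j) (random_str w (pullx alpha x) (level w j i))))
  _ _ measurable_Bset (fun i => measurable_level_weight (level w j i)) mlw.
have {}h := h (fun i x => q_bounded w p _).
have {}h := h (lam_aeS (fun x (xr : regular w j.+1 x) =>
  let: And3 xg _ _ := xr in (xg j (ltnSn j) alpha alpha_inj).2 m p) reg).
rewrite -(cvg_lim (@ereal_hausdorff R) h).
apply/esym/cvg_lim; first exact: ereal_hausdorff.
have ht : (E (level w j i))%:E @[i --> \oo] --> target%:E.
  by apply: cvg_EFin; [exact: nearW|exact: level_cvg_target].
apply: cvg_trans ht.
apply: near_eq_cvg; near=> i => /=; rewrite -level_integral//.
rewrite (@leq_trans i)//; last exact: level_ge.
by near: i; exact: nbhs_infty_ge.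
Unshelve. all: by end_near. Qed.

End target.

Section resampling.
Context (m : nat) (s : {set tup L (hv m V)}) (sF : win F s = s).
Let s' := win F' s.
Let p := win (top j) (pull (hmap m m alpha) s).

(** With all coordinates but that of [A] frozen, the [F'] part is constant and the pattern on [A] is
    read off from the cell containing u; the length of that cell is the limiting weight. *)
Lemma resample_section (x : cspace R {set V}) : regular w j.+1 x ->
  uniform_prob (@ltr01 R) [set u | win F (random_str w (upd A (x, u)) m) = s] =
  (if win F' (random_str w x m) == s' then
     limit_weight w p (random_str w (pullx alpha x)) else 0)%:E.
Proof.
move=> [xg x01 xt].
(* The construction uses the sorted labelling [beta], while the weight is expressed through the
   fixed [alpha]; they differ by a permutation [sg], which [limit_weight_perm] removes. *)
have [beta xb bA] := exists_sorted A_card xt.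
have bi := sorted_by_inj xb.
have bP a : exists b, alpha b = beta a.
  have : beta a \in A by rewrite -bA imset_f.
  by move=> /imsetP[b _ ->]; exists b.
have [sg sgP] := choice bP.
have bE : beta = alpha \o sg by apply/funext => a; rewrite /= sgP.
have sgi : injective sg.
  by move=> a b ab; apply: bi; rewrite bE /= ab.
pose pb := win (top j) (pull (hmap m m beta) s).
have pbE : pb = pull (hmap m m sg) p.
  rewrite /pb /p pull_top//; congr win; rewrite pull_comp bE.
  by apply: eq_pull => z; rewrite hmap_comp.
pose y := pullx beta x.
have gy : good w y by apply: xg.
pose yu u := pullx beta (upd A (x, u)).
have yuE u B : B != [set: 'I_j]%SET -> y B = yu u B.
  move=> BT; rewrite /y /yu /pullx /upd -bA (inj_eq (imset_inj bi)).
  by rewrite (negPf BT).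
have yuT u : yu u [set: 'I_j]%SET = u by rewrite /yu /pullx /upd bA eqxx.
have yus u : sorted_by (yu u) id.
  move=> a b ab; have neT (c d : 'I_j) : c != d -> [set c]%SET != [set: 'I_j]%SET.
    move=> cd; apply/eqP => /setP/(_ d); rewrite !inE eq_sym.
    by rewrite (negPf cd).
  have ab' : a != b by rewrite neq_ltn ab.
  rewrite -!yuE ?(neT _ _ ab')//; last by rewrite (neT b a)// eq_sym.
  by rewrite /y /pullx !imset_set1; exact: xb.
have locF u : win F' (random_str w (upd A (x, u)) m) = win F' (random_str w x m).
  have sub (t : tup L (hv m V)) (B : {set V}) : vis t \in F' -> B \subset vis t -> upd A (x, u) B = x B.
    move=> tF Bt; rewrite /upd; case: eqP => // BA.
    by move: (F'_notA tF); rewrite -BA Bt.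
  apply: eq_win => t tF; apply/idP/idP; apply: random_str_local => B Bt.
    exact: sub tF Bt.
  by apply/esym; exact: sub tF Bt.
have key u : 0 <= u < 1 -> win F (random_str w (upd A (x, u)) m) = s <->
    win F' (random_str w x m) = s' /\ in_cell w pb (random_str w y) u.
  move=> u01; have [lowE gyu] := good_local w (yuE u).
  have [cyu _] := gyu gy.
  have natE : pull (hmap m m beta) (random_str w (upd A (x, u)) m) = random_str w (yu u) m.
    exact: random_str_natural.
  have split_s := win_split (random_str w (upd A (x, u)) m) bi bA sF.
  rewrite locF natE in split_s.
  have cellE : in_cell w pb (random_str w y) u = in_cell w pb (random_str w (yu u)) u.
    by apply: eq_in_cell => n; exact: lowE.
  have u01' : 0 <= yu u [set: 'I_j]%SET < 1 by rewrite yuT.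
  have topE := @in_cell_top _ _ _ _ _ cyu (yus u) m pb.
  have cellT := @top_in_cell _ _ _ _ _ cyu u01' (yus u) m pb.
  rewrite yuT in topE cellT.
  split=> [/split_s[h1 h2]|[h1 h2]].
    by split; [exact: h1|rewrite cellE; exact: cellT].
  by apply/split_s; split; [exact: h1|apply: topE; rewrite -cellE; exact: h2].
have mset : measurable ([set u | win F (random_str w (upd A (x, u)) m) = s]
    : set (measurableTypeR R)).
  rewrite -[X in measurable X]setTI.
  have mupd : measurable_fun setT (fun u : measurableTypeR R => upd A (x, u)).
    exact: measurableT_comp (@measurable_upd R _ A) (pair1_measurable x).
  exact: (mupd measurableT _ (@fin_rv_win R L w V F m s)).
have [E|nE] := eqVneq (win F' (random_str w x m)) s'.
  have lwE : limit_weight w p (random_str w (pullx alpha x)) =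
      limit_weight w pb (random_str w y).
    have yE : y = pullx sg (pullx alpha x) by rewrite pullx_comp -bE.
    have gsy : good w (pullx sg (pullx alpha x)) by rewrite -yE; exact: gy.
    have ga := xg j (ltnSn j) alpha alpha_inj.
    rewrite pbE yE.
    exact: (esym (limit_weight_perm sgi p ga gsy)).
  rewrite lwE; apply: etrans (cell_measure gy.1 pb).
  apply: measure_ae_eq; [exact: mset|exact: measurable_cell_set|].
  apply: ae_U => u u01; have k := key u u01.
  split=> [/k[_ c]|c]; first exact: c.
  by apply/k; split; [exact: E|exact: c].
transitivity (uniform_prob (@ltr01 R) set0); last exact: measure0.
apply: measure_ae_eq; [exact: mset|exact: measurable0|].
apply: ae_U => u u01; have k := key u u01.
by split=> [/k[h _]|//]; rewrite h eqxx in nE.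
Qed.

Lemma rv_law_add :
  rv_law (lam R {set V}) (fun x => win F (random_str w x m)) s =
  push (win F) (weight w (hv m V)) s.
Proof.
pose h (x : cspace R {set V}) : R := if win F' (random_str w x m) == s' then
  limit_weight w p (random_str w (pullx alpha x)) else 0.
have mlw := @measurable_limit_weight_pull m p.
have mB : measurable [set x : cspace R {set V} | win F' (random_str w x m) = s'].
  exact: (@fin_rv_win R L w V F' m s').
have hE x : (h x)%:E = ((fun x => (limit_weight w p
    (random_str w (pullx alpha x)))%:E) \_
    [set x : cspace R {set V} | win F' (random_str w x m) = s']) x.
  rewrite patchE /h; case: eqP => xB; first by rewrite mem_set.
  by rewrite memNset.
have mlwB : measurable_fun [set x : cspace R {set V} | win F' (random_str w x m) = s']
    (fun x => (limit_weight w p (random_str w (pullx alpha x)))%:E).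
  by apply/measurable_EFinP; exact: measurable_funTS mlw.
have mh : measurable_fun setT h.
  apply/measurable_EFinP.
  have -> : EFin \o h = (fun x => (limit_weight w p
      (random_str w (pullx alpha x)))%:E) \_
      [set x : cspace R {set V} | win F' (random_str w x m) = s'].
    by apply/funext => x; exact: hE.
  exact/(measurable_restrictT _ mB).
have h0 x : 0 <= h x by rewrite /h; case: eqP => // _; exact: limit_weight_ge0.
apply: EFin_inj.
have <- := rv_lawE (lam R {set V}) s (@fin_rv_win R L w V F m).
have -> : lam R {set V} [set x | win F (random_str w x m) = s] =
    (\int[lam R {set V}]_x (h x)%:E)%E.
  apply: (@lam_upd_ae R _ A) => //; first exact: (@fin_rv_win R L w V F m s).
  exact: (lam_aeS resample_section (ae_regular V gae)).
have -> : (\int[lam R {set V}]_x (h x)%:E =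
    \int[lam R {set V}]_(x in [set x | win F' (random_str w x m) = s'])
      (limit_weight w p (random_str w (pullx alpha x)))%:E)%E.
  by rewrite [RHS]integral_mkcond; apply: eq_integral => x _; exact: hE.
rewrite -target_integral.
congr EFin; rewrite /push; apply: eq_Pr => K.
have W := win_split K alpha_inj erefl sF.
apply/andP/eqP => [[/eqP h1 /eqP h2]|/W[-> ->]]; last by rewrite !eqxx.
exact/W.
Qed.

End resampling.

Lemma has_law_add : has_law w F.
Proof.
move=> m s; have [sF|sF] := eqVneq (win F s) s; first exact: rv_law_add.
have nF (K : {set tup L (hv m V)}) : win F K <> s.
  move=> Ks; move/eqP: sF; apply; rewrite -Ks; apply: eq_win => t tF.
  by rewrite mem_win tF andbT.
transitivity (0 : R).
  rewrite /rv_law (_ : [set x | _] = set0) ?measure0//.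
  by apply/seteqP; split => x // /nF.
by rewrite /push /Pr big_pred0// => K; apply/negbTE/eqP/nF.
Qed.

End add_set.

(** * Induction over all down-closed families *)

Section all_laws.
Context (R : realType) (L : language) (w : law L R).

Lemma has_law_set0 (V : finType) : has_law w (finset.set0 : {set {set V}}).
Proof.
move=> m s; have win0 (K : {set tup L (hv m V)}) : win finset.set0 K = finset.set0.
  by apply/setP => t; rewrite mem_win !inE andbF.
have [->|s0] := eqVneq s finset.set0.
  transitivity (1 : R).
    rewrite /rv_law (_ : [set x | _] = setT) ?probability_setT//.
    by apply/seteqP; split => x //= _; exact: win0.
  rewrite /push /Pr (eq_bigl predT) ?(law_dist w _).2// => K.
  by rewrite win0 eqxx.
transitivity (0 : R).
  rewrite /rv_law (_ : [set x | _] = set0) ?measure0//.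
  by apply/seteqP; split => x //=; rewrite win0 => s0'; rewrite s0' eqxx in s0.
by rewrite /push /Pr big_pred0// => K; rewrite win0 eq_sym (negPf s0).
Qed.

(** The two halves feed each other: the laws for sets smaller than j give goodness on j vertices,
    and goodness lets sets of size j be added one by one. Hence an outer induction on j and an inner
    one on #|F|. *)
Lemma has_law_down (j : nat) :
  (forall i, (i < j)%N -> {ae lam R {set 'I_i}, forall y, good w y}) /\
  forall (V : finType) (F : {set {set V}}),
    (forall B C : {set V}, B \in F -> C \subset B -> C \in F) ->
    (forall B, B \in F -> (#|B| < j)%N) -> has_law w F.
Proof.
elim: j => [|j [IHg IHF]].
  split => // V F _ F0; suff -> : F = finset.set0 by exact: has_law_set0.
  by apply/setP => B; rewrite inE; apply/negbTE/negP => /F0.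
have gae i : (i < j.+1)%N -> {ae lam R {set 'I_i}, forall y, good w y}.
  rewrite ltnS leq_eqVlt => /predU1P[->|]; last exact: IHg.
  apply: ae_good => //; apply: IHF => [B C|B]; rewrite !inE.
    by move=> BT CB; apply: contra BT => /eqP CT; rewrite -finset.subTset -CT.
  move=> BT; rewrite -[X in (_ < X)%N]card_ord -cardsT.
  by apply: proper_card; rewrite finset.properT.
split => // V F; have [k] := ubnP #|F|; elim: k => // k IHk in F *.
rewrite ltnS => Fk Fd Fj.
have [/existsP[A /andP[AF /eqP Aj]]|] := boolP [exists A, (A \in F) && (#|A| == j)].
  have [alpha ai aA] : exists2 alpha : 'I_j -> V, injective alpha &
      (alpha @: [set: 'I_j])%SET = A.
    exists (fun i => enum_val (cast_ord (esym Aj) i)).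
      by move=> a b /enum_val_inj/cast_ord_inj.
    apply/setP => v; apply/imsetP/idP => [[i _ ->]|vA]; first exact: enum_valP.
    exists (cast_ord Aj (enum_rank_in vA v)) => //.
    by rewrite cast_ordK enum_rankK_in.
  subst A; apply: (@has_law_add _ _ w V j F alpha ai Fd _ AF gae).
    by move=> B /Fj.
  apply: IHk.
  - by apply: leq_trans Fk; rewrite [in leqRHS](cardsD1 (alpha @: [set: 'I_j])%SET) AF.
  - move=> B C /setD1P[BA BF] CB; apply/setD1P; split; last exact: Fd BF CB.
    apply: contra BA => /eqP CA; rewrite eq_sym finset.eqEcard -CA CB CA Aj -ltnS.
    exact: Fj.
  - by move=> B /setD1P[_ /Fj].
rewrite negb_exists => /forallP nj; apply: IHF => // B BF.
have := Fj _ BF; rewrite ltnS leq_eqVlt => /predU1P[Bj|//].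
by have := nj B; rewrite BF Bj eqxx.
Qed.

(** The representation of [w] over a cube that still has a coordinate at the empty set. *)
Lemma rv_law_random_str (V : finType) n :
  rv_law (lam R {set V}) (fun x => random_str w x n) =1 weight w (hv n V).
Proof.
move=> s; have winT (K : {set tup L (hv n V)}) : win [set: {set V}]%SET K = K.
  by apply/setP => t; rewrite mem_win inE andbT.
have [_ h] := has_law_down #|V|.+1.
have := h V [set: {set V}]%SET _ _ n s.
rewrite (_ : (fun x => win _ _) = (fun x => random_str w x n)); last first.
  by apply/funext => x; exact: winT.
move=> ->.
- rewrite /push (eq_Pr _ (C := pred1 s)); last by move=> K; rewrite winT.
  by rewrite /Pr big_pred1_eq.
- by move=> B C _ _; rewrite inE.
- by move=> B _; rewrite ltnS max_card.
Qed.

End all_laws.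

(** * Euclidean structures as laws *)

Section euclidean_laws.
Context (R : realType) (L : language).
Context (pe : forall P : L, set (cspace R (rset 'I_(arity P)))).
Hypothesis mpe : forall P, measurable (@pe P).

(** Peons are evaluated along injections, so a tuple with repeated entries is declared false. *)
Definition euc_str (V : finType) (x : cspace R (rset V)) : {set tup L V} :=
  [set t : tup L V | injectiveb (tagged t) &&
    `[< pe (pullback (tagged t : 'I_(arity (tag t)) -> V) x) >]]%SET.

Lemma r_image_inj (U V : finType) (f : U -> V) : injective f -> injective (r_image f).
Proof.
move=> fi A B /(congr1 val) /= /(imset_inj fi) AB; exact: val_inj.
Qed.

Lemma pullback_comp (U V W : finType) (f : U -> V) (g : V -> W) (x : rset W -> R) :
  pullback f (pullback g x) = pullback (g \o f) x.
Proof.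
apply/funext => A; rewrite /pullback; congr x; apply: val_inj => /=.
by rewrite imset_comp.
Qed.

Lemma euc_str_natural (U V : finType) (f : U -> V) x : injective f ->
  pull f (euc_str x) = euc_str (pullback f x).
Proof.
move=> fi; apply/setP => -[P a]; rewrite mem_pull !inE /=; congr (_ && _).
  apply/injectiveP/injectiveP => ai i j.
    by move=> aij; apply: ai; rewrite !ffunE aij.
  by rewrite !ffunE => /fi/ai.
rewrite pullback_comp; congr (`[< pe (pullback _ x) >]).
by apply/funext => i; rewrite ffunE.
Qed.

Lemma measurable_pullback (U V : finType) (f : U -> V) :
  measurable_fun setT (pullback f : cspace R (rset V) -> cspace R (rset U)).
Proof. by apply: measurable_cspace => A; exact: measurable_coord. Qed.

Lemma fin_rv_euc_str (V : finType) : fin_rv (@euc_str V).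
Proof.
apply: fin_rv_set => t; case ti : (injectiveb (tagged t)); last first.
  rewrite (_ : [set x | _] = set0)//.
  by apply/seteqP; split => x //=; rewrite inE ti.
have -> : [set x | t \in euc_str x] =
    pullback (tagged t : 'I_(arity (tag t)) -> V) @^-1` @pe (tag t).
  by apply/seteqP; split => x /=; rewrite inE ti /= => /asboolP.
rewrite -[X in measurable X]setTI.
exact: (@measurable_pullback _ _ (tagged t) measurableT _ (@mpe (tag t))).
Qed.

Lemma euc_law_pull (U V : finType) (f : U -> V) : injective f ->
  push (pull f) (rv_law (lam R (rset V)) (@euc_str V)) =1
  rv_law (lam R (rset U)) (@euc_str U).
Proof.
move=> fi K; rewrite -rv_law_comp; last exact: fin_rv_euc_str.
rewrite /rv_law; congr fine.
rewrite -(lam_reindex (r_image_inj fi) (@fin_rv_euc_str U K)); congr (lam _ _ _).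
by apply/seteqP; split => x /=; rewrite euc_str_natural.
Qed.

(** A non-empty subset of one summand is never a subset of the other, so the two restrictions read
    disjoint sets of coordinates. A coordinate at the empty set would be shared. *)
Lemma euc_law_dissociated (U V : finType) (K : {set tup L U}) (K' : {set tup L V}) :
  Pr (rv_law (lam R (rset (U + V)%type)) (@euc_str (U + V)%type))
    (fun M => (pull inl M == K) && (pull inr M == K')) =
  rv_law (lam R (rset U)) (@euc_str U) K * rv_law (lam R (rset V)) (@euc_str V) K'.
Proof.
have il : injective (@inl U V) by move=> a b [].
have ir : injective (@inr U V) by move=> a b [].
pose A := [set x : cspace R (rset (U + V)%type) | euc_str (pullback inl x) = K].
pose B := [set x : cspace R (rset (U + V)%type) | euc_str (pullback inr x) = K'].
have mA : measurable A.
  rewrite -[X in measurable X]setTI.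
  exact: (@measurable_pullback U (U + V)%type inl measurableT _ (@fin_rv_euc_str U K)).
have mB : measurable B.
  rewrite -[X in measurable X]setTI.
  exact: (@measurable_pullback V (U + V)%type inr measurableT _ (@fin_rv_euc_str V K')).
apply: EFin_inj; rewrite -P_rv; last exact: fin_rv_euc_str.
rewrite EFinM.
have <- := rv_lawE (lam R (rset U)) K (@fin_rv_euc_str U).
have <- := rv_lawE (lam R (rset V)) K' (@fin_rv_euc_str V).
have <- := lam_reindex (r_image_inj il) (@fin_rv_euc_str U K).
have <- := lam_reindex (r_image_inj ir) (@fin_rv_euc_str V K').
have := @lam_indep R _ (fun C : rset (U + V)%type =>
  val C \subset (inl @: [set: U])%SET) A B mA mB.
have -> : [set x : cspace R (rset (U + V)%type) | (pull inl (euc_str x) == K) &&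
   (pull inr (euc_str x) == K')] = A `&` B.
  apply/seteqP; split => x; rewrite /A /B /= !euc_str_natural//.
    by move=> /andP[/eqP -> /eqP ->].
  by move=> [-> ->]; rewrite !eqxx.
apply.
- move=> x y xy; rewrite /A /=; suff -> : pullback inl x = pullback inl y by [].
  apply/funext => C; rewrite /pullback xy//=; exact/imsetS/finset.subsetT.
- move=> x y xy; rewrite /B /=; suff -> : pullback inr x = pullback inr y by [].
  apply/funext => C; rewrite /pullback xy//=; apply/negP => /fintype.subsetP sub.
  have /set0Pn[v vC] := valP C.
  by have := sub _ (imset_f inr vC) => /imsetP[].
Qed.

Definition euc_law : law L R := Law
  (fun V => is_dist_rv (lam R (rset V)) (@fin_rv_euc_str V))
  euc_law_pull euc_law_dissociated.

End euclidean_laws.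

(** * Separating and fixing the coordinate of the empty set *)

Section extension.
Context (R : realType) (V : finType).
Local Notation U := (uniform_prob (@ltr01 R)).

(* [random_str] reads a coordinate at every subset, a Euclidean structure only
   at the non-empty ones. *)
Definition ext (cx : measurableTypeR R * cspace R (rset V)) : cspace R {set V} :=
  fun B => if insub B is Some A then cx.2 A else cx.1.

Lemma ext0 c x : ext (c, x) finset.set0 = c.
Proof. by rewrite /ext insubF// eqxx. Qed.

Lemma ext_rset c x (A : rset V) : ext (c, x) (val A) = x A.
Proof. by rewrite /ext valK. Qed.

Lemma measurable_ext : measurable_fun setT ext.
Proof.
apply: measurable_cspace => B; rewrite /ext; case: insubP => [A _ _|_].
  exact: measurableT_comp (measurable_coord A) measurable_snd.
exact: measurable_fst.
Qed.

Lemma ext_box (B : {set V} -> set (measurableTypeR R)) :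
  ext @^-1` box B = B finset.set0 `*` box (fun A : rset V => B (val A)).
Proof.
apply/seteqP; split => -[c x] /=.
  move=> h; split => [|A]; first by have := h finset.set0; rewrite ext0.
  by have := h (val A); rewrite ext_rset.
move=> [h0 h] C; have [->|C0] := eqVneq C finset.set0; first by rewrite ext0.
by rewrite -[C]/(val (exist _ C C0 : rset V)) ext_rset; exact: h.
Qed.

Lemma lam_ext (A : set (cspace R {set V})) : measurable A ->
  lam R {set V} A = (\int[U]_c lam R (rset V) [set x | A (ext (c, x))])%E.
Proof.
move=> mA; transitivity ((U \x lam R (rset V))%E (ext @^-1` A)); last first.
  rewrite /product_measure1; apply: eq_integral => c _ /=; congr (lam _ _ _).
  by apply/seteqP; split => x; rewrite /xsection /= inE.
apply/esym; move: A mA; pose P : probability _ R := (U \x lam R (rset V))%E.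
apply: (@lam_pushforward R _ _ P {set V} _ measurable_ext) => B mB.
rewrite ext_box /P.
apply: etrans (product_prob_rect _ _ (esym (fineU (mB _))) (lam_box _)) _ => //.
  exact: measurable_box.
congr EFin; rewrite [RHS](bigD1 finset.set0)//=; congr (_ * _).
rewrite [RHS](reindex_omap (val : rset V -> {set V}) insub); last first.
  by move=> C C0; rewrite insubT.
by apply: eq_bigl => A; rewrite (valP A) valK eqxx.
Qed.

End extension.

Lemma ext_pullback (R : realType) (U V : finType) (f : U -> V) c (x : cspace R (rset V)) :
  ext (c, pullback f x : cspace R (rset U)) = pullx f (ext (c, x)).
Proof.
apply/funext => B; rewrite /pullx; have [->|B0] := eqVneq B finset.set0.
  by rewrite imset0 !ext0.
have -> : B = val (exist _ B B0 : rset U) by [].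
rewrite ext_rset /pullback.
by rewrite -[(f @: _)%SET]/(val (r_image f (exist _ B B0))) ext_rset.
Qed.

Section fixing_the_empty_coordinate.
Context (R : realType) (L : language) (w : law L R).
Local Notation U := (uniform_prob (@ltr01 R)).

Definition canonical_part (V : finType) (K : {set tup L V}) : {set tup L V} :=
  [set t in K | injectiveb (tagged t)]%SET.

Hypothesis w_canonical : forall (V : finType) (K : {set tup L V}),
  weight w V K != 0 -> canonical_part K = K.

Definition id_tuple (P : L) : tup L 'I_(arity P) :=
  existT (fun Q : L => {ffun 'I_(arity Q) -> 'I_(arity P)}) P [ffun i => i].

(** The identity tuple sits on visible vertices only, so level 0 suffices. *)
Definition fixed_peon (c : R) (P : L) : set (cspace R (rset 'I_(arity P))) :=
  [set x | tmap inr (id_tuple P) \in random_str w (ext (c, x)) 0].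

Lemma measurable_ext_fst (V : finType) (c : R) :
  measurable_fun setT (fun x : cspace R (rset V) => ext (c, x)).
Proof. exact: measurableT_comp (@measurable_ext R V) (pair1_measurable (c : measurableTypeR R)). Qed.

Lemma measurable_fixed_peon c P : measurable (@fixed_peon c P).
Proof.
rewrite -[X in measurable X]setTI.
exact: (measurable_ext_fst c measurableT (measurable_random_str w (tmap inr (id_tuple P)))).
Qed.

Definition fixed_law (c : R) : law L R := euc_law (measurable_fixed_peon c).

Lemma fixed_str (V : finType) (c : R) (x : cspace R (rset V)) :
  euc_str (@fixed_peon c) x =
  canonical_part (pull inr (random_str w (ext (c, x)) 0)).
Proof.
apply/setP => -[P a]; rewrite [LHS]inE [RHS]inE mem_pull andbC /=.
case ai : (injectiveb a); rewrite ?andbF// !andbT.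
have ai' : injective (a : 'I_(arity P) -> V) by exact/injectiveP.
rewrite /fixed_peon /= ext_pullback -random_str_natural//.
rewrite mem_pull tmap_comp asboolb.
have -> : tmap (hmap 0 0 (a : 'I_(arity P) -> V) \o inr) (id_tuple P) =
    tmap (inr : V -> hv 0 V) (existT _ P a : tup L V).
  by congr existT; apply/ffunP => i; rewrite !ffunE.
by [].
Qed.

(** Averaging over the coordinate of the empty set restores the full cube, where the law is [w];
    passing to canonical parts loses nothing by [w_canonical]. *)
Lemma fixed_mean (V : finType) (B : pred {set tup L V}) :
  (\int[U]_c (Pr (weight (fixed_law c) V) B)%:E = (Pr (weight w V) B)%:E)%E.
Proof.
pose g (s : {set tup L (hv 0 V)}) := canonical_part (pull inr s).
transitivity (lam R {set V} [set y | B (g (random_str w y 0))]).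
  rewrite lam_ext; last first.
    exact: (measurable_fin_rv [set s | B (g s)] (@fin_rv_random_str R L w V 0)).
  apply: eq_integral => c _.
  have <- := P_rv (lam R (rset V)) B (fin_rv_euc_str (measurable_fixed_peon c) (V := V)).
  congr (lam _ _ _); apply/seteqP; split => x /=; rewrite fixed_str; exact: id.
have -> := P_rv (lam R {set V}) (B \o g) (@fin_rv_random_str R L w V 0).
congr EFin; transitivity (Pr (weight w (hv 0 V)) (B \o g)).
  by apply: eq_bigr => s _; rewrite rv_law_random_str.
transitivity (Pr (weight w V) (B \o @canonical_part V)).
  transitivity (Pr (push (@pull L V (hv 0 V) inr) (weight w (hv 0 V)))
    (B \o @canonical_part V)); first by rewrite Pr_push.
  apply: eq_bigr => K _.
  by apply: law_pull => a b [].
rewrite /Pr big_mkcond [RHS]big_mkcond; apply: eq_bigr => K _ /=.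
have [->|K0] := eqVneq (weight w V K) 0; first by case: ifP; case: ifP.
by rewrite w_canonical.
Qed.

Lemma Pr_pred1 (S : finType) (P : S -> R) s : Pr P (pred1 s) = P s.
Proof. by rewrite /Pr big_pred1_eq. Qed.

(** Both laws are dissociated, so the square of a weight is the probability of an event on two
    disjoint copies of [V], to which [fixed_mean] applies. As a function of c the weight thus has
    variance zero. *)
Lemma fixed_mean_square (V : finType) (K : {set tup L V}) :
  (\int[U]_c (weight (fixed_law c) V K ^+ 2)%:E = (weight w V K ^+ 2)%:E)%E.
Proof.
under eq_integral do rewrite expr2 -law_dissociated.
by rewrite fixed_mean law_dissociated.
Qed.

Lemma measurable_fixed_weight (V : finType) (K : {set tup L V}) :
  measurable_fun setT (fun c : measurableTypeR R => weight (fixed_law c) V K).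
Proof.
pose g (s : {set tup L (hv 0 V)}) := canonical_part (pull inr s).
pose A := [set y : cspace R {set V} | g (random_str w y 0) = K].
have mA : measurable A.
  exact: (measurable_fin_rv [set s | g s = K] (@fin_rv_random_str R L w V 0)).
have mext : measurable (@ext R V @^-1` A).
  by rewrite -[X in measurable X]setTI; exact: measurable_ext.
have F c : lam R (rset V) (xsection (@ext R V @^-1` A) c) =
    (weight (fixed_law c) V K)%:E.
  have E : (fun x => euc_str (@fixed_peon c) x) =
      (fun x : cspace R (rset V) => g (random_str w (ext (c, x)) 0)).
    by apply/funext => x; exact: fixed_str.
  have -> : xsection (@ext R V @^-1` A) c =
      [set x | g (random_str w (ext (c, x)) 0) = K].
    by apply/seteqP; split => x; rewrite /xsection /= inE.
  have <- := rv_lawE (lam R (rset V)) K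
    (fin_rv_euc_str (measurable_fixed_peon c) (V := V)).
  exact: (esym (congr1 (fun f : cspace R (rset V) -> {set tup L V} =>
    lam R (rset V) [set x | f x = K]) E)).
have := measurable_fun_xsection (lam R (rset V)) mext.
move=> h; apply/measurable_EFinP; move: h; congr measurable_fun.
by apply/funext => c; exact: F.
Qed.

Lemma fixed_weight_ae (V : finType) (K : {set tup L V}) :
  {ae U, forall c, weight (fixed_law c) V K - weight w V K = 0}.
Proof.
set a := weight w V K; have a0 : 0 <= a by exact: (law_dist w V).1.
apply: ae_eq0_integral_square.
  by apply: measurable_funB; [exact: measurable_fixed_weight|exact: measurable_cst].
pose f (c : measurableTypeR R) := weight (fixed_law c) V K.
have f0 c : 0 <= f c by exact: (law_dist (fixed_law c) V).1.
have mf : measurable_fun setT f by exact: measurable_fixed_weight.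
have mf2 : measurable_fun setT (fun c => (f c - a) ^+ 2).
  by apply: measurable_funX; apply: measurable_funB.
have h1 : (\int[U]_c (f c)%:E = a%:E)%E.
  by have := fixed_mean (pred1 K); under eq_integral do rewrite Pr_pred1; rewrite Pr_pred1.
have h2 := fixed_mean_square K; rewrite -/a in h2.
(* The square is expanded with the negative term moved across, so that every integrand is
   nonnegative. *)
have : (\int[U]_c (((f c - a) ^+ 2)%:E + ((2 * a) * f c)%:E) =
    \int[U]_c ((f c ^+ 2)%:E + (a ^+ 2)%:E))%E.
  by apply: eq_integral => c _; rewrite -!EFinD; congr EFin; lra.
rewrite ge0_integralD//; first last.
- exact/measurable_EFinP/measurable_funM.
- by move=> c _; rewrite lee_fin !mulr_ge0.
- exact/measurable_EFinP.
- by move=> c _; rewrite lee_fin sqr_ge0.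
rewrite ge0_integralD//; first last.
- by move=> c _; rewrite lee_fin sqr_ge0.
- exact/measurable_EFinP/measurable_funX.
- by move=> c _; rewrite lee_fin sqr_ge0.
have hc : (\int[U]_c (a ^+ 2)%:E = (a ^+ 2)%:E)%E.
  rewrite integral_cst//; transitivity ((a ^+ 2)%:E * 1)%E; last by rewrite mule1.
  by congr (_ * _)%E; exact: (probability_setT U).
rewrite h2 hc.
under [X in (_ + X)%E]eq_integral do rewrite EFinM.
rewrite ge0_integralZl_EFin//; first last.
- by rewrite mulr_ge0.
- exact/measurable_EFinP.
- by move=> c _; rewrite lee_fin.
rewrite h1 -EFinM -EFinD.
set X := (\int[U]_c _)%E; case: X => [r| |] //= [rE].
by congr EFin; lra.
Qed.

(** The sets ['I_m] and the structures on them are countably many, so one c avoids all the null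
    sets; other vertex sets are transported along [enum_val]. *)
Lemma exists_fixed_law : exists c, forall (V : finType) (K : {set tup L V}),
  weight (fixed_law c) V K = weight w V K.
Proof.
have h : {ae U, forall c, forall m (K : {set tup L 'I_m}),
    weight (fixed_law c) 'I_m K - weight w 'I_m K = 0}.
  by apply: ae_foralln => m; apply: filter_forall => K; exact: fixed_weight_ae.
have [c hc] : exists c, forall m (K : {set tup L 'I_m}),
    weight (fixed_law c) 'I_m K - weight w 'I_m K = 0.
  apply: contrapT => nex; have [N [mN N0 hN]] := h.
  have NT : N = setT.
    by apply/seteqP; split => // c _; apply: hN => /= hc; apply: nex; exists c.
  have U1 : U setT = 1%E by exact: probability_setT.
  have U0 : U setT = 0%E by rewrite -NT; exact: N0.
  by have := etrans (esym U1) U0 => /eqP; rewrite onee_eq0.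
exists c => V K; have fi : injective (@enum_val V predT) by exact: enum_val_inj.
have pull1 (v : law L R) : weight v V K = weight v 'I_#|V| (pull enum_val K).
  rewrite -(law_pull v fi) /push; rewrite -[LHS]Pr_pred1; apply: eq_Pr => K' /=.
  apply/eqP/eqP => [->//|/(congr1 (pull enum_rank))].
  rewrite !pull_comp; have e : enum_val \o enum_rank =1 @id V by exact: enum_rankK.
  by rewrite !(eq_pull e) !pull_id.
by apply/eqP; rewrite !pull1 -subr_eq0 hc.
Qed.

End fixing_the_empty_coordinate.

(** * Borel versions of Lebesgue measurable sets *)

Section borel_versions.
Context (R : realType) (I : finType).

Definition cube_tuple (x : cspace R I) : #|I|.-tuple (measurableTypeR R) :=
  [tuple x (enum_val i) | i < #|I|].

Lemma cube_tupleK : cancel cube_tuple (@tuple_fun R I).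
Proof.
by move=> x; apply/funext => i; rewrite /tuple_fun tnth_mktuple enum_rankK.
Qed.

Lemma tuple_funK : cancel (@tuple_fun R I) cube_tuple.
Proof.
by move=> t; apply: eq_from_tnth => i; rewrite tnth_mktuple /tuple_fun enum_valK.
Qed.

Lemma measurable_cube_tuple : measurable_fun setT cube_tuple.
Proof.
apply/measurable_fun_tnthP => i; rewrite /comp.
under eq_fun do rewrite tnth_mktuple.
exact: measurable_coord.
Qed.

Definition borel_version (A : set (I -> R)) (B N : set (cspace R I)) : Prop :=
  [/\ measurable B, measurable N, lam R I N = 0%E &
      forall x, ~ N x -> A x <-> B x].

Lemma exists_borel_version (A : set (I -> R)) : lebesgue_measurable A ->
  exists B N, borel_version A B N.
Proof.
move=> [A0 mA0 [N0 [M [mM M0 NM]]] AN].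
have mpre X : measurable X -> measurable (cube_tuple @^-1` X).
  by move=> mX; rewrite -[Y in measurable Y]setTI; exact: measurable_cube_tuple.
exists (cube_tuple @^-1` A0), (cube_tuple @^-1` M); split.
- exact: mpre.
- exact: mpre.
- rewrite -M0; congr (cube_prob _ _ _).
  by apply/seteqP; split => t /=; rewrite tuple_funK.
- move=> x /= nM; have : (tuple_fun (I := I) @^-1` A) (cube_tuple x) <-> A x.
    by rewrite /= cube_tupleK.
  rewrite -AN => <-; split=> [[//|/NM//]|]; by left.
Qed.

(** Up to the null set [N] each of [A] and [B] contains the other; monotonicity and subadditivity of
    the outer measure conclude. *)
Lemma lebesgue_cube_borel (A : set (I -> R)) (B N : set (cspace R I)) :
  borel_version A B N -> lebesgue_cube A = fine (lam R I B).
Proof.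
move=> [mB mN N0 AB]; rewrite /lebesgue_cube.
set mu := cube_prob R #|I|.
have mpre (X : set (cspace R I)) : measurable X ->
    measurable (@tuple_fun R I @^-1` X).
  by move=> mX; rewrite -[Y in measurable Y]setTI; exact: measurable_tuple_fun.
have muE (X : set (cspace R I)) : measurable X ->
    mu_ext mu (@tuple_fun R I @^-1` X) = lam R I X.
  by move=> mX; rewrite measurable_mu_extE//; exact: mpre.
congr fine; apply/eqP; rewrite eq_le; apply/andP; split.
  have -> : lam R I B = lam R I (B `|` N) by rewrite measureU0.
  rewrite -muE; last exact: measurableU.
  apply: le_mu_ext => t /= At; have [|nN] := pselect (N (tuple_fun t)).
    by right.
  by left; apply/AB.
rewrite -muE//; apply: (@le_trans _ _ (mu_ext mu
    (@tuple_fun R I @^-1` A `|` @tuple_fun R I @^-1` N))).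
  apply: le_mu_ext => t /= Bt; have [|nN] := pselect (N (tuple_fun t)).
    by right.
  by left; apply/AB.
apply: (le_trans (outer_measureU2 (mu^*)%mu _ _)).
by rewrite [X in (_ + X)%E]muE// N0 adde0.
Qed.

End borel_versions.

(** * Euclidean densities as probabilities under a law *)

Section euclidean_densities_as_laws.
Context (R : realType) (L : language) (E : euclidean_structure R L).

Lemma exists_borel_peons : exists pe : forall P : L, set (cspace R (rset 'I_(arity P))),
  forall P, exists N, borel_version (peon E P) (@pe P) N.
Proof.
have h P : exists BN : set (cspace R (rset 'I_(arity P))) * set (cspace R (rset 'I_(arity P))),
    borel_version (peon E P) BN.1 BN.2.
  have [B [N BN]] := exists_borel_version (@peon_measurable _ _ E P).
  by exists (B, N).
exists (fun P => (projT1 (cid (h P))).1) => P.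
by exists (projT1 (cid (h P))).2; case: cid.
Qed.

(** Only injective tuples are recorded, since embeddings and the sets [Rel] and [coRel] speak only
    of these; for canonical structures nothing is lost. *)
Definition enc (M : finstructure L) : {set tup L M} :=
  [set t : tup L M | injectiveb (tagged t) && `[< rel_of M (tag t) (tagged t) >]]%SET.

Context (pe : forall P : L, set (cspace R (rset 'I_(arity P))))
  (mpe : forall P, measurable (@pe P)) (Npe : forall P : L, set (cspace R (rset 'I_(arity P))))
  (peE : forall P, borel_version (peon E P) (@pe P) (@Npe P)).

Lemma euclid_unit (V : finType) (U : finType) (alpha : U -> V) (x : cspace R (rset V)) :
  (forall i, 0 <= x i < 1) -> euclid R U (pullback alpha x).
Proof.
move=> x01 A; rewrite in_itv /= /pullback.
by have /andP[-> /ltW ->] := x01 (r_image alpha A).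
Qed.

(** A null set pulled back along an injection stays null, and there are finitely many injections. *)
Lemma exists_exceptional_set (V : finType) : exists N : set (cspace R (rset V)),
  [/\ measurable N, lam R (rset V) N = 0%E & forall x, ~ N x ->
    (forall i, 0 <= x i < 1) /\
    forall P (alpha : {ffun 'I_(arity P) -> V}), injective alpha ->
      peon E P (pullback alpha x) <-> pe (pullback alpha x)].
Proof.
have h1 : {ae lam R (rset V), forall x, forall i, 0 <= x i < 1}.
  by apply: filter_forall => i; exact: lam_coord_itv.
have h2 : {ae lam R (rset V), forall x, forall P (alpha : {ffun 'I_(arity P) -> V}),
    injective alpha -> peon E P (pullback alpha x) <-> pe (pullback alpha x)}.
  apply: filter_forall => P; apply: filter_forall => alpha.
  have [ai|nai] := pselect (injective alpha); last by apply: aeW => x /nai.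
  have [_ mN N0 EN] := peE P.
  have hP : {ae lam R (rset 'I_(arity P)), forall y, peon E P y <-> pe y}.
    exists (@Npe P); split => // y /= nE; apply: contrapT => nN; exact/nE/EN.
  move: (lam_reindex_ae (r_image_inj ai) hP); apply: lam_aeS => x hx _; exact: hx.
have [N1 [mN1 N10 s1]] := h1; have [N2 [mN2 N20 s2]] := h2.
exists (N1 `|` N2); split; first exact: measurableU.
  by rewrite null_set_setU.
move=> x nN; split; first by apply: contrapT => n1; apply: nN; left; exact: s1.
by apply: contrapT => n2; apply: nN; right; exact: s2.
Qed.

Lemma Tind_euc_str (M : finstructure L) (x : cspace R (rset M)) :
  (forall i, 0 <= x i < 1) ->
  (forall P (alpha : {ffun 'I_(arity P) -> M}), injective alpha ->
      peon E P (pullback alpha x) <-> pe (pullback alpha x)) ->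
  Tind M E x <-> euc_str pe x = enc M.
Proof.
move=> x01 xE; have ffE P (alpha : 'I_(arity P) -> M) : finfun alpha = alpha :> (_ -> _).
  by apply/funext => i; rewrite ffunE.
split.
  move=> [[_ h1] h2]; apply/setP => -[P a]; rewrite !inE /=.
  case ai : (injectiveb a) => //=; move/injectiveP : ai => ai.
  apply: asbool_equiv_eq; rewrite -xE//; split=> [pa|ra]; last exact: h1.
  apply: contrapT => nra; have := h2 P I a; case; first by split.
  by move=> _; apply.
move=> sE; have key P (alpha : 'I_(arity P) -> M) : injective alpha ->
    peon E P (pullback alpha x) <-> rel_of M P alpha.
  move=> ai; have ai' : injective (finfun alpha) by rewrite ffE.
  have := xE P (finfun alpha) ai'; rewrite ffE => ->.
  move/setP/(_ (Tagged (fun P : L => {ffun 'I_(arity P) -> M}) (finfun alpha))) : sE.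
  rewrite !inE /= (_ : injectiveb (finfun alpha)); last exact/injectiveP.
  rewrite /= ffE => h; split=> /asboolP; first by rewrite h => /asboolP.
  by rewrite -h => /asboolP.
split; last first.
  move=> P _ alpha [ai nr]; split; first exact: euclid_unit.
  by move=> /(key P alpha ai).
split; last by move=> P _ alpha [ai r]; exact/(key P alpha ai).
by move=> A; rewrite in_itv /=; have /andP[-> /ltW ->] := x01 A.
Qed.

Lemma Tinj_euc_str (M : finstructure L) (x : cspace R (rset M)) :
  (forall i, 0 <= x i < 1) ->
  (forall P (alpha : {ffun 'I_(arity P) -> M}), injective alpha ->
      peon E P (pullback alpha x) <-> pe (pullback alpha x)) ->
  Tinj M E x <-> enc M \subset euc_str pe x.
Proof.
move=> x01 xE; have ffE P (alpha : 'I_(arity P) -> M) : finfun alpha = alpha :> (_ -> _).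
  by apply/funext => i; rewrite ffunE.
split.
  move=> [_ h1]; apply/fintype.subsetP => -[P a]; rewrite !inE /=.
  move=> /andP[ai /asboolP ra]; rewrite ai /=; apply/asboolP.
  have ai' : injective a by exact/injectiveP.
  by apply/xE => //; apply: h1.
move=> /fintype.subsetP sE; split.
  by move=> A; rewrite in_itv /=; have /andP[-> /ltW ->] := x01 A.
move=> P _ alpha [ai r]; have ai' : injective (finfun alpha) by rewrite ffE.
have := xE P (finfun alpha) ai'; rewrite ffE => xEa.
have := sE (Tagged (fun P : L => {ffun 'I_(arity P) -> M}) (finfun alpha)).
rewrite !inE /= (_ : injectiveb (finfun alpha)); last exact/injectiveP.
by rewrite /= ffE => /(_ (asboolT r)) /asboolP /xEa.
Qed.

Lemma tind_euc_law (M : finstructure L) :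
  tind_euc M E = weight (euc_law mpe) M (enc M).
Proof.
have [N [mN N0 hN]] := exists_exceptional_set M.
apply: (@lebesgue_cube_borel _ _ _ [set x | euc_str pe x = enc M] N); split => //.
  exact: fin_rv_euc_str.
by move=> x /hN[x01 xE]; exact: Tind_euc_str.
Qed.

Lemma tinj_euc_law (M : finstructure L) :
  tinj_euc M E = Pr (weight (euc_law mpe) M) (fun K => enc M \subset K).
Proof.
have [N [mN N0 hN]] := exists_exceptional_set M.
have mE : measurable [set x : cspace R (rset M) | enc M \subset euc_str pe x].
  exact: (measurable_fin_rv [set K : {set tup L M} | enc M \subset K]
    (fin_rv_euc_str mpe (V := M))).
rewrite /tinj_euc (@lebesgue_cube_borel _ _ _
  [set x : cspace R (rset M) | enc M \subset euc_str pe x] N).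
  by rewrite (P_rv _ (fun K : {set tup L M} => enc M \subset K)
    (fin_rv_euc_str mpe (V := M))).
by split => // x /hN[x01 xE]; exact: Tinj_euc_str.
Qed.

End euclidean_densities_as_laws.

(** * Sampling from finite structures *)

Section counting_injections.
Implicit Types (U V N : finType).

Definition injs V N : {set {ffun V -> N}} := [set f : {ffun V -> N} | injectiveb f]%SET.

Lemma mem_injs V N (f : {ffun V -> N}) : reflect (injective f) (f \in injs V N).
Proof. by rewrite inE; exact: injectiveP. Qed.

Lemma card_injs V N : #|injs V N| = (#|N| ^_ #|V|)%N.
Proof. by rewrite -card_inj_ffuns; apply: eq_card => f; rewrite !inE. Qed.

Lemma extend_to_perm V N (f g : {ffun V -> N}) : f \in injs V N -> g \in injs V N ->
  exists s : {perm N}, forall v, s (f v) = g v.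
Proof.
move=> /mem_injs fi /mem_injs gi.
(* The complements of the two images have the same size; [h] sends [f v] to [g v] and matches the
   complements through their enumerations. *)
pose cf := enum (~: (f @: [set: V]))%SET; pose cg := enum (~: (g @: [set: V]))%SET.
have szc : size cf = size cg.
  by rewrite -!cardE [LHS]cardsCs [RHS]cardsCs !finset.setCK !card_imset.
pose h n := if [pick v | f v == n] is Some v then g v else nth n cg (index n cf).
have hf v : h (f v) = g v.
  by rewrite /h; case: pickP => [u /eqP/fi ->//|/(_ v)]; rewrite eqxx.
have hc n : (forall v, f v != n) -> (index n cf < size cg)%N /\ h n = nth n cg (index n cf).
  move=> nf; split; last first.
    by rewrite /h; case: pickP => // v fv; have := nf v; rewrite fv.
  rewrite -szc index_mem mem_enum inE; apply/imsetP => -[v _ E].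
  by have := nf v; rewrite E eqxx.
have h_cg n : (forall v, f v != n) -> h n \in cg.
  by move=> /hc[lt ->]; rewrite mem_nth.
have cgP v : g v \notin cg by rewrite mem_enum inE negbK imset_f.
have dec n : (exists v, f v = n) \/ (forall v, f v != n).
  have [/existsP[v /eqP fv]|/existsPn nf] := boolP [exists v, f v == n].
    by left; exists v.
  by right.
have hi : injective h.
  move=> m n; have [[u <-]|um] := dec m; have [[v <-]|vn] := dec n.
  - by rewrite !hf => /gi ->.
  - by rewrite hf => E; have := cgP u; rewrite E h_cg.
  - by rewrite hf => E; have := cgP v; rewrite -E h_cg.
  - have [lm ->] := hc _ um; have [ln ->] := hc _ vn.
    rewrite (set_nth_default n m lm) => /eqP; rewrite nth_uniq ?enum_uniq// => /eqP.
    have inc k : (forall v, f v != k) -> k \in cf.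
      move=> kf; rewrite mem_enum inE; apply/imsetP => -[v _ E].
      by have := kf v; rewrite E eqxx.
    by move=> E; rewrite -(nth_index m (inc _ um)) E nth_index// inc.
by exists (perm hi) => v; rewrite permE hf.
Qed.

Definition fcomp U V N (g : {ffun V -> N}) (f : U -> V) : {ffun U -> N} :=
  [ffun u => g (f u)].

Lemma fcomp_injs U V N (g : {ffun V -> N}) (f : U -> V) : injective f ->
  g \in injs V N -> fcomp g f \in injs U N.
Proof.
by move=> fi /mem_injs gi; apply/mem_injs => u u'; rewrite !ffunE => /gi/fi.
Qed.

(** Permutations of [N] act transitively on the injections from [U], so each of these has the same
    number of extensions along [f]. The cross-multiplied form also covers the case without
    injections. *)
Lemma card_restrict_injs U V N (f : U -> V) (Q : pred {ffun U -> N}) :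
  injective f ->
  (#|[set g in injs V N | Q (fcomp g f)]%SET| * #|injs U N| =
   #|[set h in injs U N | Q h]%SET| * #|injs V N|)%N.
Proof.
move=> fi; pose c h := #|[set g in injs V N | fcomp g f == h]%SET|.
have cE h h' : h \in injs U N -> h' \in injs U N -> (c h <= c h')%N.
  move=> hi hi'; have [s sh] := extend_to_perm hi hi'.
  pose S (g : {ffun V -> N}) := [ffun v => s (g v)].
  have S_inj : injective S.
    by move=> g g' /ffunP E; apply/ffunP => v; have := E v; rewrite !ffunE => /perm_inj.
  rewrite /c -(card_imset _ S_inj); apply: subset_leq_card.
  apply/fintype.subsetP => _ /imsetP[g + ->]; rewrite !inE => /andP[/injectiveP gi /eqP gh].
  apply/andP; split; first by apply/injectiveP => v v'; rewrite !ffunE => /perm_inj/gi.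
  by apply/eqP/ffunP => u; rewrite !ffunE -sh -gh ffunE.
have {}cE h h' : h \in injs U N -> h' \in injs U N -> c h = c h'.
  by move=> hi hi'; apply/eqP; rewrite eqn_leq !cE.
have count (Q' : pred {ffun U -> N}) :
    #|[set g in injs V N | Q' (fcomp g f)]%SET| = (\sum_(h in injs U N | Q' h) c h)%N.
  rewrite -sum1_card (partition_big (fun g => fcomp g f)
    (fun h => (h \in injs U N) && Q' h))/=; last first.
    by move=> g; rewrite inE => /andP[gi ->]; rewrite fcomp_injs.
  apply: eq_bigr => h /andP[hi Qh]; rewrite /c -sum1_card; apply: eq_bigl => g.
  by rewrite !inE; case: eqP => [->|]; rewrite ?Qh ?andbT ?andbF.
have [U0|[h0 h0i]] := set_0Vmem (injs U N).
  rewrite U0 cards0 muln0 [X in (X * _)%N](_ : _ = 0%N)//.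
  by apply/eqP; rewrite cards_eq0; apply/eqP/setP => h; rewrite !inE.
have countc (Q' : pred {ffun U -> N}) :
    #|[set g in injs V N | Q' (fcomp g f)]%SET| = (#|[set h in injs U N | Q' h]%SET| * c h0)%N.
  rewrite count (eq_bigr (fun=> c h0)); last by move=> h /andP[hi _]; exact: cE.
  by rewrite sum_nat_cond_const.
have := countc predT; rewrite (countc Q).
have -> : [set g in injs V N | predT (fcomp g f)]%SET = injs V N.
  by apply/setP => g; rewrite inE andbT.
have -> : [set h in injs U N | predT h]%SET = injs U N.
  by apply/setP => g; rewrite inE andbT.
by move=> ->; rewrite -mulnA (mulnC (c h0)).
Qed.

End counting_injections.

Section sampling.
Context (R : realType) (L : language) (N : finstructure L).

(** If [N] has fewer vertices than [V] there is no injection and the quotient is 0, in agreement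
    with the convention for densities. *)
Definition samp (V : finType) (K : {set tup L V}) : R :=
  #|[set f in injs V N | pull f (enc N) == K]%SET|%:R / #|injs V N|%:R.

Lemma card_injs_gt0 (V : finType) : (#|V| <= #|N|)%N -> (0 < #|injs V N|)%N.
Proof. by move=> VN; rewrite card_injs ffact_gt0. Qed.

Lemma Pr_samp (V : finType) (B : pred {set tup L V}) :
  Pr (@samp V) B = #|[set f in injs V N | B (pull f (enc N))]%SET|%:R / #|injs V N|%:R.
Proof.
rewrite /Pr /samp -mulr_suml; congr (_ / _); rewrite -natr_sum; congr _%:R.
rewrite -sum1_card [RHS](partition_big (fun f : {ffun V -> N} => pull f (enc N)) B)/=; last first.
  by move=> f; rewrite inE => /andP[].
apply: eq_bigr => K BK; rewrite -sum1_card; apply: eq_bigl => f.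
by rewrite !inE; case: eqP => [->|]; rewrite ?BK ?andbT ?andbF.
Qed.

Lemma is_dist_samp (V : finType) : (#|V| <= #|N|)%N -> is_dist (@samp V).
Proof.
move=> VN; split => [K|]; first by rewrite divr_ge0.
rewrite -[LHS]/(Pr _ predT) Pr_samp.
have -> : [set f in injs V N | predT (pull f (enc N))]%SET = injs V N.
  by apply/setP => f; rewrite inE andbT.
by rewrite divff// pnatr_eq0 -lt0n card_injs_gt0.
Qed.

Lemma samp_pull (U V : finType) (f : U -> V) : injective f -> (#|V| <= #|N|)%N ->
  push (pull f) (@samp V) =1 @samp U.
Proof.
move=> fi VN K; have UV : (#|U| <= #|V|)%N := leq_card f fi.
rewrite /push Pr_samp /samp.
apply/eqP; rewrite eqr_div ?pnatr_eq0 -?lt0n ?card_injs_gt0 ?(leq_trans UV)//.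
rewrite -!natrM; apply/eqP; congr _%:R.
rewrite -(card_restrict_injs (fun h : {ffun U -> N} => pull h (enc N) == K) fi).
congr (_ * _)%N; apply: eq_card => g; rewrite !inE; congr (_ && (_ == _)).
by rewrite pull_comp; apply: eq_pull => u; rewrite ffunE.
Qed.

(** The probability that independent uniform injections of [U] and [V] have disjoint images. *)
Definition disjoint_ratio (U V : finType) : R :=
  #|injs (U + V)%type N|%:R / (#|injs U N| * #|injs V N|)%:R.

(** An injection of the sum is a pair of independent injections conditioned on disjoint images, and
    conditioning on an event of probability r changes a probability by at most 1 - r. *)
Lemma samp_dissociated (U V : finType) (K : {set tup L U}) (K' : {set tup L V}) :
  (#|U| + #|V| <= #|N|)%N ->
  `|Pr (@samp (U + V)%type) (fun M => (pull inl M == K) && (pull inr M == K')) -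
    samp K * samp K'| <= 1 - disjoint_ratio U V.
Proof.
move=> UVN.
pose A := [set f in injs U N | pull f (enc N) == K]%SET.
pose B := [set f in injs V N | pull f (enc N) == K']%SET.
pose S (h : {ffun U + V -> N}) := (fcomp h inl, fcomp h inr).
have S_inj : injective S.
  move=> h h' [/ffunP E1 /ffunP E2]; apply/ffunP => -[u|v].
    by have := E1 u; rewrite !ffunE.
  by have := E2 v; rewrite !ffunE.
pose D := (S @: injs (U + V)%type N)%SET; pose G := finset.setX (injs U N) (injs V N).
have il : injective (@inl U V) by move=> a b [].
have ir : injective (@inr U V) by move=> a b [].
have DG : D \subset G.
  by apply/fintype.subsetP => _ /imsetP[h hi ->]; rewrite inE /= !fcomp_injs.
pose AB := finset.setX A B.
have ABG : AB \subset G.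
  by apply/fintype.subsetP => -[f g]; rewrite !inE /= => /andP[/andP[-> _] /andP[-> _]].
have G0 : (0 < #|G|)%N.
  rewrite cardsX muln_gt0 !card_injs_gt0//.
    by rewrite (leq_trans _ UVN)// leq_addl.
  by rewrite (leq_trans _ UVN)// leq_addr.
have D0 : (0 < #|D|)%N by rewrite card_imset// card_injs_gt0// card_sum.
have -> : disjoint_ratio U V = #|D|%:R / #|G|%:R.
  by rewrite /disjoint_ratio card_imset// cardsX.
have -> : samp K * samp K' = #|AB|%:R / #|G|%:R.
  by rewrite /samp mulf_div -!natrM -!cardsX.
have -> : Pr (@samp (U + V)%type) (fun M => (pull inl M == K) && (pull inr M == K')) =
    #|(D :&: AB)%SET|%:R / #|D|%:R.
  rewrite Pr_samp; congr (_%:R / _%:R); last by rewrite card_imset.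
  rewrite -(card_imset _ S_inj); apply: eq_card => -[p1 p2].
  have memA f : (f \in A) = (f \in injs U N) && (pull f (enc N) == K) by rewrite finset.in_set.
  have memB f : (f \in B) = (f \in injs V N) && (pull f (enc N) == K') by rewrite finset.in_set.
  rewrite finset.in_setI finset.in_setX memA memB.
  apply/imsetP/andP => [[h + [-> ->]]|[/imsetP[h hi [-> ->]]]].
    rewrite finset.in_set => /andP[hi /andP[/eqP hK /eqP hK']].
    split; first exact: (imset_f S hi).
    rewrite !fcomp_injs//= -hK -hK' !pull_comp.
    by apply/andP; split; apply/eqP/eq_pull => u; rewrite ffunE.
  rewrite /= => /andP[/andP[_ /eqP hK] /andP[_ /eqP hK']]; exists h => //.
  rewrite finset.in_set hi /= -hK -hK' !pull_comp.
  by apply/andP; split; apply/eqP/eq_pull => u; rewrite ffunE.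
have h1 : (#|(D :&: AB)%SET| <= #|AB|)%N by rewrite subset_leq_card// finset.subsetIr.
have h2 : (#|(D :&: AB)%SET| <= #|D|)%N by rewrite subset_leq_card// finset.subsetIl.
have h3 : (#|AB| + #|D| <= #|(D :&: AB)%SET| + #|G|)%N.
  rewrite addnC -cardsUI addnC leq_add2l subset_leq_card//.
  by rewrite finset.subUset DG ABG.
have h4 : (#|D| <= #|G|)%N by exact: subset_leq_card.
move: h1 h2 h3 h4; rewrite -!(ler_nat R) !natrD.
have {}G0 : 0 < #|G|%:R :> R by rewrite ltr0n.
have {}D0 : 0 < #|D|%:R :> R by rewrite ltr0n.
set d := #|D|%:R in D0 *; set g := #|G|%:R in G0 *.
set y := #|(D :&: AB)%SET|%:R; set x := #|AB|%:R.
have y0 : 0 <= y by rewrite ler0n.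
move=> yx yd xdyg dg.
have ydg : y / g <= y / d by rewrite ler_wpM2l// lef_pV2.
have yd1 : y / d <= 1 by rewrite ler_pdivrMr// mul1r.
have dg1 : d / g <= 1 by rewrite ler_pdivrMr// mul1r.
have e1 : x / g <= y / g + 1 - d / g.
  have -> : y / g + 1 - d / g = (y + g - d) / g.
    by rewrite !mulrDl mulNr divff ?gt_eqF.
  by rewrite ler_pM2r ?invr_gt0//; lra.
have e2 : y / d - y / g <= 1 - d / g.
  have -> : y / g = (y / d) * (d / g) by rewrite mulrA divfK ?gt_eqF.
  rewrite -[X in X - _]mulr1 -mulrBr -[leRHS]mul1r ler_wpM2r//; lra.
have e3 : y / g <= x / g by rewrite ler_pM2r ?invr_gt0.
by rewrite ler_norml; apply/andP; split; lra.
Qed.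

End sampling.

(** * Structures, their codes, and models of a universal theory *)

Section structures.
Context (L : language).

Definition dec (V : finType) (K : {set tup L V}) : finstructure L :=
  @FinStructure L V (fun P x =>
    (Tagged (fun P : L => {ffun 'I_(arity P) -> V}) [ffun i => x i] : tup L V) \in K).

Lemma mem_enc (M : finstructure L) P (x : 'I_(arity P) -> M) :
  ((Tagged (fun P : L => {ffun 'I_(arity P) -> M}) [ffun i => x i] : tup L M) \in enc M) <->
  injective x /\ rel_of M P x.
Proof.
have xE : ([ffun i => x i] : {ffun 'I_(arity P) -> M}) = x :> (_ -> _).
  by apply/funext => i; rewrite ffunE.
rewrite inE; split=> [/andP[/injectiveP /= xi /asboolP /= r]|[xi r]].
  by split=> [i j E|]; [apply: xi; rewrite !ffunE|move: r; rewrite xE].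
apply/andP; split; first by apply/injectiveP => i j /=; rewrite !ffunE => /xi.
by apply/asboolP; rewrite /= xE.
Qed.

Lemma enc_dec (V : finType) (K : {set tup L V}) : enc (dec K) = canonical_part K.
Proof.
apply/setP => -[P a]; rewrite !inE andbC /= asboolb.
suff -> : [ffun i => a i] = a by [].
by apply/ffunP => i; rewrite ffunE.
Qed.

Lemma dec_canonical (V : finType) (K : {set tup L V}) :
  canonical_part K = K -> canonical_structure (rel_of (dec K)).
Proof.
move=> KK P x /=; rewrite -KK inE => /andP[_ /injectiveP /= xi] i j xij.
by apply: xi; rewrite !ffunE.
Qed.

Lemma dec_enc (M : finstructure L) : canonical_structure (rel_of M) -> dec (enc M) = M.
Proof.
move=> cM; transitivity (@FinStructure L M (rel_of M)); last by case: M cM.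
apply: (congr1 (@FinStructure L M)); apply/functional_extensionality_dep => P; apply/funext => x; apply/propext.
by rewrite mem_enc; split=> [[]//|r]; split => //; exact: cM r.
Qed.

Lemma holds_comp (U V : Type) (M : structure L V) (f : U -> V) n
    (F : open_formula L n) (x : 'I_n -> U) : injective f ->
  holds (fun P y => M P (f \o y)) x F <-> holds M (f \o x) F.
Proof.
move=> fi; elim: F => //= [i j|F IH|F IH G JH|F IH G JH|F IH G JH].
- by split=> [->|/fi].
- by rewrite IH.
- by rewrite IH JH.
- by rewrite IH JH.
- by rewrite IH JH.
Qed.

Context (T : theory L) (hT : canonical_theory T).

Lemma models_canonical V (M : structure L V) : models T M -> canonical_structure M.
Proof.
move=> hM P x r i j xij; apply: contrapT => ij.
have key (a b : 'I_(arity P)) : (a < b)%N -> x a = x b -> False.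
  by move=> ab xab; exact: (hT ab hM xab).
have [ab|ba|/val_inj//] := ltngtP i j; first exact: key ab xij.
exact: key ba (esym xij).
Qed.

(** Universal axioms pass to induced substructures; canonicity ensures that [enc] has forgotten no
    tuple of [N]. *)
Lemma models_dec_pull (N : finstructure L) (V : finType) (f : V -> N) :
  models T (rel_of N) -> injective f -> models T (rel_of (dec (pull f (enc N)))).
Proof.
move=> hN fi; have E : rel_of (dec (pull f (enc N))) = (fun P x => rel_of N P (f \o x)).
  apply/functional_extensionality_dep => P; apply/funext => x; apply/propext; rewrite /= mem_pull.
  have -> : tmap f (Tagged (fun P : L => {ffun 'I_(arity P) -> V}) [ffun i => x i]) =
      Tagged (fun P : L => {ffun 'I_(arity P) -> N}) [ffun i => (f \o x) i] :> tup L N.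
    by congr existT; apply/ffunP => i; rewrite !ffunE.
  by rewrite mem_enc; split=> [[]//|r]; split => //; exact: models_canonical hN _ _ r.
by rewrite E => phi Tphi x; apply/holds_comp => //; exact: hN.
Qed.

End structures.

(** * Finite densities as sampling probabilities *)

Section densities.
Context (R : realType) (L : language).
Implicit Types (M N : finstructure L).

Lemma pull_enc_eq M N (f : M -> N) : injective f ->
  pull f (enc N) = enc M <-> induced_embedding f.
Proof.
move=> fi; have fE P (x : 'I_(arity P) -> M) :
    tmap f (Tagged (fun P : L => {ffun 'I_(arity P) -> M}) [ffun i => x i]) =
    Tagged (fun P : L => {ffun 'I_(arity P) -> N}) [ffun i => (f \o x) i] :> tup L N.
  by congr existT; apply/ffunP => i; rewrite !ffunE.
split=> [E P x xi|emb].
  have hM := mem_enc x; have hN := mem_enc (f \o x).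
  rewrite -fE -mem_pull E in hN; split=> [r|r].
    by have /hN[] := proj2 hM (conj xi r).
  by have /hM[] := proj2 hN (conj (inj_comp fi xi) r).
apply/setP => -[P a]; have aE : a = [ffun i => a i] by apply/ffunP => i; rewrite ffunE.
rewrite aE mem_pull fE; apply/idP/idP => /mem_enc[xi r]; apply/mem_enc.
  have ai : injective a by move=> i j E; apply: xi; rewrite /= E.
  by split => //; apply/emb.
by split; [exact: inj_comp|apply/emb].
Qed.

Lemma enc_sub_pull M N (f : M -> N) : injective f ->
  enc M \subset pull f (enc N) <-> positive_embedding f.
Proof.
move=> fi; have fE P (x : 'I_(arity P) -> M) :
    tmap f (Tagged (fun P : L => {ffun 'I_(arity P) -> M}) [ffun i => x i]) =
    Tagged (fun P : L => {ffun 'I_(arity P) -> N}) [ffun i => (f \o x) i] :> tup L N.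
  by congr existT; apply/ffunP => i; rewrite !ffunE.
split=> [/fintype.subsetP E P x xi r|emb].
  have /E : (Tagged (fun P : L => {ffun 'I_(arity P) -> M}) [ffun i => x i] : tup L M) \in enc M.
    by apply/mem_enc.
  by rewrite mem_pull fE => /mem_enc[].
apply/fintype.subsetP => -[P a]; have aE : a = [ffun i => a i] by apply/ffunP => i; rewrite ffunE.
rewrite aE mem_pull fE => /mem_enc[xi r]; apply/mem_enc.
by split; [exact: inj_comp|exact: emb].
Qed.

Lemma injections_small M N : (#|N| < #|M|)%N -> injections M N = finset.set0.
Proof.
move=> NM; apply/setP => f; rewrite !inE; apply/negP => /injectiveP/leq_card.
by rewrite leqNgt NM.
Qed.

Lemma tind_fin_samp M N : tind_fin R M N = @samp R L N M (enc M).
Proof.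
rewrite /tind_fin /samp -[injs M N]/(injections M N); case: leqP => MN; last first.
  by rewrite injections_small// cards0 invr0 mulr0.
congr (_%:R / _); apply: eq_card => f; rewrite !inE; apply: andb_id2l => /injectiveP fi.
by apply/asboolP/eqP => /(pull_enc_eq fi).
Qed.

Lemma tinj_fin_samp M N :
  tinj_fin R M N = Pr (@samp R L N M) (fun K => enc M \subset K).
Proof.
rewrite Pr_samp /tinj_fin -[injs M N]/(injections M N); case: leqP => MN; last first.
  by rewrite injections_small// cards0 invr0 mulr0.
congr (_%:R / _); apply: eq_card => f; rewrite !inE; apply: andb_id2l => /injectiveP fi.
by apply/asboolP/idP => /(enc_sub_pull fi).
Qed.

(** Two induced embeddings with the same image differ by an automorphism; canonicity extends the
    equivalence from injective tuples to all tuples. *)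
Lemma card_embeddings_image M N (f0 : {ffun M -> N}) :
  canonical_structure (rel_of M) -> f0 \in injections M N -> induced_embedding f0 ->
  #|[set f in injections M N | `[< induced_embedding f >] &&
      (f @: [set: M] == f0 @: [set: M])%SET]%SET| = #|automorphisms M|.
Proof.
move=> cM; rewrite inE => /injectiveP f0i f0e.
pose c (s : {perm M}) := [ffun v => f0 (s v)].
have ci : injective c.
  by move=> s s' /ffunP E; apply/permP => v; apply: f0i; have := E v; rewrite !ffunE.
rewrite -(card_imset _ ci); apply: eq_card => f; rewrite finset.in_set.
apply/andP/imsetP => [[fi /andP[/asboolP fe /eqP im]]|[s + ->]].
  have {}fi : injective f by apply/injectiveP; rewrite inE in fi.
  have h v : exists u, f0 u == f v.
    have /imsetP[u _ ->] : f v \in (f0 @: [set: M])%SET by rewrite -im imset_f.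
    by exists u.
  pose s v := xchoose (h v); have sE v : f0 (s v) = f v := eqP (xchooseP (h v)).
  have si : injective s by move=> u v E; apply: fi; rewrite -!sE E.
  exists (perm si); last by apply/ffunP => v; rewrite ffunE permE.
  rewrite inE; apply/asboolP; split; first by exists (perm si)^-1%g; [exact: permK|exact: permKV].
  move=> P x; have pE : perm si \o x = s \o x by apply/funext => i /=; rewrite permE.
  rewrite pE; have key : injective x -> rel_of M P x <-> rel_of M P (s \o x).
    move=> xi; rewrite fe// f0e; last exact: inj_comp.
    by have -> : f0 \o (s \o x) = f \o x by apply/funext => i /=.
  split=> r; first by apply/key => //; exact: cM r.
  by apply/key => //; exact: inj_compr (cM _ _ r).
rewrite inE => /asboolP[_ se]; split.
  by rewrite inE; apply/injectiveP => u v; rewrite !ffunE => /f0i/perm_inj.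
apply/andP; split.
  apply/asboolP => P x xi; rewrite se f0e; last exact: inj_comp (@perm_inj _ s) xi.
  by have -> : c s \o x = f0 \o (s \o x) by apply/funext => i /=; rewrite ffunE.
apply/eqP/setP => w; apply/imsetP/imsetP => -[v _ ->].
  by exists (s v) => //; rewrite ffunE.
by exists (s^-1%g v) => //; rewrite ffunE permKV.
Qed.

Lemma isomorphic_induced_on M N (U : {set N}) :
  canonical_structure (rel_of M) -> canonical_structure (rel_of N) ->
  isomorphic (induced_on U) M <->
  exists f : {ffun M -> N},
    [/\ f \in injections M N, induced_embedding f & U = (f @: [set: M])%SET].
Proof.
move=> cM cN; split=> [[g [[h gK hK] ge]]|[f [+ fe ->]]].
  exists [ffun v => val (h v)]; split.
  - by rewrite inE; apply/injectiveP => u v; rewrite !ffunE => /val_inj; exact: can_inj hK u v.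
  - move=> P x _; have -> : [ffun v => val (h v)] \o x = val \o (h \o x).
      by apply/funext => i /=; rewrite ffunE.
    rewrite -[rel_of N P (val \o (h \o x))]/(rel_of (induced_on U) P (h \o x)) ge.
    by have -> : g \o (h \o x) = x by apply/funext => i /=; rewrite hK.
  - apply/setP => v; apply/idP/imsetP => [vU|[u _ ->]]; last by rewrite ffunE; exact: (valP (h u)).
    by exists (g (Sub v vU)) => //; rewrite ffunE gK.
rewrite inE => /injectiveP fi; set U' := (f @: [set: M])%SET.
have hP (v : {v : N | v \in U'}) : exists u, f u == val v.
  by have /imsetP[u _ ->] := valP v; exists u.
pose h v := xchoose (hP v); have hE v : f (h v) = val v := eqP (xchooseP (hP v)).
have hi : injective h by move=> u v E; apply: val_inj; rewrite -!hE E.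
pose g (u : M) : {v : N | v \in U'} := exist _ (f u) (imset_f f (finset.in_setT u)).
have gK : cancel g h by move=> u; apply: fi; rewrite hE.
have hK : cancel h g by move=> v; apply: hi; rewrite gK.
exists h; split; first by exists g.
move=> P x; have fhx : f \o (h \o x) = val \o x by apply/funext => i /=; rewrite hE.
rewrite /= -fhx; split=> r.
  apply/fe => //; apply: inj_compr (f : M -> N) _ _; exact: cN r.
by apply/fe => //; exact: cM r.
Qed.

Lemma automorphisms_gt0 M : (0 < #|automorphisms M|)%N.
Proof.
apply/card_gt0P; exists 1%g; rewrite inE; apply/asboolP; split.
  by exists id => x; rewrite perm1.
by move=> P x; have -> : (1%g : {perm M}) \o x = x by apply/funext => i /=; rewrite perm1.
Qed.

(** A vertex set inducing a copy of [M] is the image of as many embeddings as [M] has automorphisms,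
    while any set of that size is the image of |M|! injections. *)
Lemma p_finE M N : canonical_structure (rel_of M) -> canonical_structure (rel_of N) ->
  p_fin R M N = (#|M| `!)%:R / #|automorphisms M|%:R * tind_fin R M N.
Proof.
move=> cM cN; rewrite /p_fin /tind_fin; case: leqP => MN; last by rewrite mulr0.
rewrite -[#|injections M N|]/(#|injs M N|) card_injs -bin_ffact card_draws.
pose good := [set U : {set N} | (#|U| == #|M|) && `[< isomorphic (induced_on U) M >]]%SET.
pose emb := [set f in injections M N | `[< induced_embedding f >]]%SET.
rewrite -[X in X / _ = _]/(#|good|%:R) -[X in _ = _ * (X / _)]/(#|emb|%:R).
have -> : #|emb| = (#|good| * #|automorphisms M|)%N.
  rewrite -sum1_card (partition_big (fun f : {ffun M -> N} => (f @: [set: M])%SET)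
    (mem good))/=; last first.
    move=> f; rewrite inE => /andP[fi /asboolP fe]; rewrite inE; apply/andP; split.
      by rewrite card_imset ?cardsT//; apply/injectiveP; rewrite inE in fi.
    by apply/asboolP/isomorphic_induced_on => //; exists f.
  rewrite -sum_nat_const; apply: eq_bigr => U; rewrite inE => /andP[_ /asboolP].
  move=> /(isomorphic_induced_on U cM cN)[f0 [f0i f0e ->]].
  rewrite -(card_embeddings_image cM f0i f0e) -sum1_card; apply: eq_bigl => f.
  by rewrite !finset.in_set andbA.
have /lt0r_neq0 A0 : 0 < #|automorphisms M|%:R :> R by rewrite ltr0n automorphisms_gt0.
have /lt0r_neq0 m0 : 0 < (#|M| `!)%:R :> R by rewrite ltr0n fact_gt0.
rewrite !natrM invfM.
by rewrite [RHS]mulrC !mulrA divfK// [RHS]mulrAC mulfK.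
Qed.

End densities.

(** * The error of sampling without replacement *)

Section sampling_error.
Context (R : realType) (L : language).

Lemma ffactD n u v : (n ^_ (u + v) = n ^_ u * (n - u) ^_ v)%N.
Proof.
elim: v => [|v IH]; first by rewrite addn0 ffactn0 muln1.
by rewrite addnS !ffactnSr IH mulnA subnDA.
Qed.

(** Corresponding factors have quotient at least 1 - [e]; the losses add up as in Bernoulli's
    inequality. *)
Lemma ffact_sub_ge (n u v : nat) : (u + v <= n)%N ->
  (1 - v%:R * (u%:R / (n - v)%:R)) * (n ^_ v)%:R <= ((n - u) ^_ v)%:R :> R.
Proof.
move=> uvn; set e := u%:R / _.
have e0 : 0 <= e by rewrite divr_ge0.
have eP j : (j < v)%N -> (1 - e) * (n - j)%:R <= (n - u - j)%:R :> R.
  (* If n = v then u = 0, so [e], a quotient by zero, has the right value 0. *)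
  move=> jv; have nv0 : (n - v = 0)%N -> u = 0%N by lia.
  have -> : (n - u - j)%:R = (n - j)%:R - u%:R :> R by rewrite -natrB; [congr _%:R|]; lia.
  rewrite mulrBl mul1r lerD2l lerN2 /e; have [/nv0 ->|nv] := eqVneq (n - v)%N 0%N.
    by rewrite mul0r mul0r.
  rewrite mulrAC ler_pdivlMr ?ltr0n ?lt0n// ler_wpM2l// ler_nat; lia.
suff h j : (j <= v)%N -> (1 - j%:R * e) * (n ^_ j)%:R <= ((n - u) ^_ j)%:R :> R by exact: h.
elim: j => [|j IH] jv; first by rewrite mul0r subr0 mul1r !ffactn0.
have {IH}h := IH (ltnW jv); have {eP}h' := eP _ jv.
have le : ((n - u) ^_ j)%:R <= (n ^_ j)%:R :> R.
  by rewrite ler_nat !ffact_prod leq_prod// => i _; rewrite leq_sub2r// leq_subr.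
rewrite !ffactnSr !natrM.
have h1 := ler_wpM2l (ler0n R ((n - u) ^_ j)) h'.
apply: le_trans h1; rewrite [leRHS]mulrA [leLHS]mulrA ler_wpM2r//.
apply: (@le_trans _ _ (((n - u) ^_ j)%:R - e * (n ^_ j)%:R)); last first.
  by rewrite mulrBr mulr1 lerD2l lerN2 mulrC ler_wpM2l.
have -> : 1 - j.+1%:R * e = (1 - j%:R * e) - e by rewrite -natr1 mulrDl; lra.
by rewrite mulrBl lerD2r; exact: h.
Qed.

(** The factor #|V| + 1 comes from n <= (#|V| + 1) (n - #|V|), valid for #|V| < n, which trades the
    denominator n - #|V| for n. *)
Definition sampling_error (U V : finType) (n : nat) : R := (#|U| * #|V| * #|V|.+1)%:R / n%:R.

Lemma disjoint_ratio_ge (N : finstructure L) (U V : finType) : (#|U| + #|V| < #|N|)%N ->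
  1 - disjoint_ratio R N U V <= sampling_error U V #|N|.
Proof.
move=> UVN; rewrite /disjoint_ratio !card_injs card_sum ffactD.
have a0 : 0 < (#|N| ^_ #|U|)%:R :> R by rewrite ltr0n ffact_gt0; lia.
have b0 : 0 < (#|N| ^_ #|V|)%:R :> R by rewrite ltr0n ffact_gt0; lia.
rewrite !natrM -mulf_div divff ?gt_eqF// mul1r.
have h := ffact_sub_ge (ltnW UVN).
rewrite lerBlDr -lerBlDl ler_pdivlMr//; apply: le_trans h; rewrite ler_wpM2r ?ler0n//.
rewrite lerD2l lerN2 /sampling_error.
rewrite [leLHS]mulrA -natrM (mulnC #|V|) ler_pdivrMr; last by rewrite ltr0n; lia.
rewrite mulrAC ler_pdivlMr; last by rewrite ltr0n; lia.
by rewrite -!natrM ler_nat -[leqRHS]mulnA leq_mul2l; apply/orP; right; nia.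
Qed.

Lemma samp_dissociated_error (N : finstructure L) (U V : finType) (K : {set tup L U})
    (K' : {set tup L V}) : (#|U| + #|V| < #|N|)%N ->
  `|Pr (@samp R L N (U + V)%type) (fun M => (pull inl M == K) && (pull inr M == K')) -
    @samp R L N U K * @samp R L N V K'| <= sampling_error U V #|N|.
Proof.
move=> UVN; apply: le_trans (disjoint_ratio_ge UVN).
exact: samp_dissociated (ltnW UVN).
Qed.

Lemma sampling_error_cvg0 (U V : finType) (s : nat -> nat) : (forall n, (s n < s n.+1)%N) ->
  sampling_error U V (s n) @[n --> \oo] --> (0 : R).
Proof.
move=> s_incr; have sn n : (n <= s n)%N by elim: n => // n /leq_ltn_trans; exact.
rewrite -(mulr0 ((#|U| * #|V| * #|V|.+1)%:R : R)); apply: cvgMr.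
(* As n <= [s n], the reciprocal of [s n] is at most 2 / (n + 1) for n >= 1. *)
have h2 : 2 * n.+1%:R^-1 @[n --> \oo] --> (0 : R).
  by rewrite -(mulr0 2); apply: cvgMr; exact: cvg_harmonic.
apply: (@squeeze_cvgr _ _ _ _ (fun=> 0) (fun n => 2 * n.+1%:R^-1)); [|exact: cvg_cst|exact: h2].
near=> n; apply/andP; split.
  by rewrite invr_ge0.
have n0 : (0 < n)%N by near: n; exists 1%N.
have s0 : (0 < s n)%N by rewrite (leq_trans n0).
rewrite -[leLHS]mul1r ler_pdivrMr ?ltr0n// mulrAC ler_pdivlMr ?ltr0n// mul1r -natrM ler_nat.
have := sn n; lia.
Unshelve. all: by end_near. Qed.

End sampling_error.

(** * Limit objects of convergent sequences *)

Section limit_law.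
Context (R : realType) (L : language) (N : nat -> finstructure L).
Hypothesis N_incr : forall n, (#|N n| < #|N n.+1|)%N.
Hypothesis N_cvg : forall (V : finType) (K : {set tup L V}),
  cvgn (fun n => @samp R L (N n) V K).

Lemma near_card_ge (m : nat) : \forall n \near \oo, (m <= #|N n|)%N.
Proof.
exists m => // n /= mn; apply: (leq_trans mn).
by elim: {mn} n => // n /leq_ltn_trans; exact.
Qed.

Lemma exists_limit_law : exists w : law L R, forall (V : finType) (K : {set tup L V}),
  @samp R L (N n) V K @[n --> \oo] --> weight w V K.
Proof.
pose w V K := limn (fun n => @samp R L (N n) V K).
have hw V K : @samp R L (N n) V K @[n --> \oo] --> w V K by exact: N_cvg.
have hPr V (B : pred {set tup L V}) : Pr (@samp R L (N n) V) B @[n --> \oo] --> Pr (w V) B.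
  by apply: cvgn_sum => K _; exact: hw.
have w_dist V : is_dist (w V).
  split=> [K|].
    by apply: limr_ge; [exact: hw|near=> n; rewrite divr_ge0].
  have h := hPr V predT; rewrite -[LHS]/(Pr (w V) predT).
  rewrite -(cvg_lim (@Rhausdorff R) h).
  apply: (cvg_lim (@Rhausdorff R)); apply: cvg_near_cst; near=> n.
  by apply: (is_dist_samp _ _).2; near: n; exact: near_card_ge.
have w_pull (U V : finType) (f : U -> V) : injective f -> push (pull f) (w V) =1 w U.
  move=> fi K; rewrite /push -(cvg_lim (@Rhausdorff R) (hPr V (fun M => pull f M == K))).
  apply: (cvg_lim (@Rhausdorff R)); apply: cvg_trans (hw U K); apply: near_eq_cvg.
  near=> n; apply/esym/samp_pull => //; near: n; exact: near_card_ge.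
have w_dissociated (U V : finType) (K : {set tup L U}) (K' : {set tup L V}) :
    Pr (w (U + V)%type) (fun M => (pull inl M == K) && (pull inr M == K')) = w U K * w V K'.
  pose B (M : {set tup L (U + V)%type}) := (pull inl M == K) && (pull inr M == K').
  have h1 : Pr (@samp R L (N n) (U + V)%type) B - @samp R L (N n) U K * @samp R L (N n) V K'
      @[n --> \oo] --> Pr (w (U + V)%type) B - w U K * w V K'.
    by apply: cvgB; [exact: hPr|apply: cvgM; exact: hw].
  have h2 : Pr (@samp R L (N n) (U + V)%type) B -
      @samp R L (N n) U K * @samp R L (N n) V K' @[n --> \oo] --> (0 : R).
    apply/norm_cvg0P; apply: (@squeeze_cvgr _ _ _ _ (fun=> 0)
      (fun n => sampling_error R U V #|N n|)); [|exact: cvg_cst|exact: sampling_error_cvg0].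
    near=> n; rewrite normr_ge0 /=; apply: samp_dissociated_error.
    by near: n; exact: near_card_ge.
  apply/eqP; rewrite -subr_eq0; apply/eqP.
  by rewrite -(cvg_lim (@Rhausdorff R) h1) (cvg_lim (@Rhausdorff R) h2).
by exists (Law w_dist w_pull w_dissociated).
Unshelve. all: by end_near. Qed.

End limit_law.

(** * Convergence of densities and of sampling distributions *)

Section convergence_from_samples.
Context (R : realType) (L : language) (T : theory L) (hT : canonical_theory T).

Lemma samp_canonical (N : finstructure L) (V : finType) (K : {set tup L V}) :
  models T (rel_of N) -> @samp R L N V K != 0 ->
  canonical_part K = K /\ models T (rel_of (dec K)).
Proof.
move=> hN; rewrite /samp; have [->|[f]] := set_0Vmem [set f in injs V N | pull f (enc N) == K]%SET.
  by rewrite cards0 mul0r eqxx.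
rewrite finset.in_set => /andP[/mem_injs fi /eqP <-] _.
split; last exact: models_dec_pull.
apply/setP => t; rewrite inE; apply: andb_idr; rewrite mem_pull inE => /andP[/injectiveP ti _].
by apply/injectiveP => i j tij; apply: ti; rewrite !ffunE tij.
Qed.

Lemma p_fin_models (N : nat -> finstructure L) (M : finstructure L) :
  (forall n, models T (rel_of (N n))) -> models T (rel_of M) ->
  (fun n => p_fin R M (N n)) =
  (fun n => (#|M| `!)%:R / #|automorphisms M|%:R * tind_fin R M (N n)).
Proof.
by move=> hN hM; apply/funext => n; rewrite p_finE//; exact: (models_canonical hT).
Qed.

Lemma converges_to_samp (N : nat -> finstructure L) (w : law L R) (E : euclidean_structure R L) :
  (forall n, models T (rel_of (N n))) ->
  (forall (V : finType) (K : {set tup L V}),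
    @samp R L (N n) V K @[n --> \oo] --> weight w V K) ->
  (forall M : finstructure L, tind_euc M E = weight w M (enc M)) ->
  (forall M : finstructure L, tinj_euc M E = Pr (weight w M) (fun K => enc M \subset K)) ->
  converges_to T N E.
Proof.
move=> hN hw hind hinj M hM.
have h : tind_fin R M (N n) @[n --> \oo] --> tind_euc M E.
  by rewrite hind; under eq_fun do rewrite tind_fin_samp; exact: hw.
split => //.
  rewrite (p_fin_models hN hM); exact: cvgMr.
rewrite hinj; under eq_fun do rewrite tinj_fin_samp.
by apply: cvgn_sum => K _; exact: hw.
Qed.

(** A set that does not code a model of [T] is never sampled; for the others the sampling weight is
    [tind_fin], a fixed multiple of p, whose convergence is given. *)
Lemma samp_cvg (N : nat -> finstructure L) : (forall n, models T (rel_of (N n))) ->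
  convergent R T N -> forall (V : finType) (K : {set tup L V}), cvgn (fun n => @samp R L (N n) V K).
Proof.
move=> hN [_ hp] V K.
have [[KK hK]|nK] := pselect (canonical_part K = K /\ models T (rel_of (dec K))); last first.
  rewrite (_ : (fun n => _) = fun=> 0 : R); first exact: is_cvg_cst.
  by apply/funext => n; apply: contrapT => /eqP /(samp_canonical (hN n)).
have := hp _ hK; rewrite (p_fin_models hN hK).
set c : R := _ / _ => h.
have c0 : c != 0.
  by rewrite mulf_neq0// ?invr_eq0 pnatr_eq0 -lt0n ?fact_gt0// automorphisms_gt0.
have {}h : c^-1 * (c * tind_fin R (dec K) (N n)) @[n --> \oo] -->
    c^-1 * limn (fun n => c * tind_fin R (dec K) (N n)) by apply: cvgMr; exact: h.
apply: cvgP; apply: cvg_trans h; apply: near_eq_cvg; near=> n.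
by rewrite mulKf// tind_fin_samp enc_dec KK.
Unshelve. all: by end_near. Qed.

End convergence_from_samples.

Section euclidean_structure_of_borel_sets.
Context (R : realType) (L : language).
Context (pe : forall P : L, set (cspace R (rset 'I_(arity P)))).
Hypothesis mpe : forall P, measurable (@pe P).

Lemma lebesgue_measurable_borel (I : finType) (A : set (cspace R I)) :
  measurable A -> lebesgue_measurable A.
Proof.
move=> mA; exists (@tuple_fun R I @^-1` A).
  by rewrite -[X in measurable X]setTI; exact: measurable_tuple_fun.
by exists set0; [exact: negligible_set0|rewrite setU0].
Qed.

Lemma measurable_euclid (V : finType) : measurable (euclid R V : set (cspace R (rset V))).
Proof. exact: (@measurable_box _ _ (fun=> `[0, 1]%classic)). Qed.

(** The intersection with the cube is forced by [peon_sub] and changes each set only by a null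
    set. *)
Definition borel_euc : euclidean_structure R L :=
  @EuclideanStructure R L (fun P => @pe P `&` euclid R _)
    (fun P => @subIsetr _ _ _)
    (fun P => lebesgue_measurable_borel (measurableI _ _ (@mpe P) (@measurable_euclid _))).

Lemma borel_version_borel_euc : exists Npe : forall P : L, set (cspace R (rset 'I_(arity P))),
  forall P, borel_version (peon borel_euc P) (@pe P) (@Npe P).
Proof.
exists (fun P => ~` (euclid R _ : set (cspace R (rset 'I_(arity P))))) => P.
have h : {ae lam R (rset 'I_(arity P)), forall x, forall A : rset 'I_(arity P), 0 <= x A < 1}.
  by apply: filter_forall => A; exact: lam_coord_itv.
have mE := measurableC (@measurable_euclid 'I_(arity P)); split.
- exact: mpe.
- exact: mE.
- have [M [mM M0 sM]] := h; apply/eqP; rewrite -measure_le0 -M0; apply: le_measure.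
  + by rewrite inE; exact: mE.
  + by rewrite inE; exact: mM.
  + move=> x nx; apply: sM => x01; apply: nx => A; rewrite in_itv /=.
    by have /andP[-> /ltW ->] := x01 A.
- by move=> x /contrapT ex; split=> [[]|].
Qed.

End euclidean_structure_of_borel_sets.

Section limit_object.
Context (R : realType) (L : language) (T : theory L) (hT : canonical_theory T).

Lemma exists_limit_object (N : nat -> finstructure L) :
  (forall n, models T (rel_of (N n))) -> convergent R T N ->
  exists E : euclidean_structure R L, weak_on T E /\ converges_to T N E.
Proof.
move=> hN cN; have [w hw] := exists_limit_law cN.1 (samp_cvg hT hN cN).
have w_models (V : finType) (K : {set tup L V}) : weight w V K != 0 ->
    canonical_part K = K /\ models T (rel_of (dec K)).
  move=> wK; apply: contrapT => nK; move/eqP: wK; apply.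
  rewrite -(cvg_lim (@Rhausdorff R) (hw V K)) (_ : (fun n => _) = fun=> 0 : R).
    exact: lim_cst.
  by apply/funext => n; apply: contrapT => /eqP /(samp_canonical hT (hN n)).
have [c hc] := exists_fixed_law (fun V K wK => (w_models V K wK).1).
pose E := borel_euc (measurable_fixed_peon w c).
have [Npe NpeE] := borel_version_borel_euc (measurable_fixed_peon w c).
have wE V : weight (fixed_law w c) V = weight w V by apply/funext => K; exact: hc.
have hind M : tind_euc M E = weight w M (enc M).
  by rewrite (tind_euc_law (measurable_fixed_peon w c) NpeE) -wE.
have hinj M : tinj_euc M E = Pr (weight w M) (fun K => enc M \subset K).
  by rewrite (tinj_euc_law (measurable_fixed_peon w c) NpeE) -wE.
exists E; split; last exact: (converges_to_samp hT hN hw hind hinj).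
move=> M cM nM; rewrite hind; apply: contrapT => /eqP /w_models[_].
by rewrite dec_enc.
Qed.

End limit_object.

(** * Sampling from a limit object *)

Section first_moment.
Context (R : realType) (S : finType) (P : S -> R) (hP : is_dist P).

Lemma Ex_sum (I : Type) (r : seq I) (Q : pred I) (F : I -> S -> R) :
  Ex P (fun s => \sum_(i <- r | Q i) F i s) = \sum_(i <- r | Q i) Ex P (F i).
Proof.
by rewrite /Ex exchange_big; apply: eq_bigr => s _; rewrite mulr_sumr.
Qed.

(** The point found must have positive probability, since this is what makes the sampled structure a
    model. *)
Lemma exists_le_Ex (F : S -> R) (c : R) : Ex P F <= c -> exists s, P s != 0 /\ F s <= c.
Proof.
move=> Fc; apply: contrapT => nex.
have gt s : P s != 0 -> c < F s.
  by move=> Ps; rewrite ltNge; apply/negP => Fs; apply: nex; exists s.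
have term_ge0 s : 0 <= P s * (F s - c).
  have [->|/gt cF] := eqVneq (P s) 0; first by rewrite mul0r.
  by rewrite mulr_ge0 ?hP.1// subr_ge0 ltW.
have sum0 : \sum_s P s * (F s - c) = 0.
  apply/eqP; rewrite eq_le sumr_ge0 ?andbT//.
  by rewrite -[leLHS]/(Ex P (fun s => F s - c)) ExB Ex_cst// subr_le0.
suff P0 s : P s = 0 by have := hP.2; rewrite big1// => /esym/eqP; rewrite oner_eq0.
apply/eqP; apply: contrapT => /negP Ps.
have /eqP : P s * (F s - c) = 0 by apply: (psumr_eq0P (fun s _ => term_ge0 s) sum0).
by rewrite mulf_eq0 (negbTE Ps) subr_eq0 gt_eqF ?gt.
Qed.

End first_moment.

Section random_models.
Context (R : realType) (L : language) (w : law L R).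
Hypothesis w_canonical : forall (V : finType) (K : {set tup L V}),
  weight w V K != 0 -> canonical_part K = K.

(** For each fixed injection the restriction of the random structure has law [weight w V]; averaging
    over injections keeps the mean. *)
Lemma Ex_Pr_samp (W V : finType) (B : pred {set tup L V}) : (#|V| <= #|W|)%N ->
  Ex (weight w W) (fun K => Pr (@samp R L (dec K) V) B) = Pr (weight w V) B.
Proof.
move=> VW; pose c : R := #|injs V W|%:R.
transitivity (Ex (weight w W) (fun K => c^-1 * \sum_(f in injs V W) (B (pull f K))%:R)).
  apply: eq_bigr => K _; have [->|/w_canonical KK] := eqVneq (weight w W K) 0.
    by rewrite !mul0r.
  congr (_ * _); rewrite Pr_samp enc_dec KK mulrC; congr (_ * _).
  rewrite -sum1_card natr_sum [RHS]big_mkcond [LHS]big_mkcond; apply: eq_bigr => f _.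
  by rewrite finset.in_set; case: (f \in _) => //=; case: (B _).
rewrite ExZ Ex_sum (eq_bigr (fun=> Pr (weight w V) B)); last first.
  move=> f /mem_injs fi; rewrite (ExPr _ (fun K => B (pull f K))).
  by rewrite -(Pr_push (pull f) _ B); apply: eq_bigr => K _; exact: law_pull.
rewrite sumr_const -mulr_natl mulKf// pnatr_eq0 -lt0n card_injs ffact_gt0; exact: VW.
Qed.

(** The square of a sampling frequency is, up to [sampling_error], a frequency on two disjoint
    copies of [V], whose mean is the square of [weight w V K0] by dissociation. So the variance is
    at most the error. *)
Lemma samp_second_moment (W V : finType) (K0 : {set tup L V}) : (#|V| + #|V| < #|W|)%N ->
  Ex (weight w W) (fun K => (@samp R L (dec K) V K0 - weight w V K0) ^+ 2) <=
  sampling_error R V V #|W|.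
Proof.
move=> VW; set a := weight w V K0; pose s K := @samp R L (@dec L W K) V K0.
pose B (M : {set tup L (V + V)%type}) := (pull inl M == K0) && (pull inr M == K0).
have Es : Ex (weight w W) s = a.
  rewrite /a -(Pr_pred1 (weight w V)) -(@Ex_Pr_samp W); last by lia.
  by apply: eq_Ex => K; rewrite Pr_pred1.
have Es2 : Ex (weight w W) (fun K => s K ^+ 2) <= a ^+ 2 + sampling_error R V V #|W|.
  have <- : Pr (weight w (V + V)%type) B = a ^+ 2 by rewrite expr2 -law_dissociated.
  rewrite -(@Ex_Pr_samp W); last by rewrite card_sum ltnW.
  have hw := law_dist w W; rewrite -[X in _ + X](Ex_cst hw) -ExD; apply: ler_Ex => // K.
  have := @samp_dissociated_error R L (dec K) V V K0 K0 VW.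
  by rewrite -expr2 -/B -/(s K) ler_norml => /andP[+ _]; lra.
rewrite (@eq_Ex _ _ _ _ (fun K => s K ^+ 2 - ((a *+ 2) * s K - a ^+ 2))); last first.
  by move=> K; rewrite -/(s K) sqrrB; lra.
rewrite ExB ExB ExZ Ex_cst; last exact: law_dist.
rewrite Es; lra.
Qed.

Lemma exists_good_sample (n b : nat) : exists m, exists K : {set tup L 'I_m},
  [/\ (b < m)%N, weight w 'I_m K != 0 & forall i, (i <= n)%N -> forall K0 : {set tup L 'I_i},
    `|@samp R L (dec K) 'I_i K0 - weight w 'I_i K0| <= n.+1%:R^-1].
Proof.
have err0 : \sum_(i < n.+1) \sum_(K0 : {set tup L 'I_i}) sampling_error R 'I_i 'I_i m
    @[m --> \oo] --> \sum_(i < n.+1) \sum_(K0 : {set tup L 'I_i}) (0 : R).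
  apply: cvgn_sum => i _; apply: cvgn_sum => K0 _.
  exact: (@sampling_error_cvg0 R 'I_i 'I_i id).
have {}err0 : \forall m \near \oo, \sum_(i < n.+1) \sum_(K0 : {set tup L 'I_i})
    sampling_error R 'I_i 'I_i m <= n.+1%:R^-1 ^+ 2.
  rewrite !big1 in err0; last by move=> i _; rewrite big1.
  by apply: (cvgr_le _ err0); rewrite exprn_gt0// invr_gt0.
(* The bound n + n < m makes the variance estimate available for all orders i <= n. A single sum of
   squares controls every deviation, each being one of its terms. *)
have [m [mb mn me]] : exists m, [/\ (b < m)%N, (n + n < m)%N &
    \sum_(i < n.+1) \sum_(K0 : {set tup L 'I_i}) sampling_error R 'I_i 'I_i m <= n.+1%:R^-1 ^+ 2].
  have [k _ hk] := err0; exists (maxn k (maxn b.+1 (n + n).+1)); split.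
  - by rewrite !leq_max leqnn orbT.
  - by rewrite !leq_max leqnn !orbT.
  - by apply: hk; rewrite /= leq_maxl.
pose F i (K0 : {set tup L 'I_i}) (K : {set tup L 'I_m}) : R :=
  (@samp R L (dec K) 'I_i K0 - weight w 'I_i K0) ^+ 2.
have hw := law_dist w 'I_m.
have EF : Ex (weight w 'I_m) (fun K => \sum_(i < n.+1) \sum_(K0 : {set tup L 'I_i}) F i K0 K)
    <= n.+1%:R^-1 ^+ 2.
  rewrite Ex_sum; apply: le_trans me; apply: ler_sum => i _; rewrite Ex_sum.
  apply: ler_sum => K0 _; have := @samp_second_moment 'I_m 'I_i K0.
  by rewrite !card_ord; apply; have := ltn_ord i; lia.
have [K [wK FK]] := exists_le_Ex hw EF.
exists m, K; split => // i; rewrite -ltnS => i_n K0.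
have F0 j K1 : 0 <= F j K1 K by exact: sqr_ge0.
have : F i K0 K <= n.+1%:R^-1 ^+ 2.
  apply: le_trans FK; rewrite (bigD1 (Ordinal i_n))//= (bigD1 K0)//= -addrA lerDl.
  by rewrite addr_ge0// sumr_ge0// => j _; rewrite sumr_ge0.
by rewrite /F -real_normK ?num_real// ler_pXn2r// nnegrE invr_ge0.
Qed.

Lemma samp_cvg_ord (N : nat -> finstructure L) :
  (forall n, (#|N n| < #|N n.+1|)%N) ->
  (forall n i, (i <= n)%N -> forall K0 : {set tup L 'I_i},
    `|@samp R L (N n) 'I_i K0 - weight w 'I_i K0| <= n.+1%:R^-1) ->
  forall (V : finType) (K : {set tup L V}),
  @samp R L (N n) V K @[n --> \oo] --> weight w V K.
Proof.
move=> N_incr hN V K.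
have hord i (K0 : {set tup L 'I_i}) : @samp R L (N n) 'I_i K0 @[n --> \oo] --> weight w 'I_i K0.
  apply/cvgrPdist_le => e e0.
  have he : \forall n \near \oo, n.+1%:R^-1 <= e by have := @cvg_harmonic R; move/cvgr_le/(_ _ e0).
  near=> n; rewrite distrC.
  apply: (le_trans (hN n i _ K0)); first by near: n; exists i.
  by near: n; exact: he.
have fi : injective (@enum_rank V) by exact: enum_rank_inj.
rewrite -(law_pull w fi); apply: cvg_trans (_ : Pr (@samp R L (N n) 'I_#|V|)
  (fun M => pull enum_rank M == K) @[n --> \oo] --> _); last first.
  by apply: cvgn_sum => K0 _; exact: hord.
apply: near_eq_cvg; near=> n; apply: samp_pull => //.
by rewrite card_ord; near: n; exact: near_card_ge.
Unshelve. all: by end_near. Qed.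

End random_models.

Section sampling_from_limit_object.
Context (R : realType) (L : language) (T : theory L) (hT : canonical_theory T).

Lemma exists_convergent_models (E : euclidean_structure R L) : weak_on T E ->
  exists N : nat -> finstructure L,
    [/\ forall n, models T (rel_of (N n)), convergent R T N & converges_to T N E].
Proof.
move=> hE; have [pe [mpe [Npe peE]]] : exists pe : forall P : L, set (cspace R (rset 'I_(arity P))),
    (forall P, measurable (@pe P)) /\
    exists Npe : forall P : L, set (cspace R (rset 'I_(arity P))),
      forall P, borel_version (peon E P) (@pe P) (@Npe P).
  have [pe hpe] := exists_borel_peons E; exists pe; split.
    by move=> P; have [N []] := hpe P.
  by exists (fun P => projT1 (cid (hpe P))) => P; case: cid.
pose w := euc_law mpe; have hind := tind_euc_law mpe peE; have hinj := tinj_euc_law mpe peE.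
have w_canonical (V : finType) (K : {set tup L V}) : weight w V K != 0 -> canonical_part K = K.
  move=> /eqP wK; have [x <-] : exists x, euc_str pe x = K.
    apply: contrapT => nex; apply: wK; rewrite /= /rv_law (_ : [set x | _] = set0) ?measure0//.
    by apply/seteqP; split => x //= xK; apply: nex; exists x.
  by apply/setP => t; rewrite !inE andbAC andbb.
(* A canonical [K] has weight equal to the induced density of [dec K], which vanishes in a weak T-on
   unless [dec K] is a model. *)
have w_models (V : finType) (K : {set tup L V}) : weight w V K != 0 -> models T (rel_of (dec K)).
  move=> wK; apply: contrapT => nK; have KK := w_canonical _ _ wK.
  move/eqP : wK; apply; rewrite -[in LHS]KK -enc_dec.
  by rewrite -(hind (dec K)); apply: hE => //; exact: dec_canonical.
have next n b : exists M : finstructure L, [/\ (b < #|M|)%N, models T (rel_of M) &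
    forall i, (i <= n)%N -> forall K0 : {set tup L 'I_i},
    `|@samp R L M 'I_i K0 - weight w 'I_i K0| <= n.+1%:R^-1].
  have [m [K [bm wK hK]]] := exists_good_sample w_canonical n b.
  by exists (dec K); split; [rewrite card_ord|exact: w_models|].
pose g n b := projT1 (cid (next n b)).
have gP n b := projT2 (cid (next n b)).
(* Each term must have more vertices than the preceding one and approximate all orders up to n
   within 1 / (n + 1). *)
pose N := fix N n := if n is n'.+1 then g n'.+1 #|N n'| else g 0%N 0%N.
have NP n : models T (rel_of (N n)) /\
    forall i, (i <= n)%N -> forall K0 : {set tup L 'I_i},
    `|@samp R L (N n) 'I_i K0 - weight w 'I_i K0| <= n.+1%:R^-1.
  by case: n => [|n]; [have [] := gP 0%N 0%N|have [] := gP n.+1 #|N n|].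
have N_incr n : (#|N n| < #|N n.+1|)%N by have [] := gP n.+1 #|N n|.
have hN n := (NP n).1.
have cN := converges_to_samp hT hN (samp_cvg_ord N_incr (fun n => (NP n).2)) hind hinj.
by exists N; split => //; split => // M /cN[h _ _]; exact: cvgP h.
Qed.

End sampling_from_limit_object.

Theorem theorem3p4 (R : realType) (L : language) (T : theory L)
    (hT : canonical_theory T) :
  (forall N : nat -> finstructure L,
     (forall n, models T (rel_of (N n))) ->
     convergent R T N ->
     exists E : euclidean_structure R L,
       weak_on T E /\ converges_to T N E)
  /\
  (forall E : euclidean_structure R L,
     weak_on T E ->
     exists N : nat -> finstructure L,
       [/\ forall n, models T (rel_of (N n)),
           convergent R T N &
           converges_to T N E]).
Proof.
split=> [N|E]; first exact: exists_limit_object.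
exact: exists_convergent_models.
Qed.
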